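(* Let $\mathcal L$: $u_t=A(t,x)u_{xx}+B(t,x)u_x+C(t,x)u$ be any equation with analytic $A,B,C$, $A\neq0$. Up to equivalence of operators and up to equivalence of solution families, there is a one-to-one correspondence between the reduction operators of $\mathcal L$ with nonzero coefficient of $\partial_t$ and the two-parametric families of solutions of $\mathcal L$ of the form $$u=c_1v^1(t,x)+c_2v^2(t,x)+v^3(t,x),$$ where $c_1,c_2$ are constant parameters. Namely, each such operator $Q$ corresponds to the family of all solutions of $\mathcal L$ that are invariant with respect to $Q$. (Thus the problem of constructing all two-parametric solution families of $\mathcal L$ that are linear in the parameters is completely equivalent to the problem of exhaustively describing the reduction operators of $\mathcal L$ with nonzero coefficient of $\partial_t$.)
   Context: All considerations are local: functions are smooth (or analytic) on a suitable domain, which may be shrunk so that expressions not vanishing identically do not vanish. Write $Lu:=u_t-Au_{xx}-Bu_x-Cu$. A reduction operator (nonclassical symmetry) of $\mathcal L$ is an operator $Q=\tau\partial_t+\xi\partial_x+\eta\partial_u$ with coefficients depending on $(t,x,u)$, $(\tau,\xi)\ne(0,0)$, such that $Q_{(2)}(Lu)=0$ holds on the subset of the second-order jet space defined by $Lu=0$, $Q[u]=0$, $D_tQ[u]=0$, $D_xQ[u]=0$. Here $Q[u]=\eta-\tau u_t-\xi u_x$ is the characteristic of $Q$, $Q_{(2)}$ is the standard second prolongation of $Q$, and $D_t,D_x$ are total derivatives. Two operators are equivalent if they differ by a nonvanishing multiplier $\lambda(t,x,u)$. A function $u(t,x)$ is $Q$-invariant if it satisfies $Q[u]=0$. A family $u=c_1v^1+c_2v^2+v^3$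 is called two-parametric if both parameters are essential, i.e. $v^1,v^2$ are linearly independent. Two families are equivalent (and identified) if they consist of the same solutions and differ only by parameterization. *)

(* Defs.v *)
(* Stdlib reals with Coquelicot. *)
From Stdlib Require Import Reals.
From Coquelicot Require Import Coquelicot.
Open Scope R_scope.

(* Coquelicot's [is_connected] only covers subsets of R (intervals). *)
Definition connected_set {T : UniformSpace} (S : T -> Prop) : Prop :=
  forall V W : T -> Prop, open V -> open W ->
    (forall p, S p -> V p \/ W p) ->
    (exists p, S p /\ V p) -> (exists p, S p /\ W p) ->
    exists p, S p /\ V p /\ W p.

Definition region {T : UniformSpace} (S : T -> Prop) : Prop :=
  open S /\ connected_set S /\ (exists p, S p).

Definition subset {T : Type} (S S' : T -> Prop) : Prop :=
  forall p, S p -> S' p.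

Definition cylinder (U : R * R -> Prop) (I : R -> Prop) : R * R * R -> Prop :=
  fun p => U (fst p) /\ I (snd p).

(* The power series are summed by total degree; absolute convergence makes the
   order of summation irrelevant. *)
Definition analytic2 (U : R * R -> Prop) (f : R -> R -> R) : Prop :=
  forall t x, U (t, x) ->
  exists (a : nat -> nat -> R) (r : posreal),
  forall h k, Rabs h < r -> Rabs k < r ->
    let term n i := a i (n - i)%nat * h ^ i * k ^ (n - i) in
    ex_series (fun n => sum_n (fun i => Rabs (term n i)) n) /\
    is_series (fun n => sum_n (term n) n) (f (t + h) (x + k)).

Definition analytic3 (D : R * R * R -> Prop) (f : R -> R -> R -> R) : Prop :=
  forall t x u, D (t, x, u) ->
  exists (a : nat -> nat -> nat -> R) (r : posreal),
  forall h k l, Rabs h < r -> Rabs k < r -> Rabs l < r ->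
    let term n i j :=
      a i j (n - i - j)%nat * h ^ i * k ^ j * l ^ (n - i - j) in
    ex_series (fun n =>
      sum_n (fun i => sum_n (fun j => Rabs (term n i j)) (n - i)) n) /\
    is_series (fun n => sum_n (fun i => sum_n (term n i) (n - i)) n)
      (f (t + h) (x + k) (u + l)).

(* A point (t, x, u, u_t, u_x, u_tt, u_tx, u_xx) of the second-order jet
   space. *)
Record jet := Jet
  { jt : R; jx : R; ju : R; jut : R; jux : R; jutt : R; jutx : R; juxx : R }.

Definition d_t (F : jet -> R) (j : jet) : R := Derive (fun s =>
  F (Jet s (jx j) (ju j) (jut j) (jux j) (jutt j) (jutx j) (juxx j))) (jt j).
Definition d_x (F : jet -> R) (j : jet) : R := Derive (fun s =>
  F (Jet (jt j) s (ju j) (jut j) (jux j) (jutt j) (jutx j) (juxx j))) (jx j).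
Definition d_u (F : jet -> R) (j : jet) : R := Derive (fun s =>
  F (Jet (jt j) (jx j) s (jut j) (jux j) (jutt j) (jutx j) (juxx j))) (ju j).
Definition d_ut (F : jet -> R) (j : jet) : R := Derive (fun s =>
  F (Jet (jt j) (jx j) (ju j) s (jux j) (jutt j) (jutx j) (juxx j))) (jut j).
Definition d_ux (F : jet -> R) (j : jet) : R := Derive (fun s =>
  F (Jet (jt j) (jx j) (ju j) (jut j) s (jutt j) (jutx j) (juxx j))) (jux j).
Definition d_utt (F : jet -> R) (j : jet) : R := Derive (fun s =>
  F (Jet (jt j) (jx j) (ju j) (jut j) (jux j) s (jutx j) (juxx j))) (jutt j).
Definition d_utx (F : jet -> R) (j : jet) : R := Derive (fun s =>
  F (Jet (jt j) (jx j) (ju j) (jut j) (jux j) (jutt j) s (juxx j))) (jutx j).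
Definition d_uxx (F : jet -> R) (j : jet) : R := Derive (fun s =>
  F (Jet (jt j) (jx j) (ju j) (jut j) (jux j) (jutt j) (jutx j) s)) (juxx j).

(* Total derivatives, truncated at second order: they are only applied to
   functions that do not depend on u_tt, u_tx, u_xx. *)
Definition Dtot_t (F : jet -> R) (j : jet) : R :=
  d_t F j + jut j * d_u F j + jutt j * d_ut F j + jutx j * d_ux F j.
Definition Dtot_x (F : jet -> R) (j : jet) : R :=
  d_x F j + jux j * d_u F j + jutx j * d_ut F j + juxx j * d_ux F j.

(* The operator tau * d/dt + xi * d/dx + eta * d/du. *)
Record operator := Operator
  { tau : R -> R -> R -> R; xi : R -> R -> R -> R; eta : R -> R -> R -> R }.

Definition on_jet (f : R -> R -> R -> R) (j : jet) : R :=
  f (jt j) (jx j) (ju j).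

Definition characteristic (Q : operator) (j : jet) : R :=
  on_jet (eta Q) j - on_jet (tau Q) j * jut j - on_jet (xi Q) j * jux j.

(* Coefficients of the second prolongation, by the recursion
   eta^(a,b) = D_b eta^a - u_(a,t) D_b tau - u_(a,x) D_b xi. *)
Definition eta_t (Q : operator) (j : jet) : R :=
  Dtot_t (on_jet (eta Q)) j
  - jut j * Dtot_t (on_jet (tau Q)) j - jux j * Dtot_t (on_jet (xi Q)) j.
Definition eta_x (Q : operator) (j : jet) : R :=
  Dtot_x (on_jet (eta Q)) j
  - jut j * Dtot_x (on_jet (tau Q)) j - jux j * Dtot_x (on_jet (xi Q)) j.
Definition eta_tt (Q : operator) (j : jet) : R :=
  Dtot_t (eta_t Q) j
  - jutt j * Dtot_t (on_jet (tau Q)) j - jutx j * Dtot_t (on_jet (xi Q)) j.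
Definition eta_tx (Q : operator) (j : jet) : R :=
  Dtot_x (eta_t Q) j
  - jutt j * Dtot_x (on_jet (tau Q)) j - jutx j * Dtot_x (on_jet (xi Q)) j.
Definition eta_xx (Q : operator) (j : jet) : R :=
  Dtot_x (eta_x Q) j
  - jutx j * Dtot_x (on_jet (tau Q)) j - juxx j * Dtot_x (on_jet (xi Q)) j.

Definition prolong2 (Q : operator) (F : jet -> R) (j : jet) : R :=
  on_jet (tau Q) j * d_t F j + on_jet (xi Q) j * d_x F j
  + on_jet (eta Q) j * d_u F j
  + eta_t Q j * d_ut F j + eta_x Q j * d_ux F j
  + eta_tt Q j * d_utt F j + eta_tx Q j * d_utx F j + eta_xx Q j * d_uxx F j.

Definition Lop (A B C : R -> R -> R) (j : jet) : R :=
  jut j - A (jt j) (jx j) * juxx j - B (jt j) (jx j) * jux j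
  - C (jt j) (jx j) * ju j.

Definition reduction_operator (A B C : R -> R -> R)
    (D : R * R * R -> Prop) (Q : operator) : Prop :=
  analytic3 D (tau Q) /\ analytic3 D (xi Q) /\ analytic3 D (eta Q) /\
  (exists t x u, D (t, x, u) /\ (tau Q t x u <> 0 \/ xi Q t x u <> 0)) /\
  (forall j : jet, D (jt j, jx j, ju j) ->
     Lop A B C j = 0 -> characteristic Q j = 0 ->
     Dtot_t (characteristic Q) j = 0 -> Dtot_x (characteristic Q) j = 0 ->
     prolong2 Q (Lop A B C) j = 0).

Definition nonvanishing (D : R * R * R -> Prop) (f : R -> R -> R -> R) : Prop :=
  forall t x u, D (t, x, u) -> f t x u <> 0.

Definition operator_equiv (D : R * R * R -> Prop) (Q Q' : operator) : Prop :=
  exists lambda : R -> R -> R -> R,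
    analytic3 D lambda /\ nonvanishing D lambda /\
    forall t x u, D (t, x, u) ->
      tau Q' t x u = lambda t x u * tau Q t x u /\
      xi Q' t x u = lambda t x u * xi Q t x u /\
      eta Q' t x u = lambda t x u * eta Q t x u.

Definition jet_of (f : R -> R -> R) (t x : R) : jet :=
  let ft t x := Derive (fun s => f s x) t in
  let fx t x := Derive (fun y => f t y) x in
  Jet t x (f t x) (ft t x) (fx t x)
    (Derive (fun s => ft s x) t) (Derive (fun y => ft t y) x)
    (Derive (fun y => fx t y) x).

Definition solution (A B C : R -> R -> R)
    (U : R * R -> Prop) (f : R -> R -> R) : Prop :=
  analytic2 U f /\ forall t x, U (t, x) -> Lop A B C (jet_of f t x) = 0.

Definition invariant (U : R * R -> Prop) (Q : operator) (f : R -> R -> R)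
    : Prop :=
  forall t x, U (t, x) -> characteristic Q (jet_of f t x) = 0.

Definition values_in (U : R * R -> Prop) (I : R -> Prop) (f : R -> R -> R)
    : Prop :=
  forall t x, U (t, x) -> I (f t x).

(* The family u = c1 * v1 + c2 * v2 + v3 with parameters c1, c2. *)
Record lin_family := Family
  { v1 : R -> R -> R; v2 : R -> R -> R; v3 : R -> R -> R }.

Definition family_at (F : lin_family) (c1 c2 : R) (t x : R) : R :=
  c1 * v1 F t x + c2 * v2 F t x + v3 F t x.

Definition member (U : R * R -> Prop) (F : lin_family) (f : R -> R -> R) : Prop :=
  exists c1 c2, forall t x, U (t, x) -> f t x = family_at F c1 c2 t x.

Definition two_parametric_solution_family (A B C : R -> R -> R)
    (U : R * R -> Prop) (F : lin_family) : Prop :=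
  (forall c1 c2, solution A B C U (family_at F c1 c2)) /\
  (forall c1 c2,
     (forall t x, U (t, x) -> c1 * v1 F t x + c2 * v2 F t x = 0) ->
     c1 = 0 /\ c2 = 0).

Definition family_equiv (U : R * R -> Prop) (F F' : lin_family) : Prop :=
  forall f, member U F f <-> member U F' f.

(* [F] is the family of all [Q]-invariant solutions, for [Q] with coefficients
   defined on U x I.  All subregions [V] of [U] are considered because a given
   member of [F] may take values in [I] only on a part of [U]. *)
Definition corresponds (A B C : R -> R -> R) (U : R * R -> Prop)
    (I : R -> Prop) (Q : operator) (F : lin_family) : Prop :=
  forall V : R * R -> Prop, region V -> subset V U ->
  forall f : R -> R -> R, values_in V I f ->
    (solution A B C V f /\ invariant V Q f) <-> member V F f.

(* Main.v *)
Require Import Defs.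
From Stdlib Require Import Reals.
From Coquelicot Require Import Coquelicot.
From Stdlib Require Import Wf_nat Lra Lia ClassicalEpsilon FunctionalExtensionality.
Open Scope R_scope.

(* An operator with tau <> 0 is equivalent to [d/dt + g d/dx + h d/du]. Its
   invariance condition is a cubic polynomial in [u_x]; equating coefficients
   to zero gives first that [g] is affine and [h] cubic in [u], then that [g]
   does not depend on [u] and [h = h1 u + h0]. Invariant solutions are thus the
   solutions of a linear overdetermined system expressing all derivatives of
   [(u, u_x)], and what remains of the invariance condition is precisely its
   compatibility condition, so the solutions form a two-parametric affine family
   with nonvanishing Wronskian. Conversely, the Wronskian of a family cannot
   vanish identically on a subregion, and where it does not vanish Cramer's rule
   recovers [g], [h1], [h0]. Members with prescribed value and slope at a point
   recover the ratios of the coefficients of the operator from the family.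

   Analytic functions are handled through expansions in homogeneous polynomials
   rather than through coefficient arrays, which makes sums, products, inverses,
   derivatives and the recursion for linear differential equations direct. An
   expansion is never recentred: a solution constructed at one point is analytic
   nearby because it is a constant combination of the solutions constructed at
   the nearby point. *)

(** Moving a power series to another centre means rearranging a multiple series; since this is
    avoided, [an f t x u] speaks of one centre only. Facts needed on a neighbourhood
    (differentiability, symmetry of second derivatives, a differential equation) are read off a
    single expansion as [near] statements, and analyticity at another point comes from the
    hypotheses there or from a construction repeated there.

    The algebraic hinge is one computation, [near2_defect]. If [y] solves the second-order
    x-equation, the failure [z] of its t-equation solves the homogeneous x-equation with a source
    affine in [y_x] and [y], whose coefficients are the three obstructions. Vanishing obstructions
    and zero data force [z = 0], which gives existence of solutions. Conversely [z = 0] for [v1],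
    [v2], [v3] with nonzero Wronskian forces the obstructions to vanish, which gives the operator.
    [invariance_defect_linear] finds the same obstructions in the invariance condition. *)

(** * Homogeneous polynomials *)

(* [hpoly n c p]: [p] is a homogeneous polynomial of degree [n] whose
   coefficients have absolute values summing to at most [c]. *)
Inductive hpoly : nat -> R -> (R -> R -> R -> R) -> Prop :=
| hp_const c : hpoly 0 (Rabs c) (fun _ _ _ => c)
| hp_add n c d p q : hpoly n c p -> hpoly n d q ->
    hpoly n (c + d) (fun x y z => p x y z + q x y z)
| hp_mul1 n c p : hpoly n c p -> hpoly (S n) c (fun x y z => x * p x y z)
| hp_mul2 n c p : hpoly n c p -> hpoly (S n) c (fun x y z => y * p x y z)
| hp_mul3 n c p : hpoly n c p -> hpoly (S n) c (fun x y z => z * p x y z)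
| hp_weaken n c d p q : hpoly n c p -> c <= d ->
    (forall x y z, p x y z = q x y z) -> hpoly n d q.

Lemma hpoly_ext n c p q :
  hpoly n c p -> (forall x y z, p x y z = q x y z) -> hpoly n c q.
Proof. intros H E. now apply hp_weaken with c p; [|lra|]. Qed.

Lemma hpoly_le n c d p : hpoly n c p -> c <= d -> hpoly n d p.
Proof. intros H E. now apply hp_weaken with c p. Qed.

Lemma hpoly_zero n c : 0 <= c -> hpoly n c (fun _ _ _ => 0).
Proof.
  revert c; induction n as [|n IH]; intros c Hc.
  - apply hp_weaken with (Rabs 0) (fun _ _ _ => 0);
      [constructor | now rewrite Rabs_R0 | easy].
  - apply hpoly_ext with (fun x y z => x * 0); [|intros; ring].
    now apply hp_mul1 with (p := fun _ _ _ => 0), IH.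
Qed.

Lemma hpoly_nonneg n c p : hpoly n c p -> 0 <= c.
Proof. induction 1; try lra. apply Rabs_pos. Qed.

Lemma hpoly_bound n c p r x y z :
  hpoly n c p -> Rabs x <= r -> Rabs y <= r -> Rabs z <= r ->
  Rabs (p x y z) <= c * r ^ n.
Proof.
  intros H Hx Hy Hz.
  assert (Hr : 0 <= r) by (pose proof (Rabs_pos x); lra).
  induction H as [c|n c d p q Hp IHp Hq IHq|n c p Hp IHp|n c p Hp IHp
    |n c p Hp IHp|n c d p q Hp IHp Hcd Epq]; simpl.
  - lra.
  - eapply Rle_trans; [apply Rabs_triang|]; lra.
  - rewrite Rabs_mult; replace (c * (r * r ^ n)) with (r * (c * r ^ n)) by ring.
    now apply Rmult_le_compat; try apply Rabs_pos.
  - rewrite Rabs_mult; replace (c * (r * r ^ n)) with (r * (c * r ^ n)) by ring.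
    now apply Rmult_le_compat; try apply Rabs_pos.
  - rewrite Rabs_mult; replace (c * (r * r ^ n)) with (r * (c * r ^ n)) by ring.
    now apply Rmult_le_compat; try apply Rabs_pos.
  - rewrite <- Epq. apply Rle_trans with (1 := IHp).
    apply Rmult_le_compat_r; [now apply pow_le|easy].
Qed.

Lemma hpoly0_const c p : hpoly 0 c p -> forall x y z, p x y z = p 0 0 0.
Proof.
  intros H; remember 0%nat as n eqn:E.
  induction H; intros; try discriminate; auto.
  - now rewrite IHhpoly1, IHhpoly2.
  - rewrite <- !H1; auto.
Qed.

Lemma hpoly_scal a n c p :
  hpoly n c p -> hpoly n (Rabs a * c) (fun x y z => a * p x y z).
Proof.
  induction 1.
  - apply hp_weaken with (Rabs (a * c)) (fun _ _ _ => a * c);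
      [constructor | rewrite Rabs_mult; lra | easy].
  - rewrite Rmult_plus_distr_l.
    apply (hpoly_ext _ _ _ _ (hp_add _ _ _ _ _ IHhpoly1 IHhpoly2)); intros; ring.
  - apply (hpoly_ext _ _ _ _ (hp_mul1 _ _ _ IHhpoly)); intros; ring.
  - apply (hpoly_ext _ _ _ _ (hp_mul2 _ _ _ IHhpoly)); intros; ring.
  - apply (hpoly_ext _ _ _ _ (hp_mul3 _ _ _ IHhpoly)); intros; ring.
  - apply (hp_weaken _ _ _ _ _ IHhpoly).
    + apply Rmult_le_compat_l; [apply Rabs_pos|easy].
    + intros; now rewrite H1.
Qed.

Lemma hpoly_mul n c p m d q :
  hpoly n c p -> hpoly m d q ->
  hpoly (n + m) (c * d) (fun x y z => p x y z * q x y z).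
Proof.
  intros H Hq; pose proof (hpoly_nonneg _ _ _ Hq) as Hd. induction H; simpl.
  - now apply hpoly_scal.
  - rewrite Rmult_plus_distr_r.
    apply (hpoly_ext _ _ _ _ (hp_add _ _ _ _ _ IHhpoly1 IHhpoly2)); intros; ring.
  - apply (hpoly_ext _ _ _ _ (hp_mul1 _ _ _ IHhpoly)); intros; ring.
  - apply (hpoly_ext _ _ _ _ (hp_mul2 _ _ _ IHhpoly)); intros; ring.
  - apply (hpoly_ext _ _ _ _ (hp_mul3 _ _ _ IHhpoly)); intros; ring.
  - apply (hp_weaken _ _ _ _ _ IHhpoly).
    + now apply Rmult_le_compat_r.
    + intros; now rewrite H1.
Qed.

Lemma hpoly_sum N n (c : nat -> R) (p : nat -> R -> R -> R -> R) :
  (forall m, (m <= N)%nat -> hpoly n (c m) (p m)) ->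
  hpoly n (sum_f_R0 c N) (fun x y z => sum_f_R0 (fun m => p m x y z) N).
Proof.
  induction N as [|N IH]; intros H; simpl.
  - apply (hpoly_ext _ _ _ _ (H 0%nat (le_n _))); easy.
  - apply (hpoly_ext _ _ _ _ (hp_add _ _ _ _ _ (IH (fun m Hm => H m (le_S _ _ Hm)))
      (H (S N) (le_n _)))); easy.
Qed.

(** The coefficient sum is submultiplicative, so linear forms of norm at most 1 leave the bound
    unchanged. Permutations of the coordinates and restrictions to coordinate planes are the
    instances in use. *)
Lemma hpoly_subst n c p X Y Z : hpoly n c p ->
  hpoly 1 1 X -> hpoly 1 1 Y -> hpoly 1 1 Z ->
  hpoly n c (fun x y z => p (X x y z) (Y x y z) (Z x y z)).
Proof.
  intros H HX HY HZ.
  assert (L : forall n c q V, hpoly n c q -> hpoly 1 1 V ->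
    hpoly (S n) c (fun x y z => V x y z * q x y z)).
  { intros m d q V Hq HV. rewrite <- (Rmult_1_l d). now apply (hpoly_mul 1 1 V). }
  induction H.
  - constructor.
  - apply (hp_add _ _ _ _ _ IHhpoly1 IHhpoly2).
  - apply (L _ _ _ _ IHhpoly HX).
  - apply (L _ _ _ _ IHhpoly HY).
  - apply (L _ _ _ _ IHhpoly HZ).
  - apply (hp_weaken _ _ _ _ _ IHhpoly); auto.
Qed.

Lemma hpoly_coords : hpoly 1 1 (fun x _ _ => x) /\ hpoly 1 1 (fun _ y _ => y) /\
  hpoly 1 1 (fun _ _ z => z) /\ hpoly 1 1 (fun _ _ _ => 0).
Proof.
  assert (H1 : hpoly 0 1 (fun _ _ _ => 1)) by (rewrite <- Rabs_R1 at 1; constructor).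
  split; [|split; [|split]]; [| | |apply hpoly_zero; lra].
  - apply (hpoly_ext _ _ _ _ (hp_mul1 _ _ _ H1)); intros; ring.
  - apply (hpoly_ext _ _ _ _ (hp_mul2 _ _ _ H1)); intros; ring.
  - apply (hpoly_ext _ _ _ _ (hp_mul3 _ _ _ H1)); intros; ring.
Qed.

Lemma hpoly_swap12 n c p : hpoly n c p -> hpoly n c (fun x y z => p y x z).
Proof. intros H. now apply (hpoly_subst _ _ _ _ _ _ H); apply hpoly_coords. Qed.

Lemma hpoly_swap13 n c p : hpoly n c p -> hpoly n c (fun x y z => p z y x).
Proof. intros H. now apply (hpoly_subst _ _ _ _ _ _ H); apply hpoly_coords. Qed.

Lemma hpoly_restrict2 n c p : hpoly n c p -> hpoly n c (fun x _ z => p x 0 z).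
Proof. intros H. now apply (hpoly_subst _ _ _ _ _ _ H); apply hpoly_coords. Qed.

Lemma hpoly_restrict3 n c p : hpoly n c p -> hpoly n c (fun x y _ => p x y 0).
Proof. intros H. now apply (hpoly_subst _ _ _ _ _ _ H); apply hpoly_coords. Qed.

Definition D1 (f : R -> R -> R -> R) x y z := Derive (fun s => f s y z) x.
Definition D2 (f : R -> R -> R -> R) x y z := Derive (fun s => f x s z) y.
Definition D3 (f : R -> R -> R -> R) x y z := Derive (fun s => f x y s) z.

(** Differentiating a monomial of degree [n] multiplies its coefficient by an exponent at most [n].
    Degree 0 is separate because there is no degree below it. The other two variables follow by
    swapping. *)
Lemma hpoly_derive n c p : hpoly n c p ->
  exists p' : R -> R -> R -> R, (forall x y z, is_derive (fun s => p s y z) x (p' x y z)) /\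
  match n with
  | O => forall x y z, p' x y z = 0
  | S m => hpoly m (INR n * c) p'
  end.
Proof.
  induction 1 as [c|n c d p q Hp [p' [Dp IHp]] Hq [q' [Dq IHq]]
    |n c p Hp [p' [Dp IHp]]|n c p Hp [p' [Dp IHp]]
    |n c p Hp [p' [Dp IHp]]|n c d p q Hp [p' [Dp IHp]] Hcd Epq].
  - exists (fun _ _ _ => 0); split; [|easy]. intros; apply @is_derive_const.
  - exists (fun x y z => p' x y z + q' x y z); split.
    + intros; now apply @is_derive_plus.
    + destruct n; [intros; rewrite IHp, IHq; ring|].
      rewrite Rmult_plus_distr_l. now apply hp_add.
  - exists (fun x y z => p x y z + x * p' x y z); split.
    + intros. replace (p x y z + x * p' x y z)
        with (plus (mult 1 (p x y z)) (mult x (p' x y z)))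
        by (unfold plus, mult; simpl; lra).
      apply (is_derive_mult (fun s => s) (fun s => p s y z));
        [apply @is_derive_id | apply Dp | intros; apply Rmult_comm].
    + destruct n.
      * apply hpoly_ext with p; [simpl; now rewrite Rmult_1_l|].
        intros; rewrite IHp; ring.
      * rewrite S_INR, Rmult_plus_distr_r, Rmult_1_l, Rplus_comm.
        apply hp_add; [easy|]. now apply hp_mul1.
  - exists (fun x y z => y * p' x y z); split.
    + intros; now apply @is_derive_scal.
    + destruct n.
      * apply hpoly_ext with (fun _ _ _ => 0); [|intros; rewrite IHp; ring].
        apply hpoly_zero; simpl. pose proof (hpoly_nonneg _ _ _ Hp); lra.
      * apply hpoly_le with (INR (S n) * c); [now apply hp_mul2|].
        apply Rmult_le_compat_r; [apply (hpoly_nonneg _ _ _ Hp)|].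
        apply le_INR; lia.
  - exists (fun x y z => z * p' x y z); split.
    + intros; now apply @is_derive_scal.
    + destruct n.
      * apply hpoly_ext with (fun _ _ _ => 0); [|intros; rewrite IHp; ring].
        apply hpoly_zero; simpl. pose proof (hpoly_nonneg _ _ _ Hp); lra.
      * apply hpoly_le with (INR (S n) * c); [now apply hp_mul3|].
        apply Rmult_le_compat_r; [apply (hpoly_nonneg _ _ _ Hp)|].
        apply le_INR; lia.
  - exists p'; split.
    + intros. apply is_derive_ext with (fun s => p s y z); [now intros|apply Dp].
    + destruct n; [easy|]. apply (hpoly_le _ _ _ _ IHp).
      apply Rmult_le_compat_l; [apply pos_INR|easy].
Qed.

Lemma hpoly_ex_derive1 n c p x y z :
  hpoly n c p -> ex_derive (fun s => p s y z) x.
Proof. intros H; destruct (hpoly_derive _ _ _ H) as [p' [Dp _]]. eexists; apply Dp. Qed.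

Lemma hpoly_D1 n c p : hpoly (S n) c p -> hpoly n (INR (S n) * c) (D1 p).
Proof.
  intros H; destruct (hpoly_derive _ _ _ H) as [p' [Dp Hp]].
  apply (hpoly_ext _ _ _ _ Hp). intros; symmetry. apply is_derive_unique, Dp.
Qed.

Lemma hpoly0_D1 c p x y z : hpoly 0 c p -> D1 p x y z = 0.
Proof.
  intros H; destruct (hpoly_derive _ _ _ H) as [p' [Dp Hp]].
  rewrite <- (Hp x y z). apply is_derive_unique, Dp.
Qed.

(* Integrating [y ^ j * p] for all [j] at once lets the induction absorb
   factors [y] without integrating by parts. *)
Lemma hpoly_primitive n c p j : hpoly n c p ->
  exists q : R -> R -> R -> R, hpoly (S (n + j)) c q /\ (forall x z, q x 0 z = 0) /\
  forall x y z : R, is_derive (fun s => q x s z) y (y ^ j * p x y z).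
Proof.
  intros H; revert j.
  induction H as [c|n c d p q Hp IHp Hq IHq|n c p Hp IHp|n c p Hp IHp
    |n c p Hp IHp|n c d p q Hp IHp Hcd Epq]; intros j.
  - exists (fun x y z => y ^ (S j) * (c / INR (S j))).
    assert (Hj : 1 <= INR (S j)) by (apply (le_INR 1); lia).
    split; [|split].
    + apply hpoly_le with (Rabs (c / INR (S j))).
      * change (0 + j)%nat with j.
        generalize (c / INR (S j)) as a; intros a; generalize (S j) as k.
        induction k as [|k IH]; simpl.
        -- apply hpoly_ext with (fun _ _ _ => a); [constructor|intros; ring].
        -- apply (hpoly_ext _ _ _ _ (hp_mul2 _ _ _ IH)); intros; simpl; ring.
      * unfold Rdiv; rewrite Rabs_mult, Rabs_inv, (Rabs_pos_eq (INR _)) by lra.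
        rewrite <- (Rmult_1_r (Rabs c)) at 2.
        apply Rmult_le_compat_l; [apply Rabs_pos|].
        rewrite <- Rinv_1. apply Rinv_le_contravar; lra.
    + intros; simpl; ring.
    + intros. replace (y ^ j * c) with (INR (S j) * y ^ j * (c / INR (S j))).
      * generalize (c / INR (S j)); intros a. auto_derive; [easy|].
        change (1 * (INR (S j) * y ^ j) * a = INR (S j) * y ^ j * a). ring.
      * field. apply Rgt_not_eq; lra.
  - destruct (IHp j) as [P [HP [P0 DP]]], (IHq j) as [Q [HQ [Q0 DQ]]].
    exists (fun x y z => P x y z + Q x y z); split; [now apply hp_add|split].
    + intros; rewrite P0, Q0; ring.
    + intros; rewrite Rmult_plus_distr_l. now apply @is_derive_plus.
  - destruct (IHp j) as [P [HP [P0 DP]]].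
    exists (fun x y z => x * P x y z); split; [now apply hp_mul1|split].
    + intros; rewrite P0; ring.
    + intros; replace (y ^ j * (x * p x y z)) with (x * (y ^ j * p x y z)) by ring.
      now apply @is_derive_scal.
  - destruct (IHp (S j)) as [P [HP [P0 DP]]].
    exists P; split; [now replace (S n + j)%nat with (n + S j)%nat by lia|split].
    + easy.
    + intros; replace (y ^ j * (y * p x y z)) with (y ^ (S j) * p x y z)
        by (simpl; ring); apply DP.
  - destruct (IHp j) as [P [HP [P0 DP]]].
    exists (fun x y z => z * P x y z); split; [now apply hp_mul3|split].
    + intros; rewrite P0; ring.
    + intros; replace (y ^ j * (z * p x y z)) with (z * (y ^ j * p x y z)) by ring.
      now apply @is_derive_scal.
  - destruct (IHp j) as [P [HP [P0 DP]]].
    exists P; split; [now apply (hpoly_le _ _ _ _ HP)|split]; [easy|].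
    intros; rewrite <- Epq; apply DP.
Qed.

(** [hpoly_primitive] only asserts existence; the recursion that solves differential equations needs
    the primitive as a function of [p], which the integral provides. *)
Definition J2 (p : R -> R -> R -> R) x y z := RInt (fun s => p x s z) 0 y.

Lemma hpoly_J2 n c p : hpoly n c p ->
  hpoly (S n) c (J2 p) /\ (forall x z, J2 p x 0 z = 0) /\
  (forall x y z, is_derive (fun s => J2 p x s z) y (p x y z)).
Proof.
  intros H; destruct (hpoly_primitive n c p 0 H) as [q [Hq [q0 Dq]]].
  rewrite Nat.add_0_r in Hq.
  assert (E : forall x y z, J2 p x y z = q x y z).
  { intros; unfold J2. replace (q x y z) with (minus (q x y z) (q x 0 z)).
    - apply is_RInt_unique.
      apply (is_RInt_derive (fun s => q x s z) (fun s => p x s z)).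
      + intros s _. generalize (Dq x s z); simpl; now rewrite Rmult_1_l.
      + intros s _. apply (@ex_derive_continuous R_AbsRing R_NormedModule).
        apply (hpoly_ex_derive1 _ _ _ _ _ _ (hpoly_swap12 _ _ _ H)).
    - rewrite q0; unfold minus, plus, opp; simpl; ring. }
  split; [|split].
  - apply (hpoly_ext _ _ _ _ Hq); auto.
  - intros; now rewrite E.
  - intros. apply is_derive_ext with (fun s => q x s z); [now intros|].
    generalize (Dq x y z); simpl; now rewrite Rmult_1_l.
Qed.

(** * Analytic functions of three variables *)

Lemma open_Rabs_lt r : open (fun s : R => Rabs s < r).
Proof.
  intros s Hs. exists (mkposreal (r - Rabs s) (proj2 (Rlt_0_minus _ _) Hs)).
  intros y Hy; change (Rabs (y - s) < r - Rabs s) in Hy.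
  replace y with ((y - s) + s) by ring.
  apply Rle_lt_trans with (1 := Rabs_triang _ _). lra.
Qed.

Lemma Rabs_diag_lt x d : 0 < d -> Rabs (x - x) < d.
Proof. now rewrite Rminus_diag, Rabs_R0. Qed.

Lemma Weierstrass_M (u : nat -> R -> R) (c : nat -> R) (D : R -> Prop) :
  (forall n s, D s -> Rabs (u n s) <= c n) -> ex_series c ->
  CVU_dom (fun N s => sum_n (fun n => u n s) N) D.
Proof.
  intros Hu Hc. apply CVU_dom_cauchy. intros eps.
  destruct (Cauchy_ex_series c Hc eps) as [N HN].
  assert (W : forall n m s, D s -> (N <= n)%nat -> (n <= m)%nat ->
    Rabs (sum_n (fun k => u k s) m - sum_n (fun k => u k s) n) < eps).
  { intros n m s Hs Hn Hm. destruct (Nat.eq_dec n m) as [->|Hne].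
    - rewrite Rminus_diag, Rabs_R0. apply cond_pos.
    - change (norm (minus (sum_n (fun k => u k s) m : R_NormedModule)
        (sum_n (fun k => u k s) n)) < eps).
      rewrite <- (sum_n_m_sum_n (G := R_NormedModule)) by easy.
      eapply Rle_lt_trans; [apply (norm_sum_n_m (V := R_NormedModule))|].
      eapply Rle_lt_trans; [|apply (HN (S n) m); lia].
      eapply Rle_trans; [|apply Rle_abs].
      apply sum_n_m_le. intros k; now apply Hu. }
  exists N; intros n m s Hs Hn Hm.
  destruct (Nat.le_ge_cases n m).
  - rewrite Rabs_minus_sym; auto.
  - auto.
Qed.

Lemma is_connected_Rabs_lt r : is_connected (fun s : R => Rabs s < r).
Proof.
  intros a b x Ha Hb Hx. apply Rabs_def2 in Ha; apply Rabs_def2 in Hb.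
  apply Rabs_def1; lra.
Qed.

Lemma is_derive_Series (u u' : nat -> R -> R) (c c' : nat -> R) r s :
  (forall n s, Rabs s < r -> is_derive (u n) s (u' n s)) ->
  (forall n s, Rabs s < r -> continuous (u' n) s) ->
  (forall n s, Rabs s < r -> Rabs (u n s) <= c n) ->
  (forall n s, Rabs s < r -> Rabs (u' n s) <= c' n) ->
  ex_series c -> ex_series c' -> Rabs s < r ->
  is_derive (fun s => Series (fun n => u n s)) s (Series (fun n => u' n s)).
Proof.
  intros Du Cu Bu Bu' Hc Hc' Hs.
  assert (E : forall N s, Rabs s < r ->
    is_derive (fun s => sum_n (fun n => u n s) N) s (sum_n (fun n => u' n s) N)).
  { intros N s' Hs'. apply (is_derive_sum_n (fun n s => u n s)).
    intros k _. now apply Du. }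
  assert (E' : forall N s, Rabs s < r ->
    Derive (fun s => sum_n (fun n => u n s) N) s = sum_n (fun n => u' n s) N)
    by (intros; now apply is_derive_unique, E).
  unfold Series. rewrite <- (Lim_seq_ext _ _ (fun N => E' N s Hs)).
  apply (CVU_Derive (fun N s => sum_n (fun n => u n s) N) (fun s => Rabs s < r)).
  - apply open_Rabs_lt.
  - apply is_connected_Rabs_lt.
  - now apply Weierstrass_M with c.
  - intros N s' Hs'. eexists; now apply E.
  - intros N s' Hs'. apply continuity_pt_filterlim.
    apply continuous_ext_loc with (fun s => sum_n (fun n => u' n s) N).
    + apply filter_imp with (2 := open_Rabs_lt r s' Hs').
      intros; symmetry; now apply E'.
    + induction N as [|N IH].
      * apply continuous_ext with (u' 0%nat); [intros; now rewrite sum_O|now apply Cu].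
      * apply continuous_ext with (fun s => plus (sum_n (fun n => u' n s) N) (u' (S N) s));
          [intros; now rewrite sum_Sn|].
        apply @continuous_plus; [apply IH|now apply Cu].
  - apply CVU_dom_cauchy. intros eps.
    destruct (proj1 (CVU_dom_cauchy _ _)
      (Weierstrass_M u' c' (fun s => Rabs s < r) Bu' Hc') eps) as [N HN].
    exists N; intros n m s' Hs' Hn Hm. rewrite !E' by easy. now apply HN.
  - easy.
Qed.

(* One constant [M] bounds the coefficients and fixes the domain
   [|h|, |k|, |l| < 1 / (2 M)], on which the series converges geometrically. *)
Definition expansion (f : R -> R -> R -> R) t x u P M :=
  1 <= M /\ (forall n, hpoly n (M ^ S n) (P n)) /\
  forall h k l, 2 * M * Rabs h < 1 -> 2 * M * Rabs k < 1 -> 2 * M * Rabs l < 1 ->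
    is_series (fun n => P n h k l) (f (t + h) (x + k) (u + l)).

Definition an f t x u := exists P M, expansion f t x u P M.

Lemma expansion_le f t x u P M M' :
  expansion f t x u P M -> M <= M' -> expansion f t x u P M'.
Proof.
  intros [H1 [HP Hs]] HM; split; [lra|split].
  - intros n; apply (hpoly_le _ _ _ _ (HP n)). apply pow_incr; lra.
  - assert (W : forall h, 2 * M' * Rabs h < 1 -> 2 * M * Rabs h < 1).
    { intros h Hh. pose proof (Rabs_pos h). nra. }
    intros; apply Hs; auto.
Qed.

(** A radius strictly larger than all increments leaves room to move them, while [M * r] stays below
    1/2 and the terms remain geometrically small. *)
Lemma common_radius M h k l : 0 < M ->
  2 * M * Rabs h < 1 -> 2 * M * Rabs k < 1 -> 2 * M * Rabs l < 1 ->
  exists r, 0 < r /\ Rabs h < r /\ Rabs k < r /\ Rabs l < r /\ 2 * M * r < 1.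
Proof.
  intros HM Hh Hk Hl.
  set (m := Rmax (Rabs h) (Rmax (Rabs k) (Rabs l))).
  assert (Hm : 2 * M * m < 1) by (unfold m, Rmax; repeat destruct Rle_dec; easy).
  assert (0 <= m) by (unfold m; apply Rle_trans with (Rabs h);
    [apply Rabs_pos|apply Rmax_l]).
  assert (Rabs h <= m /\ Rabs k <= m /\ Rabs l <= m).
  { unfold m; split; [apply Rmax_l|split]; (eapply Rle_trans; [|apply Rmax_r]);
      [apply Rmax_l|apply Rmax_r]. }
  exists ((m + / (2 * M)) / 2).
  assert (E : 2 * M * / (2 * M) = 1) by (field; lra).
  assert (m < / (2 * M)) by nra.
  repeat split; nra.
Qed.

(** Absorbs the factor [n + 1], produced by derivatives and by Cauchy products, into the geometric
    constant. *)
Lemma INR_S_le_pow2 n : INR (S n) <= 2 ^ n.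
Proof.
  induction n as [|n IH]; [simpl; lra|].
  rewrite S_INR; simpl pow. assert (1 <= 2 ^ n) by (apply pow_R1_Rle; lra). lra.
Qed.

Lemma ex_series_geom_scal K q : 0 <= q -> q < 1 -> ex_series (fun n => K * q ^ n).
Proof.
  intros H0 H1. apply (ex_series_scal_l (V := R_NormedModule) K), ex_series_geom.
  now rewrite Rabs_pos_eq.
Qed.

Lemma hpoly_term_bound n M p r x y z : 0 <= M ->
  hpoly n (M ^ S n) p -> Rabs x <= r -> Rabs y <= r -> Rabs z <= r ->
  Rabs (p x y z) <= M * (M * r) ^ n.
Proof.
  intros HM Hp Hx Hy Hz. eapply Rle_trans; [eapply hpoly_bound; eauto|].
  rewrite Rpow_mult_distr; simpl. right; ring.
Qed.

Lemma hpoly_series_abs P M h k l : 1 <= M -> (forall n, hpoly n (M ^ S n) (P n)) ->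
  2 * M * Rabs h < 1 -> 2 * M * Rabs k < 1 -> 2 * M * Rabs l < 1 ->
  ex_series (fun n => Rabs (P n h k l)).
Proof.
  intros H1 HP Hh Hk Hl.
  destruct (common_radius M h k l) as [r [r0 [rh [rk [rl rM]]]]]; try lra.
  apply @ex_series_le with (b := fun n => M * (M * r) ^ n).
  - intros n. unfold norm; simpl; unfold abs; simpl. rewrite Rabs_Rabsolu.
    apply hpoly_term_bound; try lra; auto.
  - apply ex_series_geom_scal; nra.
Qed.

Lemma expansion_abs f t x u P M h k l : expansion f t x u P M ->
  2 * M * Rabs h < 1 -> 2 * M * Rabs k < 1 -> 2 * M * Rabs l < 1 ->
  ex_series (fun n => Rabs (P n h k l)).
Proof. intros [H1 [HP _]]. now apply hpoly_series_abs. Qed.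

Lemma expansion_is_derive f t x u P M h k l : expansion f t x u P M ->
  2 * M * Rabs h < 1 -> 2 * M * Rabs k < 1 -> 2 * M * Rabs l < 1 ->
  is_derive (fun s => f s (x + k) (u + l)) (t + h)
    (Series (fun n => D1 (P (S n)) h k l)).
Proof.
  intros [H1 [HP Hs]] Hh Hk Hl.
  destruct (common_radius M h k l) as [r [r0 [rh [rk [rl rM]]]]]; try lra.
  assert (HD : forall n, hpoly n (INR (S n) * M ^ S (S n)) (D1 (P (S n))))
    by (intros; now apply hpoly_D1).
  assert (E0 : forall s, D1 (P 0%nat) s k l = 0)
    by (intros; now apply hpoly0_D1 with (M ^ 1)).
  (* Majorant of the differentiated terms. The factor [n + 1] costs [2 ^ n], so the ratio becomes
     [2 * M * r < 1]; hence the factor 2 in the domain of an expansion. *)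
  set (c' := fun n => match n with O => 0 | S m => M ^ 2 * (2 * (M * r)) ^ m end).
  assert (Hc' : ex_series c').
  { apply ex_series_incr_1. simpl. apply ex_series_geom_scal; nra. }
  assert (B' : forall n s, Rabs s < r -> Rabs (D1 (P n) s k l) <= c' n).
  { intros [|n] s Hr.
    - rewrite E0, Rabs_R0; simpl; lra.
    - eapply Rle_trans; [apply (hpoly_bound _ _ _ r _ _ _ (HD n)); lra|].
      unfold c'. rewrite !Rpow_mult_distr.
      replace (INR (S n) * M ^ S (S n) * r ^ n)
        with (INR (S n) * (M ^ 2 * (M ^ n * r ^ n))) by (simpl; ring).
      replace (M ^ 2 * (2 ^ n * (M ^ n * r ^ n)))
        with (2 ^ n * (M ^ 2 * (M ^ n * r ^ n))) by ring.
      apply Rmult_le_compat_r; [|apply INR_S_le_pow2].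
      repeat apply Rmult_le_pos; try apply pow_le; lra. }
  assert (D : is_derive (fun s => Series (fun n => P n s k l)) h
    (Series (fun n => D1 (P n) h k l))).
  { apply is_derive_Series with (r := r) (u' := fun n s => D1 (P n) s k l)
      (c := fun n => M * (M * r) ^ n) (c' := c'); auto.
    - intros n s _. apply Derive_correct. apply (hpoly_ex_derive1 _ _ _ _ _ _ (HP n)).
    - intros [|n] s _.
      + apply continuous_ext with (fun _ => 0); [intros; now rewrite E0|].
        apply @continuous_const.
      + apply (@ex_derive_continuous R_AbsRing R_NormedModule).
        apply (hpoly_ex_derive1 _ _ _ _ _ _ (HD n)).
    - intros n s Hr. apply hpoly_term_bound; try lra; auto.
    - apply ex_series_geom_scal; nra. }
  assert (ED : Series (fun n => D1 (P n) h k l) = Series (fun n => D1 (P (S n)) h k l)).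
  { rewrite Series_incr_1.
    - rewrite E0. apply Rplus_0_l.
    - apply @ex_series_le with (b := c'); [|easy]. intros n; now apply B'. }
  rewrite ED in D.
  apply is_derive_ext_loc with (fun s => Series (fun n => P n (s - t) k l)).
  - assert (Hpos : 0 < r - Rabs h) by lra.
    exists (mkposreal _ Hpos). intros s Hb; change (Rabs (s - (t + h)) < r - Rabs h) in Hb.
    assert (Rabs (s - t) < r).
    { replace (s - t) with ((s - (t + h)) + h) by ring.
      eapply Rle_lt_trans; [apply Rabs_triang|]; lra. }
    replace (f s (x + k) (u + l)) with (f (t + (s - t)) (x + k) (u + l))
      by (f_equal; ring).
    apply is_series_unique, Hs; [|easy|easy]. nra.
  - replace (Series (fun n => D1 (P (S n)) h k l))
      with (scal 1 (Series (fun n => D1 (P (S n)) h k l))) by apply Rmult_1_l.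
    apply (is_derive_comp (fun s => Series (fun n => P n s k l)) (fun s => s - t)).
    + now replace (t + h - t) with h by ring.
    + auto_derive; [easy|ring].
Qed.

Lemma Rabs_small_2 M M' h : 1 <= M -> 2 * (2 * M ^ 2) * Rabs h < 1 ->
  M' <= 2 * M ^ 2 -> 2 * M' * Rabs h < 1.
Proof. intros. pose proof (Rabs_pos h). nra. Qed.

(** The degree [n] part of the derivative has norm at most [(n + 1) * M ^ (n + 2)], hence at most
    [2 ^ n * M ^ (n + 2)], which [2 * M ^ 2] to the power [n + 1] dominates because [M >= 1]. *)
Lemma expansion_D1 f t x u P M : expansion f t x u P M ->
  expansion (D1 f) t x u (fun n => D1 (P (S n))) (2 * M ^ 2).
Proof.
  intros H. pose proof H as [H1 [HP Hs]].
  split; [nra|split].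
  - intros n. apply hpoly_le with (1 := hpoly_D1 _ _ _ (HP (S n))).
    apply Rle_trans with (2 ^ n * M ^ S (S n)).
    + apply Rmult_le_compat_r; [apply pow_le; lra|apply INR_S_le_pow2].
    + replace ((2 * M ^ 2) ^ S n) with (2 ^ n * M ^ S (S n) * (2 * M ^ n)).
      * assert (0 <= 2 ^ n * M ^ S (S n)) by (apply Rmult_le_pos; apply pow_le; lra).
        assert (1 <= M ^ n) by (apply pow_R1_Rle; lra). nra.
      * rewrite Rpow_mult_distr, <- pow_mult.
        replace (2 * S n)%nat with (S (S n) + n)%nat by lia.
        rewrite pow_add. simpl; ring.
  - intros h k l Hh Hk Hl.
    assert (W : forall h, 2 * (2 * M ^ 2) * Rabs h < 1 -> 2 * M * Rabs h < 1)
      by (intros; apply Rabs_small_2 with M; nra).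
    unfold D1 at 2. erewrite is_derive_unique
      by (apply expansion_is_derive with (1 := H); auto).
    apply Series_correct.
    destruct (common_radius (2 * M ^ 2) h k l) as [r [r0 [rh [rk [rl rM]]]]]; try nra.
    apply @ex_series_le with (b := fun n => M ^ 2 * (2 * (M * r)) ^ n).
    + intros n. eapply Rle_trans;
        [apply (hpoly_bound _ _ _ r _ _ _ (hpoly_D1 _ _ _ (HP (S n)))); lra|].
      rewrite !Rpow_mult_distr.
      replace (INR (S n) * M ^ S (S n) * r ^ n)
        with (INR (S n) * (M ^ 2 * (M ^ n * r ^ n))) by (simpl; ring).
      replace (M ^ 2 * (2 ^ n * (M ^ n * r ^ n)))
        with (2 ^ n * (M ^ 2 * (M ^ n * r ^ n))) by ring.
      apply Rmult_le_compat_r; [|apply INR_S_le_pow2].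
      repeat apply Rmult_le_pos; try apply pow_le; lra.
    + apply ex_series_geom_scal; nra.
Qed.

Lemma an_D1 f t x u : an f t x u -> an (D1 f) t x u.
Proof. intros [P [M H]]. eexists; eexists; apply expansion_D1, H. Qed.
Arguments an_D1 {f t x u}.

Lemma expansion_swap12 f t x u P M : expansion f t x u P M ->
  expansion (fun x t u => f t x u) x t u (fun n x y z => P n y x z) M.
Proof.
  intros [H1 [HP Hs]].
  split; [easy|split]; [intros; apply hpoly_swap12, HP|intros; now apply Hs].
Qed.

Lemma expansion_D2 f t x u P M : expansion f t x u P M ->
  expansion (D2 f) t x u (fun n => D2 (P (S n))) (2 * M ^ 2).
Proof.
  intros H.
  apply (expansion_swap12 _ _ _ _ _ _ (expansion_D1 _ _ _ _ _ _ (expansion_swap12 _ _ _ _ _ _ H))).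
Qed.

Lemma an_swap12 f t x u : an f t x u -> an (fun x t u => f t x u) x t u.
Proof.
  intros [P [M H]]. eexists; eexists; apply expansion_swap12, H.
Qed.

Lemma an_swap13 f t x u : an f t x u -> an (fun u x t => f t x u) u x t.
Proof.
  intros [P [M [H1 [HP Hs]]]]. exists (fun n x y z => P n z y x), M.
  split; [easy|split]; [intros; apply hpoly_swap13, HP|intros; now apply Hs].
Qed.

Lemma an_D2 f t x u : an f t x u -> an (D2 f) t x u.
Proof. intros H. apply (an_swap12 _ _ _ _ (an_D1 (an_swap12 _ _ _ _ H))). Qed.
Arguments an_D2 {f t x u}.

Lemma an_D3 f t x u : an f t x u -> an (D3 f) t x u.
Proof. intros H. apply (an_swap13 _ _ _ _ (an_D1 (an_swap13 _ _ _ _ H))). Qed.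
Arguments an_D3 {f t x u}.

(** A cube around the point in coordinates, rather than a filter on triples, so that functions and
    predicates stay curried. *)
Definition near (t x u : R) (P : R -> R -> R -> Prop) :=
  exists d, 0 < d /\ forall t' x' u', Rabs (t' - t) < d -> Rabs (x' - x) < d ->
    Rabs (u' - u) < d -> P t' x' u'.

Lemma near_imp t x u (P Q : R -> R -> R -> Prop) :
  (forall t x u, P t x u -> Q t x u) -> near t x u P -> near t x u Q.
Proof. intros I [d [d0 H]]; exists d; auto. Qed.

Lemma near_and t x u (P Q : R -> R -> R -> Prop) :
  near t x u P -> near t x u Q -> near t x u (fun t x u => P t x u /\ Q t x u).
Proof.
  intros [d [d0 H]] [d' [d0' H']]; exists (Rmin d d').
  pose proof (Rmin_l d d'); pose proof (Rmin_r d d').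
  split; [now apply Rmin_pos|]. intros; split; [apply H|apply H']; lra.
Qed.
Arguments near_and {t x u P Q}.

Lemma near_self t x u P : near t x u P -> P t x u.
Proof. intros [d [d0 H]]; apply H; now apply Rabs_diag_lt. Qed.
Arguments near_self {t x u P}.

(** The expansion at the centre already yields differentiability at nearby points, although
    analyticity itself is not transported to them. *)
Lemma near_ex_derive1 f t x u : an f t x u ->
  near t x u (fun t x u => ex_derive (fun s => f s x u) t).
Proof.
  intros [P [M H]]; pose proof H as [H1 _].
  assert (M0 : 0 < / (2 * M)) by (apply Rinv_0_lt_compat; lra).
  assert (E : 2 * M * / (2 * M) = 1) by (field; lra).
  exists (/ (2 * M)); split; [easy|]. intros t' x' u' Ht Hx Hu.
  replace t' with (t + (t' - t)) by ring. replace x' with (x + (x' - x)) by ring.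
  replace u' with (u + (u' - u)) by ring.
  eexists; apply expansion_is_derive with (1 := H); nra.
Qed.
Arguments near_ex_derive1 {f t x u}.

Lemma near_ex_derive2 f t x u : an f t x u ->
  near t x u (fun t x u => ex_derive (fun s => f t s u) x).
Proof.
  intros H; destruct (near_ex_derive1 (an_swap12 _ _ _ _ H)) as [d [d0 Hd]].
  exists d; split; auto.
Qed.
Arguments near_ex_derive2 {f t x u}.

Lemma near_ex_derive3 f t x u : an f t x u ->
  near t x u (fun t x u => ex_derive (fun s => f t x s) u).
Proof.
  intros H; destruct (near_ex_derive1 (an_swap13 _ _ _ _ H)) as [d [d0 Hd]].
  exists d; split; auto.
Qed.
Arguments near_ex_derive3 {f t x u}.

Lemma an_is_derive1 f t x u : an f t x u -> is_derive (fun s => f s x u) t (D1 f t x u).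
Proof. intros H. apply Derive_correct, (near_self (near_ex_derive1 H)). Qed.
Arguments an_is_derive1 {f t x u}.
Lemma an_is_derive2 f t x u : an f t x u -> is_derive (fun s => f t s u) x (D2 f t x u).
Proof. intros H. apply Derive_correct, (near_self (near_ex_derive2 H)). Qed.
Arguments an_is_derive2 {f t x u}.
Lemma an_is_derive3 f t x u : an f t x u -> is_derive (fun s => f t x s) u (D3 f t x u).
Proof. intros H. apply Derive_correct, (near_self (near_ex_derive3 H)). Qed.
Arguments an_is_derive3 {f t x u}.

Lemma expansion_at_0 f t x u P M : expansion f t x u P M -> P 0%nat 0 0 0 = f t x u.
Proof.
  intros [H1 [HP Hs]].
  assert (Z : 2 * M * Rabs 0 < 1) by (rewrite Rabs_R0; lra).
  specialize (Hs 0 0 0 Z Z Z). rewrite !Rplus_0_r in Hs.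
  rewrite <- (is_series_unique _ _ Hs), Series_incr_1 by (eexists; apply Hs).
  rewrite (Series_ext _ (fun _ => 0 * 0)).
  - rewrite (Series_scal_l 0 (fun _ => 0)). ring.
  - intros n. pose proof (hpoly_bound _ _ _ 0 0 0 0 (HP (S n))) as B.
    rewrite Rabs_R0, pow_i, Rmult_0_r in B by lia.
    pose proof (Rabs_pos (P (S n) 0 0 0)) as B'.
    rewrite Rmult_0_r. apply Rabs_eq_0. apply Rle_antisym; [apply B; lra|easy].
Qed.

Lemma an_continuous f t x u eps : an f t x u -> 0 < eps ->
  near t x u (fun t' x' u' => Rabs (f t' x' u' - f t x u) < eps).
Proof.
  intros [P [M H]] He. pose proof H as [H1 [HP Hs]].
  (* The first bound makes the ratio [M * d] at most 1/4, so the geometric series sums to less than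
     2; the second makes the first-order bound [M ^ 2 * d] at most [eps / 4]. *)
  set (d := Rmin (/ (4 * M)) (eps / (4 * M ^ 2))).
  assert (d0 : 0 < d).
  { apply Rmin_pos; [apply Rinv_0_lt_compat; lra|].
    apply Rdiv_lt_0_compat; nra. }
  assert (d1 : 4 * M * d <= 1).
  { replace 1 with (4 * M * / (4 * M)) by (field; lra).
    apply Rmult_le_compat_l; [lra|apply Rmin_l]. }
  assert (d2 : 4 * M ^ 2 * d <= eps).
  { replace eps with (4 * M ^ 2 * (eps / (4 * M ^ 2))) by (field; lra).
    apply Rmult_le_compat_l; [nra|apply Rmin_r]. }
  exists d; split; [easy|]. intros t' x' u' Ht Hx Hu.
  set (h := t' - t) in *; set (k := x' - x) in *; set (l := u' - u) in *.
  replace t' with (t + h) by (unfold h; ring).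
  replace x' with (x + k) by (unfold k; ring).
  replace u' with (u + l) by (unfold l; ring).
  assert (W : forall v, Rabs v < d -> 2 * M * Rabs v < 1) by (intros; nra).
  assert (S1 : is_series (fun n => P n h k l) (f (t + h) (x + k) (u + l))) by auto.
  rewrite <- (is_series_unique _ _ S1), Series_incr_1 by (eexists; apply S1).
  rewrite (hpoly0_const _ _ (HP 0%nat)), (expansion_at_0 _ _ _ _ _ _ H).
  unfold Rminus; rewrite Rplus_comm, <- Rplus_assoc, Rplus_opp_l, Rplus_0_l.
  assert (B : forall n, Rabs (P (S n) h k l) <= M ^ 2 * d * (M * d) ^ n).
  { intros n. eapply Rle_trans; [apply (hpoly_term_bound (S n) M _ d); auto; lra|].
    simpl; right; ring. }
  assert (q1 : 0 <= M * d) by nra. assert (q2 : M * d <= / 4) by nra.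
  assert (G : ex_series (fun n => M ^ 2 * d * (M * d) ^ n))
    by (apply ex_series_geom_scal; lra).
  eapply Rle_lt_trans; [apply Series_Rabs|].
  - apply @ex_series_le with (2 := G). intros n; unfold norm; simpl; unfold abs; simpl.
    now rewrite Rabs_Rabsolu.
  - eapply Rle_lt_trans; [apply Series_le with (2 := G)|].
    + intros n; split; [apply Rabs_pos|apply B].
    + rewrite Series_scal_l, Series_geom by (rewrite Rabs_pos_eq; lra).
      apply Rle_lt_trans with (M ^ 2 * d * 2); [|nra].
      apply Rmult_le_compat_l; [nra|].
      replace 2 with (/ (/ 2)) by field. apply Rinv_le_contravar; lra.
Qed.

Lemma an_near_neq0 f t x u : an f t x u -> f t x u <> 0 ->
  near t x u (fun t x u => f t x u <> 0).
Proof.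
  intros H H0. apply near_imp with (2 := an_continuous _ _ _ _ _ H (Rabs_pos_lt _ H0)).
  intros t' x' u' H' E; rewrite E in H'. unfold Rminus in H'.
  rewrite Rplus_0_l, Rabs_Ropp in H'. lra.
Qed.

(** Raising the constant to [M + / d] keeps the bounds and shrinks the domain of the expansion into
    the cube where [f = g]. *)
Lemma an_ext_near f g t x u : an f t x u ->
  near t x u (fun t x u => f t x u = g t x u) -> an g t x u.
Proof.
  intros [P [M H]] [d [d0 E]].
  assert (Hd : 0 < / d) by now apply Rinv_0_lt_compat.
  destruct (expansion_le _ _ _ _ _ _ (M + / d) H ltac:(lra)) as [H1 [HP Hs]].
  exists P, (M + / d); split; [easy|split]; [easy|].
  assert (W : forall v, 2 * (M + / d) * Rabs v < 1 -> Rabs v < d).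
  { intros v Hv. pose proof (Rabs_pos v). destruct H as [H _].
    assert (/ d * d = 1) by (field; lra).
    apply Rnot_le_lt; intros Hc. assert (/ d * d <= / d * Rabs v) by
      (apply Rmult_le_compat_l; lra). nra. }
  intros h k l Hh Hk Hl. rewrite <- E; [now apply Hs| | |];
    (match goal with |- Rabs ?e < _ => ring_simplify e end); auto.
Qed.

Lemma an_ext f g t x u : an f t x u -> (forall t x u, f t x u = g t x u) -> an g t x u.
Proof.
  intros H E; apply (an_ext_near _ _ _ _ _ H). exists 1; split; [lra|auto].
Qed.

(** * Algebra of analytic functions *)

Lemma expansion_common f g t x u : an f t x u -> an g t x u ->
  exists P Q M, expansion f t x u P M /\ expansion g t x u Q M.
Proof.
  intros [P [M HP]] [Q [N HQ]]; exists P, Q, (Rmax M N).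
  split; [eapply expansion_le; [eassumption|apply Rmax_l]
         |eapply expansion_le; [eassumption|apply Rmax_r]].
Qed.

Lemma is_series_const_term (a : R) : is_series (fun n => match n with O => a | _ => 0 end) a.
Proof.
  change (is_lim_seq (sum_n (fun n => match n with O => a | _ => 0 end)) a).
  apply is_lim_seq_ext with (fun _ => a); [|apply is_lim_seq_const].
  induction n as [|n IH]; [now rewrite sum_O|].
  rewrite sum_Sn, <- IH. symmetry; apply Rplus_0_r.
Qed.

Lemma an_const a t x u : an (fun _ _ _ => a) t x u.
Proof.
  exists (fun n _ _ _ => match n with O => a | _ => 0 end), (Rabs a + 1).
  pose proof (Rabs_pos a).
  split; [lra|split].
  - intros [|n].
    + apply hpoly_le with (Rabs a); [constructor|simpl; lra].
    + apply hpoly_zero, pow_le; lra.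
  - intros. apply is_series_const_term.
Qed.

Lemma an_coord1 t x u : an (fun t _ _ => t) t x u.
Proof.
  exists (fun n h _ _ => match n with O => t | 1%nat => h | _ => 0 end), (Rabs t + 1).
  pose proof (Rabs_pos t).
  split; [lra|split].
  - intros [|[|n]].
    + apply hpoly_le with (Rabs t); [constructor|simpl; lra].
    + apply hpoly_le with 1; [apply hpoly_coords|simpl; nra].
    + apply hpoly_zero, pow_le; lra.
  - intros h _ _ _ _ _. apply is_series_decr_1. unfold plus, opp; simpl.
    replace (t + h + - t) with h by ring. apply is_series_const_term.
Qed.

Lemma an_coord2 t x u : an (fun _ x _ => x) t x u.
Proof. apply (an_swap12 (fun x _ _ => x)), an_coord1. Qed.
Lemma an_coord3 t x u : an (fun _ _ u => u) t x u.
Proof. apply (an_swap13 (fun x _ _ => x)), an_coord1. Qed.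

Lemma an_plus f g t x u : an f t x u -> an g t x u ->
  an (fun t x u => f t x u + g t x u) t x u.
Proof.
  intros Hf Hg; destruct (expansion_common _ _ _ _ _ Hf Hg)
    as [P [Q [M [[H1 [HP Sf]] [_ [HQ Sg]]]]]].
  exists (fun n x y z => P n x y z + Q n x y z), (2 * M).
  split; [lra|split].
  - intros n; apply hpoly_le with (M ^ S n + M ^ S n); [now apply hp_add|].
    rewrite Rpow_mult_distr. assert (0 <= M ^ S n) by (apply pow_le; lra).
    assert (1 <= 2 ^ n) by (apply pow_R1_Rle; lra). simpl (2 ^ S n). nra.
  - assert (W : forall v, 2 * (2 * M) * Rabs v < 1 -> 2 * M * Rabs v < 1)
      by (intros v; pose proof (Rabs_pos v); nra).
    intros; apply (is_series_plus (V := R_NormedModule)); auto.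
Qed.

Lemma an_mult f g t x u : an f t x u -> an g t x u ->
  an (fun t x u => f t x u * g t x u) t x u.
Proof.
  intros Hf Hg; destruct (expansion_common _ _ _ _ _ Hf Hg)
    as [P [Q [M [Ef Eg]]]].
  pose proof Ef as [H1 [HP Sf]]; pose proof Eg as [_ [HQ Sg]].
  exists (fun n x y z => sum_f_R0 (fun k => P k x y z * Q (n - k)%nat x y z) n), (2 * M ^ 2).
  (* The degree [n] part is a sum of [n + 1] products, each of norm at most [M ^ (n + 2)]: the same
     absorption as for derivatives. *)
  split; [nra|split].
  - intros n; apply hpoly_le with (sum_f_R0 (fun k => M ^ S k * M ^ S (n - k)) n).
    + apply (hpoly_sum n n (fun k => M ^ S k * M ^ S (n - k))
        (fun k x y z => P k x y z * Q (n - k)%nat x y z)).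
      intros k Hk. replace n with (k + (n - k))%nat at 1 by lia. now apply hpoly_mul.
    + rewrite (sum_eq _ (fun _ => M ^ S (S n))).
      * rewrite sum_cte, Rmult_comm.
        apply Rle_trans with (2 ^ n * M ^ S (S n)).
        { apply Rmult_le_compat_r; [apply pow_le; lra|apply INR_S_le_pow2]. }
        replace ((2 * M ^ 2) ^ S n) with (2 ^ n * M ^ S (S n) * (2 * M ^ n)).
        { assert (0 <= 2 ^ n * M ^ S (S n)) by (apply Rmult_le_pos; apply pow_le; lra).
          assert (1 <= M ^ n) by (apply pow_R1_Rle; lra). nra. }
        rewrite Rpow_mult_distr, <- pow_mult.
        replace (2 * S n)%nat with (S (S n) + n)%nat by lia.
        rewrite pow_add. simpl; ring.
      * intros i Hi. rewrite <- pow_add. f_equal; lia.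
  - assert (W : forall v, 2 * (2 * M ^ 2) * Rabs v < 1 -> 2 * M * Rabs v < 1)
      by (intros; apply Rabs_small_2 with M; nra).
    intros h k l Hh Hk Hl; apply W in Hh; apply W in Hk; apply W in Hl.
    apply (is_series_mult (fun n => P n h k l) (fun n => Q n h k l)); auto.
    + now apply (expansion_abs f t x u P M).
    + now apply (expansion_abs g t x u Q M).
Qed.

Lemma an_opp f t x u : an f t x u -> an (fun t x u => - f t x u) t x u.
Proof.
  intros H. apply an_ext with (fun t x u => (-1) * f t x u); [|intros; ring].
  apply (an_mult (fun _ _ _ => -1)); [apply an_const|easy].
Qed.

Lemma an_minus f g t x u : an f t x u -> an g t x u ->
  an (fun t x u => f t x u - g t x u) t x u.
Proof. intros Hf Hg. apply an_plus; [easy|now apply an_opp]. Qed.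

(** Course-of-values recursion with a total function as memory: the hypothesis says that [step n]
    consults only values below [n]. In the proof [T n] is a table correct below [n], and [x0] fills
    the initial table. *)
Lemma strong_recursion {X : Type} (x0 : X) (step : nat -> (nat -> X) -> X) :
  (forall n f g, (forall m, (m < n)%nat -> f m = g m) -> step n f = step n g) ->
  exists W, forall n, W n = step n W.
Proof.
  intros Hs.
  pose (T := fix T n : nat -> X := match n with
    | O => fun _ => x0
    | S n => fun m => if (m <? n)%nat then T n m else step m (T n) end).
  pose (W := fun n => T (S n) n).
  assert (E : forall n m, (m < n)%nat -> T n m = W m).
  { induction n as [|n IH]; intros m Hm; [lia|].
    destruct (Nat.eq_dec m n) as [->|Hne]; [easy|].
    simpl. replace (m <? n)%nat with true by (symmetry; apply Nat.ltb_lt; lia).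
    apply IH; lia. }
  exists W; intros n. unfold W at 1; simpl. rewrite Nat.ltb_irrefl.
  apply Hs; intros; now apply E.
Qed.

Lemma geometric_convolution M M' n : 0 <= M -> 2 * M <= M' ->
  sum_f_R0 (fun k => M ^ k * M' ^ (n - k)) n <= 2 * M' ^ n.
Proof.
  intros H0 HM.
  (* The extra [M ^ n] makes the induction close: passing to [S n] turns the left side into [M']
     times the sum plus [2 * M ^ S n], and [2 * M <= M']. *)
  enough (sum_f_R0 (fun k => M ^ k * M' ^ (n - k)) n + M ^ n <= 2 * M' ^ n)
    by (assert (0 <= M ^ n) by (now apply pow_le); lra).
  induction n as [|n IH]; [simpl; lra|].
  rewrite tech5, (sum_eq _ (fun k => M ^ k * M' ^ (n - k) * M')).
  - rewrite <- scal_sum, Nat.sub_diag. simpl.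
    assert (0 <= M ^ n) by (now apply pow_le).
    assert (M' * (sum_f_R0 (fun k => M ^ k * M' ^ (n - k)) n + M ^ n) <= M' * (2 * M' ^ n))
      by (apply Rmult_le_compat_l; lra).
    nra.
  - intros k Hk. replace (S n - k)%nat with (S (n - k)) by lia. simpl; ring.
Qed.

Lemma sum_convolution_le M M' n : 0 <= M -> 2 * M <= M' ->
  sum_f_R0 (fun k => M ^ S k * M' ^ S (n - k)) n <= 2 * M * M' ^ S n.
Proof.
  intros H0 HM.
  rewrite (sum_eq _ (fun k => M ^ k * M' ^ (n - k) * (M * M'))) by (intros; simpl; ring).
  rewrite <- scal_sum. simpl. pose proof (geometric_convolution M M' n H0 HM).
  assert (0 <= M * M') by nra. nra.
Qed.

(** Comparing degrees in [f * Q = 1] determines the part of degree [n + 1] of [Q] from the lower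
    ones, with [/ a] as the only division. *)
Lemma an_inv f t x u : an f t x u -> f t x u <> 0 -> an (fun t x u => / f t x u) t x u.
Proof.
  intros [P [M H]] F0. pose proof H as [H1 [HP Hs]].
  set (a := f t x u) in *.
  destruct (strong_recursion (fun _ _ _ : R => 0) (fun n Q => match n with
    | O => fun _ _ _ => / a
    | S n => fun x y z => - / a *
        sum_f_R0 (fun k => P (S k) x y z * Q (n - k)%nat x y z) n end)) as [Q HQ].
  { intros [|n] f1 g1 E; [easy|]. extensionality h; extensionality k; extensionality l.
    f_equal. apply sum_eq. intros i Hi. rewrite E by lia. easy. }
  assert (B0 : 0 <= Rabs (/ a)) by apply Rabs_pos.
  (* Three demands: [M' >= Rabs (/ a)] for degree 0, [M' >= 2 * M] for the convolution bound, and
     [M' >= 2 * M ^ 2 * Rabs (/ a)] for one step of the recursion. *)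
  set (M' := 2 * M ^ 2 * (1 + Rabs (/ a))).
  assert (m1 : M <= M ^ 2) by nra.
  assert (m2 : 0 <= (M ^ 2 - 1) * Rabs (/ a)) by (apply Rmult_le_pos; lra).
  assert (HM' : 2 * M <= M') by (unfold M'; nra).
  assert (HM'' : Rabs (/ a) <= M') by (unfold M'; nra).
  assert (HM3 : Rabs (/ a) * (2 * M ^ 2) <= M') by (unfold M'; nra).
  assert (BQ : forall n, hpoly n (M' ^ S n) (Q n)).
  { intros n; induction n as [n IH] using (well_founded_induction lt_wf).
    rewrite HQ; destruct n as [|n].
    - apply hpoly_le with (Rabs (/ a)); [constructor|simpl; lra].
    - apply hpoly_le with (Rabs (- / a) * sum_f_R0 (fun k => M ^ S (S k) * M' ^ S (n - k)) n).
      + apply hpoly_scal.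
        apply (hpoly_sum n (S n) _ (fun k x y z => P (S k) x y z * Q (n - k)%nat x y z)).
        intros k Hk. replace (S n) with (S k + (n - k))%nat by lia.
        apply hpoly_mul; [easy|]. apply IH; lia.
      + rewrite Rabs_Ropp.
        rewrite (sum_eq _ (fun k => M ^ S k * M' ^ S (n - k) * M)) by (intros; simpl; ring).
        rewrite <- scal_sum.
        apply Rle_trans with (Rabs (/ a) * (M * (2 * M * M' ^ S n))).
        * apply Rmult_le_compat_l; [easy|]. apply Rmult_le_compat_l; [lra|].
          apply sum_convolution_le; lra.
        * replace (Rabs (/ a) * (M * (2 * M * M' ^ S n)))
            with (Rabs (/ a) * (2 * M ^ 2) * M' ^ S n) by ring.
          change (M' ^ S (S n)) with (M' * M' ^ S n).
          apply Rmult_le_compat_r; [apply pow_le; lra|easy]. }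
  exists Q, M'; split; [nra|split]; [easy|].
  intros h k l Hh Hk Hl.
  assert (W : forall v, 2 * M' * Rabs v < 1 -> 2 * M * Rabs v < 1)
    by (intros v; pose proof (Rabs_pos v); nra).
  assert (AQ : ex_series (fun n => Rabs (Q n h k l)))
    by (apply hpoly_series_abs with M'; auto; nra).
  assert (SQ := Series_correct _ (ex_series_Rabs _ AQ)).
  set (b := Series (fun n => Q n h k l)) in *.
  assert (SP : is_series (fun n => P n h k l) (f (t + h) (x + k) (u + l))) by auto.
  pose proof (is_series_mult _ _ _ _ SP SQ
    (expansion_abs _ _ _ _ _ _ _ _ _ H (W _ Hh) (W _ Hk) (W _ Hl)) AQ) as S1.
  assert (P0 : P 0%nat h k l = a)
    by (rewrite (hpoly0_const _ _ (HP 0%nat)); apply (expansion_at_0 _ _ _ _ _ _ H)).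
  (* This gives at once that [f] does not vanish at the point and that [b] is its reciprocal. *)
  assert (E1 : f (t + h) (x + k) (u + l) * b = 1).
  { rewrite <- (is_series_unique _ _ S1), <- (is_series_unique _ _ (is_series_const_term 1)).
    apply Series_ext; intros [|n].
    - simpl. rewrite HQ, P0. now field.
    - rewrite decomp_sum by lia. simpl Init.Nat.pred. simpl Nat.sub at 1.
      rewrite (HQ (S n)), P0.
      set (s := sum_f_R0 (fun i => P (S i) h k l * Q (n - i)%nat h k l) n).
      change (a * (- / a * s) + s = 0). now field. }
  replace (/ f (t + h) (x + k) (u + l)) with b; [easy|].
  apply Rmult_eq_reg_l with (f (t + h) (x + k) (u + l)); [|intros E; rewrite E in E1; lra].
  rewrite E1, Rinv_r; [easy|intros E; rewrite E in E1; lra].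
Qed.

Lemma an_div f g t x u : an f t x u -> an g t x u -> g t x u <> 0 ->
  an (fun t x u => f t x u / g t x u) t x u.
Proof. intros Hf Hg G0. apply an_mult; [easy|now apply an_inv]. Qed.

Lemma an_restrict f t x u v : an f t x u -> an (fun t x _ => f t x u) t x v.
Proof.
  intros [P [M [H1 [HP Hs]]]]. exists (fun n x y _ => P n x y 0), M.
  split; [easy|split]; [intros; now apply hpoly_restrict3|].
  intros h k l Hh Hk _. rewrite <- (Rplus_0_r u) at 1. apply Hs; auto.
  rewrite Rabs_R0; lra.
Qed.

(** [Schwarz] asks for existence of the derivatives nearby but for continuity of the mixed ones only
    at the point, which is what an expansion at that point supplies. *)
Lemma an_schwarz12 f t x u : an f t x u -> D1 (D2 f) t x u = D2 (D1 f) t x u.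
Proof.
  intros H.
  assert (C : forall g, an g t x u -> continuity_2d_pt (fun a b => g a b u) t x).
  { intros g Hg eps. destruct (an_continuous g t x u eps Hg (cond_pos eps)) as [d [d0 Hd]].
    exists (mkposreal d d0). intros; apply Hd; auto.
    now apply Rabs_diag_lt. }
  apply (Schwarz (fun a b => f a b u)).
  - destruct (near_and (near_and (near_ex_derive1 H)
      (near_ex_derive2 H)) (near_and
      (near_ex_derive1 (an_D2 H))
      (near_ex_derive2 (an_D1 H)))) as [d [d0 Hd]].
    exists (mkposreal d d0). intros a b Ha Hb.
    destruct (Hd a b u Ha Hb) as [[? ?] [? ?]]; [now apply Rabs_diag_lt|].
    repeat split; easy.
  - apply (C (D1 (D2 f))), an_D1, an_D2, H.
  - apply (C (D2 (D1 f))), an_D2, an_D1, H.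
Qed.

Lemma an_schwarz13 f t x u : an f t x u -> D1 (D3 f) t x u = D3 (D1 f) t x u.
Proof.
  intros H. pose proof (an_swap13 _ _ _ _ (an_swap12 _ _ _ _ (an_swap13 _ _ _ _ H))) as H'.
  apply (an_schwarz12 (fun t u x => f t x u) t u x H').
Qed.

Lemma an_schwarz23 f t x u : an f t x u -> D2 (D3 f) t x u = D3 (D2 f) t x u.
Proof.
  intros H. apply (an_schwarz13 (fun x t u => f t x u) x t u), an_swap12, H.
Qed.

(** * Coefficient arrays *)

(** In a monomial of degree [n] the third exponent is [n - i - j], so the coefficients are indexed
    by the triangle [i + j <= n]. *)
Definition tri (n : nat) (F : nat -> nat -> R) :=
  sum_f_R0 (fun i => sum_f_R0 (F i) (n - i)) n.

Lemma tri_ext n F G :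
  (forall i j, (i + j <= n)%nat -> F i j = G i j) -> tri n F = tri n G.
Proof. intros H; apply sum_eq; intros i Hi; apply sum_eq; intros j Hj; apply H; lia. Qed.

Lemma tri_le n F G :
  (forall i j, (i + j <= n)%nat -> F i j <= G i j) -> tri n F <= tri n G.
Proof. intros H; apply sum_Rle; intros i Hi; apply sum_Rle; intros j Hj; apply H; lia. Qed.

Lemma tri_plus n F G : tri n (fun i j => F i j + G i j) = tri n F + tri n G.
Proof.
  unfold tri. rewrite <- plus_sum. apply sum_eq; intros; apply plus_sum.
Qed.

Lemma tri_scal n a F : tri n (fun i j => a * F i j) = a * tri n F.
Proof.
  unfold tri. rewrite scal_sum. apply sum_eq; intros i _.
  rewrite Rmult_comm, scal_sum. apply sum_eq; intros; ring.
Qed.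

(** This and the next two lemmas are the effect on coefficients of multiplying a polynomial by its
    first, second or third variable. *)
Lemma tri_shift1 n F : (forall j, F 0%nat j = 0) ->
  tri (S n) F = tri n (fun i j => F (S i) j).
Proof.
  intros H. unfold tri. rewrite decomp_sum by lia. rewrite (sum_eq_R0 (F 0%nat)) by auto.
  rewrite Rplus_0_l. reflexivity.
Qed.

Lemma tri_shift2 n F : (forall i, F i 0%nat = 0) ->
  tri (S n) F = tri n (fun i j => F i (S j)).
Proof.
  intros H. unfold tri. rewrite tech5, Nat.sub_diag. simpl (sum_f_R0 (F (S n)) 0).
  rewrite H, Rplus_0_r. apply sum_eq; intros i Hi.
  rewrite decomp_sum by lia. rewrite H, Rplus_0_l.
  replace (Init.Nat.pred (S n - i)) with (n - i)%nat by lia. reflexivity.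
Qed.

Lemma tri_shift3 n F : (forall i j, (i + j = S n)%nat -> F i j = 0) ->
  tri (S n) F = tri n F.
Proof.
  intros H. unfold tri. rewrite tech5, Nat.sub_diag. simpl (sum_f_R0 (F (S n)) 0).
  rewrite H, Rplus_0_r by lia. apply sum_eq; intros i Hi.
  replace (S n - i)%nat with (S (n - i)) by lia.
  rewrite tech5, (H i) by lia. apply Rplus_0_r.
Qed.

Definition poly3 (n : nat) (a : nat -> nat -> R) (x y z : R) :=
  tri n (fun i j => a i j * x ^ i * y ^ j * z ^ (n - i - j)).

Lemma hpoly_coefficients n c p : hpoly n c p ->
  exists a, (forall x y z, p x y z = poly3 n a x y z) /\
    tri n (fun i j => Rabs (a i j)) <= c.
Proof.
  induction 1 as [c|n c d p q Hp [a [Ep Ha]] Hq [b [Eq Hb]]|n c p Hp [a [Ep Ha]]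
    |n c p Hp [a [Ep Ha]]|n c p Hp [a [Ep Ha]]|n c d p q Hp [a [Ep Ha]] Hcd Epq].
  - exists (fun _ _ => c); split; [intros|]; unfold poly3, tri; simpl; lra.
  - exists (fun i j => a i j + b i j); split.
    + intros; rewrite Ep, Eq. unfold poly3. rewrite <- tri_plus.
      apply tri_ext; intros; ring.
    + eapply Rle_trans; [apply tri_le; intros; apply Rabs_triang|].
      rewrite tri_plus; lra.
  - exists (fun i j => match i with O => 0 | S i => a i j end); split.
    + intros; rewrite Ep; unfold poly3. rewrite tri_shift1 by (intros; ring).
      rewrite <- tri_scal. apply tri_ext; intros; simpl; ring.
    + rewrite tri_shift1 by (intros; apply Rabs_R0). easy.
  - exists (fun i j => match j with O => 0 | S j => a i j end); split.
    + intros; rewrite Ep; unfold poly3. rewrite tri_shift2 by (intros; ring).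
      rewrite <- tri_scal. apply tri_ext; intros i j Hij.
      replace (S n - i - S j)%nat with (n - i - j)%nat by lia. simpl; ring.
    + rewrite tri_shift2 by (intros; apply Rabs_R0). easy.
  (* The new monomials with third exponent 0, those with [i + j = S n], must get coefficient 0; [a]
     is arbitrary there. *)
  - exists (fun i j => if (i + j <=? n)%nat then a i j else 0); split.
    + intros; rewrite Ep; unfold poly3. rewrite tri_shift3.
      * rewrite <- tri_scal. apply tri_ext; intros i j Hij.
        replace (i + j <=? n)%nat with true by (symmetry; apply Nat.leb_le; lia).
        replace (S n - i - j)%nat with (S (n - i - j)) by lia. simpl; ring.
      * intros i j Hij. replace (i + j <=? n)%nat with false
          by (symmetry; apply Nat.leb_gt; lia). ring.
    + rewrite tri_shift3.
      * eapply Rle_trans; [|apply Ha]. right. apply tri_ext; intros i j Hij.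
        replace (i + j <=? n)%nat with true by (symmetry; apply Nat.leb_le; lia). easy.
      * intros i j Hij. replace (i + j <=? n)%nat with false
          by (symmetry; apply Nat.leb_gt; lia). apply Rabs_R0.
  - exists a; split; [intros; now rewrite <- Epq|lra].
Qed.

Lemma hpoly_monomial a i j m :
  hpoly (i + j + m) (Rabs a) (fun x y z => a * x ^ i * y ^ j * z ^ m).
Proof.
  induction i as [|i IH]; simpl.
  - induction j as [|j IH]; simpl.
    + induction m as [|m IH]; simpl.
      * apply hpoly_ext with (fun _ _ _ => a); [constructor|intros; ring].
      * apply (hpoly_ext _ _ _ _ (hp_mul3 _ _ _ IH)); intros; ring.
    + apply (hpoly_ext _ _ _ _ (hp_mul2 _ _ _ IH)); intros; ring.
  - apply (hpoly_ext _ _ _ _ (hp_mul1 _ _ _ IH)); intros; ring.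
Qed.

Lemma hpoly_poly3 n a : hpoly n (tri n (fun i j => Rabs (a i j))) (poly3 n a).
Proof.
  unfold tri, poly3.
  apply (hpoly_sum n n (fun i => sum_f_R0 (fun j => Rabs (a i j)) (n - i))
    (fun i x y z => sum_f_R0 (fun j => a i j * x ^ i * y ^ j * z ^ (n - i - j)) (n - i))).
  intros i Hi. apply (hpoly_sum (n - i) n (fun j => Rabs (a i j))
    (fun j x y z => a i j * x ^ i * y ^ j * z ^ (n - i - j))).
  intros j Hj. pose proof (hpoly_monomial (a i j) i j (n - i - j)) as Hm.
  now replace (i + j + (n - i - j))%nat with n in Hm by lia.
Qed.

Lemma an_intro f t x u P c K r : 0 < r ->
  (forall n, hpoly n (c n) (P n)) -> (forall n, c n * r ^ n <= K) ->
  (forall h k l, Rabs h < r -> Rabs k < r -> Rabs l < r ->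
     is_series (fun n => P n h k l) (f (t + h) (x + k) (u + l))) ->
  an f t x u.
Proof.
  intros r0 HP Hc Hs.
  assert (Hr : 0 < / r) by now apply Rinv_0_lt_compat.
  (* [M] dominates both [K] and [/ r]: then [c n] is at most [K * (/ r) ^ n], hence at most
     [M ^ S n], and increments below [1 / (2 M)] are below [r]. *)
  set (M := 1 + / r + Rabs K). pose proof (Rabs_pos K) as K0.
  exists P, M; split; [unfold M; lra|split].
  - intros n; apply hpoly_le with (c n); [easy|].
    apply Rle_trans with (K * (/ r) ^ n).
    + rewrite pow_inv. apply Rmult_le_reg_r with (r ^ n); [now apply pow_lt|].
      eapply Rle_trans; [apply Hc|]. right; field. apply pow_nonzero; lra.
    + simpl. apply Rle_trans with (Rabs K * (/ r) ^ n).
      * apply Rmult_le_compat_r; [apply pow_le; lra|apply Rle_abs].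
      * apply Rmult_le_compat; [easy|apply pow_le; lra|unfold M; lra|].
        apply pow_incr; unfold M; lra.
  - assert (W : forall v, 2 * M * Rabs v < 1 -> Rabs v < r).
    { intros v Hv. pose proof (Rabs_pos v).
      assert (/ r * r = 1) by (field; lra).
      apply Rnot_le_lt; intros C.
      assert (/ r * r <= / r * Rabs v) by (apply Rmult_le_compat_l; lra).
      assert (/ r * Rabs v <= M * Rabs v) by
        (apply Rmult_le_compat_r; [easy|unfold M; lra]). lra. }
    auto.
Qed.

Lemma ex_series_bounded (a : nat -> R) : ex_series a -> exists K, forall n, a n <= K.
Proof.
  intros H. apply ex_series_lim_0 in H.
  destruct (filterlim_bounded (K := R_AbsRing) (V := R_NormedModule) a) as [K HK].
  { exists 0; exact H. }
  exists K; intros n. eapply Rle_trans; [apply Rle_abs|apply HK].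
Qed.

Lemma an_of_analytic3 D f t x u : analytic3 D f -> D (t, x, u) -> an f t x u.
Proof.
  intros H Hp; destruct (H t x u Hp) as [a [[r r0] Hs]]; simpl in Hs.
  (* At three equal positive increments [r'] the absolute series has as terms the coefficient sums
     times [r' ^ n]; its convergence bounds them. *)
  set (r' := r / 2). assert (Hr' : 0 < r' < r) by (unfold r'; lra).
  assert (W : Rabs r' < r) by (rewrite Rabs_pos_eq; lra).
  destruct (Hs r' r' r' W W W) as [Hex _].
  destruct (ex_series_bounded _ Hex) as [K HK].
  apply an_intro with (fun n => poly3 n (fun i j => a i j (n - i - j)%nat))
    (fun n => tri n (fun i j => Rabs (a i j (n - i - j)%nat))) K r'; [lra| | |].
  - intros; apply hpoly_poly3.
  - intros n. eapply Rle_trans; [|apply (HK n)]. right.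
    rewrite Rmult_comm, <- tri_scal, sum_n_Reals. apply sum_eq; intros i Hi.
    rewrite sum_n_Reals. apply sum_eq; intros j Hj.
    rewrite !Rabs_mult, !(Rabs_pos_eq (_ ^ _)) by (apply pow_le; lra).
    replace n with (i + (j + (n - i - j)))%nat at 1 by lia. rewrite !pow_add. ring.
  - intros h k l Hh Hk Hl. destruct (Hs h k l) as [_ S1]; try lra.
    apply (is_series_ext) with (2 := S1). intros n. rewrite sum_n_Reals.
    apply sum_eq; intros i Hi. now rewrite sum_n_Reals.
Qed.

Lemma expansion_coefficients f t x u P M : expansion f t x u P M ->
  exists a : nat -> nat -> nat -> R,
    forall n, (forall h k l, P n h k l = poly3 n (a n) h k l) /\
      tri n (fun i j => Rabs (a n i j)) <= M ^ S n.
Proof.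
  intros [_ [HP _]].
  apply (choice (fun n (a : nat -> nat -> R) =>
    (forall h k l, P n h k l = poly3 n a h k l) /\
      tri n (fun i j => Rabs (a i j)) <= M ^ S n)).
  intros n; apply (hpoly_coefficients _ _ _ (HP n)).
Qed.

Lemma small_radius M : 1 <= M ->
  exists r : posreal, forall h, Rabs h < r -> 2 * M * Rabs h < 1.
Proof.
  intros H1. assert (H0 : 0 < / (2 * M)) by (apply Rinv_0_lt_compat; lra).
  exists (mkposreal _ H0); simpl; intros h Hh.
  apply Rmult_lt_compat_l with (r := 2 * M) in Hh; [|lra].
  now rewrite Rinv_r in Hh by lra.
Qed.

Lemma analytic3_of_an D f : (forall t x u, D (t, x, u) -> an f t x u) -> analytic3 D f.
Proof.
  intros H t x u Hp; destruct (H t x u Hp) as [P [M E]]. pose proof E as [H1 [_ Hs]].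
  destruct (expansion_coefficients _ _ _ _ _ _ E) as [a Ha].
  destruct (small_radius M H1) as [r Hr].
  (* [analytic3] wants one array indexed by three exponents; their sum recovers the degree, and so
     which homogeneous part to consult. *)
  exists (fun i j m => a (i + j + m)%nat i j), r.
  intros h k l Hh Hk Hl term; split.
  - destruct (common_radius M h k l) as [q [q0 [rh [rk [rl rM]]]]]; auto; try lra.
    apply @ex_series_le with (b := fun n => M * (M * q) ^ n);
      [|apply ex_series_geom_scal; nra].
    intros n. rewrite sum_n_Reals, (sum_eq _ (fun i =>
      sum_f_R0 (fun j => Rabs (term n i j)) (n - i))) by (intros; apply sum_n_Reals).
    change (Rabs (tri n (fun i j => Rabs (term n i j))) <= M * (M * q) ^ n).
    rewrite Rabs_pos_eq by (apply cond_pos_sum; intros; apply cond_pos_sum;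
      intros; apply Rabs_pos).
    apply Rle_trans with (q ^ n * tri n (fun i j => Rabs (a n i j))).
    + rewrite <- tri_scal. apply tri_le; intros i j Hij. unfold term.
      replace (i + j + (n - i - j))%nat with n by lia.
      rewrite !Rabs_mult, <- !RPow_abs.
      replace (q ^ n) with (q ^ i * q ^ j * q ^ (n - i - j))
        by (rewrite <- !pow_add; f_equal; lia).
      rewrite Rmult_comm, !(Rmult_comm (Rabs (a n i j))), !Rmult_assoc.
      rewrite <- !(Rmult_assoc _ _ (Rabs (a n i j))). rewrite (Rmult_comm (Rabs l ^ _)).
      assert (Q : forall v m, Rabs v < q -> 0 <= Rabs v ^ m <= q ^ m).
      { intros v m Hv; split; [apply pow_le, Rabs_pos|].
        apply pow_incr; split; [apply Rabs_pos|lra]. }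
      destruct (Q h i rh), (Q k j rk), (Q l (n - i - j)%nat rl).
      apply Rle_trans with (Rabs h ^ i * Rabs k ^ j * Rabs l ^ (n - i - j) * Rabs (a n i j));
        [right; ring|].
      apply Rle_trans with (q ^ i * q ^ j * q ^ (n - i - j) * Rabs (a n i j));
        [|right; ring].
      apply Rmult_le_compat_r; [apply Rabs_pos|].
      apply Rmult_le_compat; try apply Rmult_le_compat; auto. now apply Rmult_le_pos.
    + rewrite Rpow_mult_distr. replace (M * (M ^ n * q ^ n)) with (q ^ n * M ^ S n)
        by (simpl; ring).
      apply Rmult_le_compat_l; [apply pow_le; lra|apply Ha].
  - apply is_series_ext with (fun n => P n h k l); [|apply Hs; auto].
    intros n. rewrite (proj1 (Ha n)), sum_n_Reals. apply sum_eq; intros i Hi.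
    rewrite sum_n_Reals. apply sum_eq; intros j Hj. unfold term.
    now replace (i + j + (n - i - j))%nat with n by lia.
Qed.

(** Reuses the calculus of three variables. The third coordinate 0 of the centre is a convention;
    [an2_lift] moves it to any value. *)
Definition an2 (f : R -> R -> R) t x := an (fun t x _ => f t x) t x 0.

(** Uses [0 ^ 0 = 1]: on the plane where the third coordinate is 0, only monomials free of it
    survive. *)
Lemma sum_pow_0 (b : nat -> R) m : sum_f_R0 (fun j => b j * 0 ^ (m - j)) m = b m.
Proof.
  destruct m as [|m]; [simpl; ring|].
  rewrite tech5, Nat.sub_diag, sum_eq_R0; [simpl; ring|].
  intros j Hj. rewrite pow_i by lia. ring.
Qed.

Lemma poly3_at_0 n a x y :
  poly3 n a x y 0 = sum_f_R0 (fun i => a i (n - i)%nat * x ^ i * y ^ (n - i)) n.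
Proof.
  apply sum_eq; intros i Hi. apply (sum_pow_0 (fun j => a i j * x ^ i * y ^ j)).
Qed.

Lemma an2_of_analytic2 U f t x : analytic2 U f -> U (t, x) -> an2 f t x.
Proof.
  intros H Hp; destruct (H t x Hp) as [a [[r r0] Hs]]; simpl in Hs.
  set (r' := r / 2). assert (Hr' : 0 < r' < r) by (unfold r'; lra).
  assert (W : Rabs r' < r) by (rewrite Rabs_pos_eq; lra).
  destruct (Hs r' r' W W) as [Hex _].
  destruct (ex_series_bounded _ Hex) as [K HK].
  apply an_intro with
    (fun n x y _ => sum_f_R0 (fun i => a i (n - i)%nat * x ^ i * y ^ (n - i)) n)
    (fun n => sum_f_R0 (fun i => Rabs (a i (n - i)%nat)) n) K r'; [lra| | |].
  - intros n. apply (hpoly_sum n n (fun i => Rabs (a i (n - i)%nat))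
      (fun i x y _ => a i (n - i)%nat * x ^ i * y ^ (n - i))).
    intros i Hi. pose proof (hpoly_monomial (a i (n - i)%nat) i (n - i) 0) as Hm.
    replace (i + (n - i) + 0)%nat with n in Hm by lia.
    apply (hpoly_ext _ _ _ _ Hm); intros; simpl; ring.
  - intros n. eapply Rle_trans; [|apply (HK n)]. right.
    rewrite Rmult_comm, scal_sum, sum_n_Reals. apply sum_eq; intros i Hi.
    rewrite !Rabs_mult, !(Rabs_pos_eq (_ ^ _)) by (apply pow_le; lra).
    replace n with (i + (n - i))%nat at 2 by lia. rewrite !pow_add. ring.
  - intros h k l Hh Hk Hl. destruct (Hs h k) as [_ S1]; try lra.
    apply (is_series_ext) with (2 := S1). intros n. now rewrite sum_n_Reals.
Qed.

Lemma analytic2_of_an2 U f : (forall t x, U (t, x) -> an2 f t x) -> analytic2 U f.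
Proof.
  intros H t x Hp; destruct (H t x Hp) as [P [M E]]. pose proof E as [H1 [_ Hs]].
  destruct (expansion_coefficients _ _ _ _ _ _ E) as [a Ha].
  destruct (small_radius M H1) as [r Hr].
  exists (fun i j => a (i + j)%nat i j), r.
  assert (Z : 2 * M * Rabs 0 < 1) by (rewrite Rabs_R0; lra).
  intros h k Hh Hk term; split.
  - destruct (common_radius M h k 0) as [q [q0 [rh [rk [rl rM]]]]]; auto; try lra.
    apply @ex_series_le with (b := fun n => M * (M * q) ^ n);
      [|apply ex_series_geom_scal; nra].
    intros n. rewrite sum_n_Reals.
    change (Rabs (sum_f_R0 (fun i => Rabs (term n i)) n) <= M * (M * q) ^ n).
    rewrite Rabs_pos_eq by (apply cond_pos_sum; intros; apply Rabs_pos).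
    apply Rle_trans with (q ^ n * tri n (fun i j => Rabs (a n i j))).
    + rewrite <- tri_scal. apply sum_Rle; intros i Hi. unfold term.
      apply Rle_trans with (q ^ n * Rabs (a n i (n - i)%nat)).
      * replace (i + (n - i))%nat with n by lia.
        rewrite !Rabs_mult, <- !RPow_abs.
        replace (q ^ n) with (q ^ i * q ^ (n - i)) by (rewrite <- !pow_add; f_equal; lia).
        assert (Q : forall v m, Rabs v < q -> 0 <= Rabs v ^ m <= q ^ m).
        { intros v m Hv; split; [apply pow_le, Rabs_pos|].
          apply pow_incr; split; [apply Rabs_pos|lra]. }
        destruct (Q h i rh), (Q k (n - i)%nat rk).
        rewrite Rmult_assoc, Rmult_comm.
        apply Rmult_le_compat_r; [apply Rabs_pos|]. now apply Rmult_le_compat.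
      * destruct (n - i)%nat as [|m]; [simpl; lra|]. rewrite tech5.
        assert (0 <= sum_f_R0 (fun j => q ^ n * Rabs (a n i j)) m); [|lra].
        apply cond_pos_sum; intros; apply Rmult_le_pos; [apply pow_le; lra|apply Rabs_pos].
    + rewrite Rpow_mult_distr. replace (M * (M ^ n * q ^ n)) with (q ^ n * M ^ S n)
        by (simpl; ring).
      apply Rmult_le_compat_l; [apply pow_le; lra|apply Ha].
  - apply is_series_ext with (fun n => P n h k 0); [|apply Hs; auto].
    intros n. rewrite (proj1 (Ha n)), sum_n_Reals, poly3_at_0. apply sum_eq; intros i Hi.
    unfold term. now replace (i + (n - i))%nat with n by lia.
Qed.

(** * Linear differential equations *)

Lemma expansion_D2_eq f t x u P M h k l : expansion f t x u P M ->
  2 * M * Rabs h < 1 -> 2 * M * Rabs k < 1 -> 2 * M * Rabs l < 1 ->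
  D2 f (t + h) (x + k) (u + l) = Series (fun n => D2 (P (S n)) h k l).
Proof.
  intros H Hh Hk Hl. apply is_derive_unique.
  now apply (expansion_is_derive (fun x t u => f t x u) x t u
    (fun n y x z => P n x y z) M k h l (expansion_swap12 _ _ _ _ _ _ H)).
Qed.

Lemma near_of_expansion t x u M (P : R -> R -> R -> Prop) : 1 <= M ->
  (forall h k l, 2 * M * Rabs h < 1 -> 2 * M * Rabs k < 1 -> 2 * M * Rabs l < 1 ->
    P (t + h) (x + k) (u + l)) -> near t x u P.
Proof.
  intros H1 H. destruct (small_radius M H1) as [[r r0] Hr]; simpl in Hr.
  exists r; split; [easy|]. intros t' x' u' Ht Hx Hu.
  replace t' with (t + (t' - t)) by ring. replace x' with (x + (x' - x)) by ring.
  replace u' with (u + (u' - u)) by ring. auto.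
Qed.

(** Capital letters are the homogeneous parts of the functions in lower case, [N] those of [c]. The
    recursion is the differential equation read degree by degree; summing the Cauchy products gives
    it back. *)
Lemma linear_ode_row a b c phi w1 w2 v A B N Phi W1 W2 V t x u M :
  expansion a t x u A M -> expansion b t x u B M -> expansion c t x u N M ->
  expansion phi t x u Phi M -> expansion w1 t x u W1 M ->
  expansion w2 t x u W2 M -> expansion v t x u V M ->
  (forall n h l, V n h 0 l = Phi n h 0 l) ->
  (forall n h k l, D2 (V (S n)) h k l =
    sum_f_R0 (fun i => A i h k l * W1 (n - i)%nat h k l
                     + B i h k l * W2 (n - i)%nat h k l) n + N n h k l) ->
  near t x u (fun t x u => D2 v t x u = a t x u * w1 t x u + b t x u * w2 t x u + c t x u)
  /\ near t x u (fun t' _ u' => v t' x u' = phi t' x u').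
Proof.
  intros Ea Eb Ec Ep E1 E2 Ev I0 HD. split.
  - apply near_of_expansion with M; [apply Ea|]. intros h k l Hh Hk Hl.
    rewrite (expansion_D2_eq _ _ _ _ _ _ _ _ _ Ev) by easy. apply is_series_unique.
    pose proof (is_series_mult _ _ _ _ (proj2 (proj2 Ea) _ _ _ Hh Hk Hl)
      (proj2 (proj2 E1) _ _ _ Hh Hk Hl) (expansion_abs _ _ _ _ _ _ _ _ _ Ea Hh Hk Hl)
      (expansion_abs _ _ _ _ _ _ _ _ _ E1 Hh Hk Hl)) as S1.
    pose proof (is_series_mult _ _ _ _ (proj2 (proj2 Eb) _ _ _ Hh Hk Hl)
      (proj2 (proj2 E2) _ _ _ Hh Hk Hl) (expansion_abs _ _ _ _ _ _ _ _ _ Eb Hh Hk Hl)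
      (expansion_abs _ _ _ _ _ _ _ _ _ E2 Hh Hk Hl)) as S2.
    pose proof (is_series_plus _ _ _ _ (is_series_plus _ _ _ _ S1 S2)
      (proj2 (proj2 Ec) _ _ _ Hh Hk Hl)) as S3.
    apply is_series_ext with (2 := S3). intros n. rewrite HD, plus_sum. reflexivity.
  - apply near_imp with (P := fun t' x' u' =>
      v t' (x + 0) u' = phi t' (x + 0) u'); [intros ? ? ?; now rewrite Rplus_0_r|].
    apply near_of_expansion with M; [apply Ea|]. intros h k l Hh _ Hl.
    assert (Z : 2 * M * Rabs 0 < 1) by (rewrite Rabs_R0; lra).
    rewrite <- (is_series_unique _ _ (proj2 (proj2 Ev) _ _ _ Hh Z Hl)).
    rewrite <- (is_series_unique _ _ (proj2 (proj2 Ep) _ _ _ Hh Z Hl)).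
    apply Series_ext; intros; apply I0.
Qed.

Lemma an_large f t x u : an f t x u ->
  exists P M0, 1 <= M0 /\ forall M, M0 <= M -> expansion f t x u P M.
Proof.
  intros [P [M H]]; exists P, M; split; [apply H|].
  intros; now apply expansion_le with M.
Qed.

Lemma expansion_of_hpoly P M t x u : 1 <= M -> (forall n, hpoly n (M ^ S n) (P n)) ->
  expansion (fun t' x' u' => Series (fun n => P n (t' - t) (x' - x) (u' - u))) t x u P M.
Proof.
  intros H1 HP; split; [easy|split]; [easy|]. intros h k l Hh Hk Hl.
  replace (t + h - t) with h by ring. replace (x + k - x) with k by ring.
  replace (u + l - u) with l by ring.
  now apply Series_correct, ex_series_Rabs, hpoly_series_abs with M.
Qed.

(** A linear Cauchy problem in the second variable, with the others as parameters, solved by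
    majorants. Integration does not increase the coefficient sum, so only the convolutions with the
    coefficients contribute to growth. *)
Lemma an_linear_ode a11 a12 a21 a22 b1 b2 phi1 phi2 t x u :
  an a11 t x u -> an a12 t x u -> an a21 t x u -> an a22 t x u ->
  an b1 t x u -> an b2 t x u -> an phi1 t x u -> an phi2 t x u ->
  exists w1 w2, an w1 t x u /\ an w2 t x u /\
  near t x u (fun t x u =>
    D2 w1 t x u = a11 t x u * w1 t x u + a12 t x u * w2 t x u + b1 t x u) /\
  near t x u (fun t x u =>
    D2 w2 t x u = a21 t x u * w1 t x u + a22 t x u * w2 t x u + b2 t x u) /\
  near t x u (fun t' _ u' => w1 t' x u' = phi1 t' x u') /\
  near t x u (fun t' _ u' => w2 t' x u' = phi2 t' x u').
Proof.
  intros H11 H12 H21 H22 Hb1 Hb2 Hp1 Hp2.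
  destruct (an_large _ _ _ _ H11) as [A11 [m1 [l1 E11]]].
  destruct (an_large _ _ _ _ H12) as [A12 [m2 [l2 E12]]].
  destruct (an_large _ _ _ _ H21) as [A21 [m3 [l3 E21]]].
  destruct (an_large _ _ _ _ H22) as [A22 [m4 [l4 E22]]].
  destruct (an_large _ _ _ _ Hb1) as [N1 [m5 [l5 Eb1]]].
  destruct (an_large _ _ _ _ Hb2) as [N2 [m6 [l6 Eb2]]].
  destruct (an_large _ _ _ _ Hp1) as [Phi1 [m7 [l7 Ep1]]].
  destruct (an_large _ _ _ _ Hp2) as [Phi2 [m8 [l8 Ep2]]].
  set (M := m1 + m2 + m3 + m4 + m5 + m6 + m7 + m8).
  set (rhs := fun (A B N : nat -> R -> R -> R -> R) n
      (W : nat -> (R -> R -> R -> R) * (R -> R -> R -> R)) h k l =>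
    sum_f_R0 (fun i => A i h k l * fst (W (n - i)%nat) h k l
                     + B i h k l * snd (W (n - i)%nat) h k l) n + N n h k l).
  (* Degree [n + 1] of the solution: the initial datum on [k = 0] plus the primitive in [k] of
     degree [n] of the right-hand side. *)
  set (row := fun (A B N Phi : nat -> R -> R -> R -> R) n W h k l =>
    Phi (S n) h 0 l + J2 (rhs A B N n W) h k l).
  destruct (strong_recursion (fun _ _ _ : R => 0, fun _ _ _ : R => 0) (fun n W =>
    match n with
    | O => (fun h _ l => Phi1 0%nat h 0 l, fun h _ l => Phi2 0%nat h 0 l)
    | S n => (row A11 A12 N1 Phi1 n W, row A21 A22 N2 Phi2 n W)
    end)) as [W HW].
  { intros [|n] f g E; [easy|].
    assert (R : forall A B N, rhs A B N n f = rhs A B N n g).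
    { intros A B N. unfold rhs. extensionality h; extensionality k; extensionality l.
      f_equal. apply sum_eq. intros i Hi. now rewrite E by lia. }
    unfold row. now rewrite !R. }
  assert (F11 : expansion a11 t x u A11 M) by (apply E11; unfold M; lra).
  assert (F12 : expansion a12 t x u A12 M) by (apply E12; unfold M; lra).
  assert (F21 : expansion a21 t x u A21 M) by (apply E21; unfold M; lra).
  assert (F22 : expansion a22 t x u A22 M) by (apply E22; unfold M; lra).
  assert (G1 : expansion b1 t x u N1 M) by (apply Eb1; unfold M; lra).
  assert (G2 : expansion b2 t x u N2 M) by (apply Eb2; unfold M; lra).
  assert (K1 : expansion phi1 t x u Phi1 M) by (apply Ep1; unfold M; lra).
  assert (K2 : expansion phi2 t x u Phi2 M) by (apply Ep2; unfold M; lra).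
  assert (BM : 1 <= M) by apply F11.
  clear E11 E12 E21 E22 Eb1 Eb2 Ep1 Ep2. clearbody M.
  clear m1 m2 m3 m4 m5 m6 m7 m8 l1 l2 l3 l4 l5 l6 l7 l8.
  (* Two products cost [2 * M] each times 2 coefficients-by-convolution, the source one more [M],
     the initial datum another: any [M' >= 6 * M] leaves room. *)
  pose (M' := 16 * M).
  assert (BR : forall A B N n,
    (forall i, hpoly i (M ^ S i) (A i)) -> (forall i, hpoly i (M ^ S i) (B i)) ->
    (forall i, hpoly i (M ^ S i) (N i)) ->
    (forall m, (m <= n)%nat -> hpoly m (M' ^ S m) (fst (W m)) /\
      hpoly m (M' ^ S m) (snd (W m))) ->
    hpoly n (5 * M * M' ^ S n) (rhs A B N n W)).
  { intros A B N n HA HB HN HWn.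
    apply hpoly_le with
      (sum_f_R0 (fun i => M ^ S i * M' ^ S (n - i) + M ^ S i * M' ^ S (n - i)) n + M ^ S n).
    - apply hp_add; [|easy].
      apply (hpoly_sum n n _ (fun i h k l => A i h k l * fst (W (n - i)%nat) h k l
                     + B i h k l * snd (W (n - i)%nat) h k l)).
      intros i Hi. destruct (HWn (n - i)%nat ltac:(lia)) as [W1 W2].
      replace n with (i + (n - i))%nat at 1 by lia.
      apply hp_add; now apply hpoly_mul.
    - rewrite plus_sum. pose proof (sum_convolution_le M M' n) as G.
      assert (M ^ S n <= M' ^ S n) by (apply pow_incr; unfold M'; lra).
      assert (0 <= M' ^ S n) by (apply pow_le; unfold M'; lra).
      assert (M' ^ S n <= M * M' ^ S n) by nra.
      unfold M' in *; lra. }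
  assert (BRow : forall A B N Phi n,
    (forall i, hpoly i (M ^ S i) (A i)) -> (forall i, hpoly i (M ^ S i) (B i)) ->
    (forall i, hpoly i (M ^ S i) (N i)) -> (forall i, hpoly i (M ^ S i) (Phi i)) ->
    (forall m, (m <= n)%nat -> hpoly m (M' ^ S m) (fst (W m)) /\
      hpoly m (M' ^ S m) (snd (W m))) ->
    hpoly (S n) (M' ^ S (S n)) (row A B N Phi n W)).
  { intros A B N Phi n HA HB HN HP HWn.
    apply hpoly_le with (M ^ S (S n) + 5 * M * M' ^ S n).
    - apply hp_add; [apply (hpoly_restrict2 _ _ _ (HP (S n)))|].
      now apply hpoly_J2, BR.
    - assert (M ^ S n <= M' ^ S n) by (apply pow_incr; unfold M'; lra).
      change (M * M ^ S n + 5 * M * M' ^ S n <= M' * M' ^ S n).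
      assert (0 <= M' ^ S n) by (apply pow_le; unfold M'; lra).
      assert (M * M ^ S n <= M * M' ^ S n) by (apply Rmult_le_compat_l; lra).
      assert (M' * M' ^ S n = 16 * (M * M' ^ S n)) by (unfold M' at 1; ring).
      assert (0 <= M * M' ^ S n) by (apply Rmult_le_pos; lra). lra. }
  assert (BW : forall n, hpoly n (M' ^ S n) (fst (W n)) /\ hpoly n (M' ^ S n) (snd (W n))).
  { intros n; induction n as [n IH] using (well_founded_induction lt_wf).
    rewrite HW; destruct n as [|n]; simpl fst; simpl snd.
    - split; apply hpoly_le with (M ^ 1); try (apply pow_incr; unfold M'; lra).
      + apply (hpoly_restrict2 0 (M ^ 1) (Phi1 0%nat)), K1.
      + apply (hpoly_restrict2 0 (M ^ 1) (Phi2 0%nat)), K2.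
    - assert (IH' : forall m, (m <= n)%nat -> hpoly m (M' ^ S m) (fst (W m)) /\
        hpoly m (M' ^ S m) (snd (W m))) by (intros; apply IH; lia).
      split; apply BRow; auto;
        first [apply F11|apply F12|apply F21|apply F22|apply G1|apply G2|apply K1|apply K2]. }
  set (W1 := fun n => fst (W n)). set (W2 := fun n => snd (W n)).
  assert (X1 := expansion_of_hpoly W1 M' t x u ltac:(unfold M'; lra) (fun n => proj1 (BW n))).
  assert (X2 := expansion_of_hpoly W2 M' t x u ltac:(unfold M'; lra) (fun n => proj2 (BW n))).
  assert (DR : forall A B N Phi n h k l,
    (forall i, hpoly i (M ^ S i) (A i)) -> (forall i, hpoly i (M ^ S i) (B i)) ->
    (forall i, hpoly i (M ^ S i) (N i)) ->
    row A B N Phi n W h 0 l = Phi (S n) h 0 l /\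
    D2 (row A B N Phi n W) h k l = rhs A B N n W h k l).
  { intros A B N Phi n h k l HA HB HN.
    destruct (hpoly_J2 _ _ _ (BR A B N n HA HB HN (fun m _ => BW m))) as [_ [J0 DJ]].
    unfold row; split; [now rewrite J0, Rplus_0_r|].
    apply is_derive_unique. rewrite <- (Rplus_0_l (rhs _ _ _ _ _ _ _ _)).
    apply (is_derive_plus (fun _ => Phi (S n) h 0 l)); [apply @is_derive_const|apply DJ]. }
  set (w1 := fun t' x' u' => Series (fun n => W1 n (t' - t) (x' - x) (u' - u))) in X1.
  set (w2 := fun t' x' u' => Series (fun n => W2 n (t' - t) (x' - x) (u' - u))) in X2.
  destruct (linear_ode_row a11 a12 b1 phi1 w1 w2 w1 A11 A12 N1 Phi1 W1 W2 W1 t x u M')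
    as [R1 I1]; auto; try (apply expansion_le with M; [easy|unfold M'; lra]).
  { intros [|n] h l; unfold W1; rewrite HW; [easy|]. simpl fst.
    apply (DR _ _ _ _ n h 0 l); [apply F11|apply F12|apply G1]. }
  { intros n h k l; unfold W1 at 1; rewrite HW. simpl fst.
    apply DR; [apply F11|apply F12|apply G1]. }
  destruct (linear_ode_row a21 a22 b2 phi2 w1 w2 w2 A21 A22 N2 Phi2 W1 W2 W2 t x u M')
    as [R2 I2]; auto; try (apply expansion_le with M; [easy|unfold M'; lra]).
  { intros [|n] h l; unfold W2; rewrite HW; [easy|]. simpl snd.
    apply (DR _ _ _ _ n h 0 l); [apply F21|apply F22|apply G2]. }
  { intros n h k l; unfold W2 at 1; rewrite HW. simpl snd.
    apply DR; [apply F21|apply F22|apply G2]. }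
  exists w1, w2; repeat split; auto; eexists; eexists; [apply X1|apply X2].
Qed.

(** * Functions of two variables and the identity theorem *)

Definition Dt (f : R -> R -> R) t x := Derive (fun s => f s x) t.
Definition Dx (f : R -> R -> R) t x := Derive (fun s => f t s) x.

Definition near2 (t x : R) (P : R -> R -> Prop) :=
  exists d, 0 < d /\ forall t' x', Rabs (t' - t) < d -> Rabs (x' - x) < d -> P t' x'.

Lemma near2_imp t x (P Q : R -> R -> Prop) :
  (forall t x, P t x -> Q t x) -> near2 t x P -> near2 t x Q.
Proof. intros I [d [d0 H]]; exists d; auto. Qed.

Lemma near2_and t x (P Q : R -> R -> Prop) :
  near2 t x P -> near2 t x Q -> near2 t x (fun t x => P t x /\ Q t x).
Proof.
  intros [d [d0 H]] [d' [d0' H']]; exists (Rmin d d').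
  pose proof (Rmin_l d d'); pose proof (Rmin_r d d').
  split; [now apply Rmin_pos|]. intros; split; [apply H|apply H']; lra.
Qed.
Arguments near2_and {t x P Q}.

Lemma near2_self t x P : near2 t x P -> P t x.
Proof. intros [d [d0 H]]; apply H; now apply Rabs_diag_lt. Qed.
Arguments near2_self {t x P}.

(** This is what allows an equality valid near a point to be differentiated there and again at all
    close points. *)
Lemma near2_near t x P : near2 t x P -> near2 t x (fun t x => near2 t x P).
Proof.
  intros [d [d0 H]]; exists (d / 2); split; [lra|]. intros t' x' Ht Hx.
  exists (d / 2); split; [lra|]. intros t'' x'' Ht' Hx'. apply H.
  - replace (t'' - t) with ((t'' - t') + (t' - t)) by ring.
    eapply Rle_lt_trans; [apply Rabs_triang|lra].
  - replace (x'' - x) with ((x'' - x') + (x' - x)) by ring.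
    eapply Rle_lt_trans; [apply Rabs_triang|lra].
Qed.
Arguments near2_near {t x P}.

Lemma near2_of_near t x u (P : R -> R -> R -> Prop) :
  near t x u P -> near2 t x (fun t x => P t x u).
Proof.
  intros [d [d0 H]]; exists d; split; [easy|]. intros; apply H; auto.
  now apply Rabs_diag_lt.
Qed.
Arguments near2_of_near {t x u P}.

Lemma near2_locally_t t x P : near2 t x P -> locally t (fun s => P s x).
Proof.
  intros [d [d0 H]]. exists (mkposreal d d0). intros s Hs. apply H; [apply Hs|].
  now apply Rabs_diag_lt.
Qed.
Arguments near2_locally_t {t x P}.

Lemma near2_locally_x t x P : near2 t x P -> locally x (fun s => P t s).
Proof.
  intros [d [d0 H]]. exists (mkposreal d d0). intros s Hs. apply H; [|apply Hs].
  now apply Rabs_diag_lt.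
Qed.
Arguments near2_locally_x {t x P}.

Lemma open_near2 (U : R * R -> Prop) t x : open U -> U (t, x) ->
  near2 t x (fun t x => U (t, x)).
Proof.
  intros HU Hp; destruct (HU _ Hp) as [[d d0] Hd].
  exists d; split; [easy|]. intros t' x' Ht Hx. apply Hd. split; [apply Ht|apply Hx].
Qed.

Lemma near2_open (U : R * R -> Prop) :
  (forall t x, U (t, x) -> near2 t x (fun t x => U (t, x))) -> open U.
Proof.
  intros H [t x] Hp; destruct (H t x Hp) as [d [d0 Hd]].
  exists (mkposreal d d0). intros [t' x'] [Ht Hx]. apply Hd; [apply Ht|apply Hx].
Qed.

Lemma Dt_near f g t x : near2 t x (fun t x => f t x = g t x) ->
  near2 t x (fun t x => Dt f t x = Dt g t x).
Proof.
  intros H; apply near2_imp with (2 := near2_near H). intros t' x' H'.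
  apply Derive_ext_loc, (near2_locally_t H').
Qed.
Arguments Dt_near {f g t x}.

Lemma Dx_near f g t x : near2 t x (fun t x => f t x = g t x) ->
  near2 t x (fun t x => Dx f t x = Dx g t x).
Proof.
  intros H; apply near2_imp with (2 := near2_near H). intros t' x' H'.
  apply Derive_ext_loc, (near2_locally_x H').
Qed.
Arguments Dx_near {f g t x}.

Lemma an2_const c t x : an2 (fun _ _ => c) t x.
Proof. exact (an_const c t x 0). Qed.
Lemma an2_plus f g t x : an2 f t x -> an2 g t x -> an2 (fun t x => f t x + g t x) t x.
Proof. exact (an_plus _ _ t x 0). Qed.
Lemma an2_minus f g t x : an2 f t x -> an2 g t x -> an2 (fun t x => f t x - g t x) t x.
Proof. exact (an_minus _ _ t x 0). Qed.
Lemma an2_opp f t x : an2 f t x -> an2 (fun t x => - f t x) t x.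
Proof. exact (an_opp _ t x 0). Qed.
Lemma an2_mult f g t x : an2 f t x -> an2 g t x -> an2 (fun t x => f t x * g t x) t x.
Proof. exact (an_mult _ _ t x 0). Qed.
Lemma an2_div f g t x : an2 f t x -> an2 g t x -> g t x <> 0 ->
  an2 (fun t x => f t x / g t x) t x.
Proof. exact (an_div _ _ t x 0). Qed.
Lemma an2_lincomb c1 c2 f g t x : an2 f t x -> an2 g t x ->
  an2 (fun t x => c1 * f t x + c2 * g t x) t x.
Proof.
  intros Hf Hg.
  apply an2_plus; [apply (an2_mult (fun _ _ => c1))|apply (an2_mult (fun _ _ => c2))];
    auto; apply an2_const.
Qed.

Lemma an2_Dt f t x : an2 f t x -> an2 (Dt f) t x.
Proof. exact (@an_D1 _ t x 0). Qed.
Arguments an2_Dt {f t x}.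
Lemma an2_Dx f t x : an2 f t x -> an2 (Dx f) t x.
Proof. exact (@an_D2 _ t x 0). Qed.
Arguments an2_Dx {f t x}.

Lemma an2_is_derive_t f t x : an2 f t x -> is_derive (fun s => f s x) t (Dt f t x).
Proof. exact (@an_is_derive1 _ t x 0). Qed.
Arguments an2_is_derive_t {f t x}.
Lemma an2_is_derive_x f t x : an2 f t x -> is_derive (fun s => f t s) x (Dx f t x).
Proof. exact (@an_is_derive2 _ t x 0). Qed.
Arguments an2_is_derive_x {f t x}.
Lemma an2_near_derive_t f t x : an2 f t x ->
  near2 t x (fun t x => is_derive (fun s => f s x) t (Dt f t x)).
Proof.
  intros H. apply near2_imp with (2 := near2_of_near (near_ex_derive1 H)).
  intros; now apply Derive_correct.
Qed.
Arguments an2_near_derive_t {f t x}.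
Lemma an2_near_derive_x f t x : an2 f t x ->
  near2 t x (fun t x => is_derive (fun s => f t s) x (Dx f t x)).
Proof.
  intros H. apply near2_imp with (2 := near2_of_near (near_ex_derive2 H)).
  intros; now apply Derive_correct.
Qed.
Arguments an2_near_derive_x {f t x}.

Lemma an2_continuous f t x eps : an2 f t x -> 0 < eps ->
  near2 t x (fun t' x' => Rabs (f t' x' - f t x) < eps).
Proof. intros H He. apply (near2_of_near (an_continuous _ _ _ _ _ H He)). Qed.

Lemma an2_near_neq0 f t x : an2 f t x -> f t x <> 0 -> near2 t x (fun t x => f t x <> 0).
Proof. intros H H0. apply (near2_of_near (an_near_neq0 _ _ _ _ H H0)). Qed.

Lemma an2_ext_near f g t x : an2 f t x -> near2 t x (fun t x => f t x = g t x) -> an2 g t x.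
Proof.
  intros H [d [d0 E]]. apply (an_ext_near _ _ _ _ _ H). exists d; split; auto.
Qed.

Lemma an2_lift f t x u : an2 f t x -> an (fun t x _ => f t x) t x u.
Proof. intros H. apply (an_restrict _ t x 0 u H). Qed.

Lemma an2_slice f t x u : an f t x u -> an2 (fun t x => f t x u) t x.
Proof. intros H. apply (an_restrict _ t x u 0 H). Qed.

Lemma an2_analytic2 U f : analytic2 U f <-> (forall t x, U (t, x) -> an2 f t x).
Proof.
  split; [|apply analytic2_of_an2]. intros H t x Hp; now apply an2_of_analytic2 with U.
Qed.

(** * Connectedness of boxes and intervals *)

Lemma unit_interval_connected (V W : R -> Prop) : open V -> open W ->
  (forall s, 0 <= s <= 1 -> V s \/ W s) -> V 0 -> W 1 ->
  exists s, 0 <= s <= 1 /\ V s /\ W s.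
Proof.
  intros HV HW HC H0 H1.
  (* If [V m] with [m < 1], openness pushes past the supremum [m]. If [W m], then [W] contains an
     interval below [m], which meets [V] because [m] is the least upper bound. *)
  destruct (completeness (fun s => 0 <= s <= 1 /\ V s)) as [m [Hub Hlub]].
  - exists 1; intros s [Hs _]; lra.
  - exists 0; split; [lra|easy].
  - assert (M0 : 0 <= m) by (apply Hub; split; [lra|easy]).
    assert (M1 : m <= 1) by (apply Hlub; intros s [Hs _]; lra).
    destruct (HC m (conj M0 M1)) as [Hm|Hm].
    + destruct (Rle_lt_or_eq_dec _ _ M1) as [Hlt|E]; [|subst m; exists 1; repeat split; auto; lra].
      destruct (HV m Hm) as [[d d0] Hd].
      set (s := m + Rmin (d / 2) (1 - m)).
      pose proof (Rmin_l (d / 2) (1 - m)). pose proof (Rmin_r (d / 2) (1 - m)).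
      assert (0 < Rmin (d / 2) (1 - m)) by (apply Rmin_pos; lra).
      assert (s <= m); [|unfold s in *; lra].
      apply Hub; split; [unfold s; lra|]. apply Hd.
      change (Rabs (s - m) < d). unfold s. replace (m + Rmin (d / 2) (1 - m) - m)
        with (Rmin (d / 2) (1 - m)) by ring. rewrite Rabs_pos_eq; lra.
    + destruct (HW m Hm) as [[d d0] Hd].
      apply NNPP; intros N. assert (m <= m - d / 2); [|lra].
      apply Hlub; intros s [Hs Vs]. apply Rnot_lt_le; intros Hlt. apply N.
      exists s; repeat split; try lra; auto. apply Hd.
      assert (s <= m) by (apply Hub; auto).
      change (Rabs (s - m) < d). apply Rabs_def1; lra.
Qed.

Lemma path_connected {T : UniformSpace} (S : T -> Prop) :
  (forall p q, S p -> S q -> exists g : R -> T,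
    (forall V, open V -> open (fun s => V (g s))) /\ g 0 = p /\ g 1 = q /\
    forall s, 0 <= s <= 1 -> S (g s)) ->
  connected_set S.
Proof.
  intros H V W HV HW HC [p [Sp Vp]] [q [Sq Wq]].
  destruct (H p q Sp Sq) as [g [Cg [g0 [g1 Sg]]]].
  destruct (unit_interval_connected (fun s => V (g s)) (fun s => W (g s)))
    as [s [Hs [Vs Ws]]]; auto; try congruence.
  exists (g s); auto.
Qed.

Lemma affine_near (a b s d : R) : 0 < d ->
  exists e, 0 < e /\ forall s', Rabs (s' - s) < e ->
    Rabs (a + s' * (b - a) - (a + s * (b - a))) < d.
Proof.
  intros d0. pose proof (Rabs_pos (b - a)).
  exists (d / (1 + Rabs (b - a))). split; [apply Rdiv_lt_0_compat; lra|].
  intros s' Hs. replace (a + s' * (b - a) - (a + s * (b - a))) with ((s' - s) * (b - a)) by ring.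
  rewrite Rabs_mult. pose proof (Rabs_pos (s' - s)).
  apply Rle_lt_trans with (Rabs (s' - s) * (1 + Rabs (b - a))); [nra|].
  apply Rmult_lt_compat_r with (r := 1 + Rabs (b - a)) in Hs; [|lra].
  unfold Rdiv in Hs. rewrite Rmult_assoc, Rinv_l, Rmult_1_r in Hs; lra.
Qed.

Lemma affine_between (a b c d s : R) : Rabs (a - c) < d -> Rabs (b - c) < d ->
  0 <= s <= 1 -> Rabs (a + s * (b - a) - c) < d.
Proof.
  intros Ha Hb Hs. replace (a + s * (b - a) - c) with ((1 - s) * (a - c) + s * (b - c)) by ring.
  eapply Rle_lt_trans; [apply Rabs_triang|].
  rewrite !Rabs_mult, (Rabs_pos_eq (1 - s)), (Rabs_pos_eq s) by lra.
  destruct (Rle_lt_or_eq_dec 0 s (proj1 Hs)) as [H|<-]; [|lra].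
  assert (s * Rabs (b - c) < s * d) by now apply Rmult_lt_compat_l.
  assert ((1 - s) * Rabs (a - c) <= (1 - s) * d) by (apply Rmult_le_compat_l; lra).
  lra.
Qed.

Definition box (t x d : R) : R * R -> Prop :=
  fun p => Rabs (fst p - t) < d /\ Rabs (snd p - x) < d.

Lemma box_center t x d : 0 < d -> box t x d (t, x).
Proof. intros; split; simpl; now apply Rabs_diag_lt. Qed.

Lemma region_box t x d : 0 < d -> region (box t x d).
Proof.
  intros d0; split; [|split].
  - apply near2_open; intros t' x' [Ht Hx]; simpl in *.
    exists (Rmin (d - Rabs (t' - t)) (d - Rabs (x' - x))).
    split; [apply Rmin_pos; lra|]. intros t'' x'' Ht' Hx'.
    pose proof (Rmin_l (d - Rabs (t' - t)) (d - Rabs (x' - x))).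
    pose proof (Rmin_r (d - Rabs (t' - t)) (d - Rabs (x' - x))).
    split; simpl.
    + replace (t'' - t) with ((t'' - t') + (t' - t)) by ring.
      eapply Rle_lt_trans; [apply Rabs_triang|lra].
    + replace (x'' - x) with ((x'' - x') + (x' - x)) by ring.
      eapply Rle_lt_trans; [apply Rabs_triang|lra].
  - apply path_connected. intros [a1 a2] [b1 b2] [Ha1 Ha2] [Hb1 Hb2]; simpl in *.
    exists (fun s => (a1 + s * (b1 - a1), a2 + s * (b2 - a2))). repeat split.
    + intros V HV s Hs. destruct (open_near2 _ _ _ HV Hs) as [e [e0 He]].
      destruct (affine_near a1 b1 s e e0) as [e1 [e1p He1]].
      destruct (affine_near a2 b2 s e e0) as [e2 [e2p He2]].
      exists (mkposreal _ (Rmin_pos _ _ e1p e2p)). intros s' Hs'.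
      change (Rabs (s' - s) < Rmin e1 e2) in Hs'.
      pose proof (Rmin_l e1 e2). pose proof (Rmin_r e1 e2).
      apply He; [apply He1|apply He2]; lra.
    + f_equal; ring.
    + f_equal; ring.
    + simpl. apply affine_between; auto.
    + simpl. apply affine_between; auto.
  - exists (t, x). now apply box_center.
Qed.

Lemma region_interval u d : 0 < d -> region (fun v : R => Rabs (v - u) < d).
Proof.
  intros d0; split; [|split].
  - intros v Hv. assert (P : 0 < d - Rabs (v - u)) by lra.
    exists (mkposreal _ P). intros w Hw. change (Rabs (w - v) < d - Rabs (v - u)) in Hw.
    replace (w - u) with ((w - v) + (v - u)) by ring.
    eapply Rle_lt_trans; [apply Rabs_triang|lra].
  - apply path_connected. intros a b Ha Hb.
    exists (fun s => a + s * (b - a)). repeat split.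
    + intros V HV s Hs. destruct (HV _ Hs) as [[e e0] He].
      destruct (affine_near a b s e e0) as [e1 [e1p He1]].
      exists (mkposreal _ e1p). intros s' Hs'. apply He, He1, Hs'.
    + change ((a + 0 * (b - a))%R = a :> R); ring.
    + change ((a + 1 * (b - a))%R = b :> R); ring.
    + intros s Hs. now apply affine_between.
  - exists u. now apply Rabs_diag_lt.
Qed.

Lemma near2_box t x P : near2 t x P ->
  exists d, 0 < d /\ forall t' x', box t x d (t', x') -> P t' x'.
Proof. intros [d [d0 H]]; exists d; split; [easy|]. intros t' x' [Ht Hx]; auto. Qed.

Lemma derive_0_eq (f : R -> R) a b :
  (forall s, Rmin a b <= s <= Rmax a b -> is_derive f s 0) -> f a = f b.
Proof.
  intros H. destruct (MVT_gen f a b (fun _ => 0)) as [c [_ E]].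
  - intros s Hs; apply H; lra.
  - intros s Hs. apply continuity_pt_filterlim.
    apply (@ex_derive_continuous R_AbsRing R_NormedModule). eexists; now apply H.
  - lra.
Qed.

Lemma between_close a b c d s : Rabs (a - c) < d -> Rabs (b - c) < d ->
  Rmin a b <= s <= Rmax a b -> Rabs (s - c) < d.
Proof.
  intros Ha Hb Hs. apply Rabs_def2 in Ha; apply Rabs_def2 in Hb.
  unfold Rmin, Rmax in Hs; destruct Rle_dec; apply Rabs_def1; lra.
Qed.

(** A locally constant property and its negation both cut open sets out of [U], so connectedness
    rules one of them out. *)
Lemma region_ind (U : R * R -> Prop) (P : R * R -> Prop) : region U ->
  (forall t x, U (t, x) -> near2 t x (fun t' x' => P (t', x') <-> P (t, x))) ->
  (exists p, U p /\ P p) -> forall p, U p -> P p.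
Proof.
  intros [HU [HC _]] HP HE p Up. apply NNPP; intros Np.
  assert (O : forall Q : R * R -> Prop,
    (forall t x, U (t, x) -> near2 t x (fun t' x' => Q (t', x') <-> Q (t, x))) ->
    open (fun p => U p /\ Q p)).
  { intros Q HQ; apply near2_open; intros t x [Ut Qt].
    apply near2_imp with (2 := near2_and (open_near2 _ _ _ HU Ut) (HQ t x Ut)).
    intros t' x' [? ?]; tauto. }
  destruct (HC (fun p => U p /\ P p) (fun p => U p /\ ~ P p)) as [q [_ [[_ Y] [_ N]]]].
  - now apply O.
  - apply (O (fun p => ~ P p)). intros t x Ut. apply near2_imp with (2 := HP t x Ut).
    intros; tauto.
  - intros q Uq. destruct (classic (P q)); tauto.
  - destruct HE as [q [Uq Pq]]; exists q; tauto.
  - exists p; tauto.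
  - tauto.
Qed.

Lemma zero_gradient_constant (U : R * R -> Prop) (c : R -> R -> R) : region U ->
  (forall t x, U (t, x) -> is_derive (fun s => c s x) t 0 /\ is_derive (fun s => c t s) x 0) ->
  exists k, forall t x, U (t, x) -> c t x = k.
Proof.
  intros HU Hc. pose proof HU as [OU [_ [[t0 x0] U0]]].
  exists (c t0 x0). intros t x Ut.
  apply (region_ind U (fun p => c (fst p) (snd p) = c t0 x0) HU) with (p := (t, x)); auto.
  - intros t1 x1 U1; simpl.
    destruct (open_near2 _ _ _ OU U1) as [d [d0 Hd]].
    assert (Z : forall y : R, Rabs (y - y) < d) by (intros; now apply Rabs_diag_lt).
    exists d; split; [easy|]. intros t2 x2 Ht Hx.
    rewrite (derive_0_eq (fun s => c s x2) t2 t1), (derive_0_eq (fun s => c t1 s) x2 x1).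
    + tauto.
    + intros s Hs. apply (proj2 (Hc t1 s (Hd t1 s (Z t1) (between_close _ _ _ _ _ Hx (Z x1) Hs)))).
    + intros s Hs. apply (proj1 (Hc s x2 (Hd s x2 (between_close _ _ _ _ _ Ht (Z t1) Hs) Hx))).
  - exists (t0, x0); auto.
Qed.

(** Derivatives are words in [D1] and [D2], so flatness passes to derivatives without commuting
    them. *)
Inductive iterated_derivative (f : R -> R -> R -> R) : (R -> R -> R -> R) -> Prop :=
| id_self : iterated_derivative f f
| id_D1 g : iterated_derivative f g -> iterated_derivative f (D1 g)
| id_D2 g : iterated_derivative f g -> iterated_derivative f (D2 g).

Lemma iterated_derivative_l f g h : iterated_derivative f g ->
  iterated_derivative g h -> iterated_derivative f h.
Proof. intros H; induction 1; auto; now constructor. Qed.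

(** By induction on the degree, applied to [D1 f] and [D2 f], both partial derivatives of [P (S n)]
    vanish on the plane; so does its value at the origin. *)
Lemma expansion_flat n f t x u P M : expansion f t x u P M ->
  (forall g, iterated_derivative f g -> g t x u = 0) -> forall h k, P n h k 0 = 0.
Proof.
  revert f P M; induction n as [|n IH]; intros f P M E Hf h k.
  - rewrite (hpoly0_const _ _ (proj1 (proj2 E) 0%nat)), (expansion_at_0 _ _ _ _ _ _ E).
    apply Hf; constructor.
  - assert (E1 : forall h k, D1 (P (S n)) h k 0 = 0).
    { apply (IH _ _ _ (expansion_D1 _ _ _ _ _ _ E)). intros g Hg. apply Hf.
      apply iterated_derivative_l with (D1 f); [do 2 constructor|easy]. }
    assert (E2 : forall h k, D2 (P (S n)) h k 0 = 0).
    { apply (IH _ _ _ (expansion_D2 _ _ _ _ _ _ E)). intros g Hg. apply Hf.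
      apply iterated_derivative_l with (D2 f); [do 2 constructor|easy]. }
    pose proof (proj1 (proj2 E) (S n)) as HP.
    rewrite (derive_0_eq (fun s => P (S n) s k 0) h 0), (derive_0_eq (fun s => P (S n) 0 s 0) k 0).
    + pose proof (hpoly_bound _ _ _ 0 0 0 0 HP) as B.
      rewrite Rabs_R0, pow_i, Rmult_0_r in B by lia.
      apply Rabs_eq_0, Rle_antisym; [apply B; lra|apply Rabs_pos].
    + intros s _. pose proof (Derive_correct _ _
        (hpoly_ex_derive1 _ _ _ s 0 0 (hpoly_swap12 _ _ _ HP))) as Q.
      change (Derive _ _) with (D2 (P (S n)) 0 s 0) in Q. rewrite E2 in Q. exact Q.
    + intros s _. pose proof (Derive_correct _ _ (hpoly_ex_derive1 _ _ _ s k 0 HP)) as Q.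
      change (Derive _ _) with (D1 (P (S n)) s k 0) in Q. rewrite E1 in Q. exact Q.
Qed.

Lemma an2_flat_zero f t x : an2 f t x ->
  (forall g, iterated_derivative (fun t x _ => f t x) g -> g t x 0 = 0) ->
  near2 t x (fun t x => f t x = 0).
Proof.
  intros [P [M E]] Hf. pose proof (expansion_flat) as F.
  apply (@near2_of_near t x 0 (fun t x _ => f t x = 0)).
  apply near_imp with (P := fun t x u => (fun t x _ => f t x) t x 0 = 0); [auto|].
  destruct (small_radius M (proj1 E)) as [[r r0] Hr]; simpl in Hr.
  exists r; split; [easy|]. intros t' x' u' Ht Hx _.
  replace t' with (t + (t' - t)) by ring. replace x' with (x + (x' - x)) by ring.
  assert (Z : 2 * M * Rabs 0 < 1) by (rewrite Rabs_R0, Rmult_0_r; lra).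
  pose proof (proj2 (proj2 E) (t' - t) (x' - x) 0 (Hr _ Ht) (Hr _ Hx) Z) as S1.
  simpl in S1. rewrite <- (is_series_unique _ _ S1), (Series_ext _ (fun _ => 0 * 0)).
  - rewrite (Series_scal_l 0 (fun _ => 0)). ring.
  - intros n. rewrite (F n _ _ _ _ _ _ E Hf). ring.
Qed.

(** The points near which [f] vanishes and the points where some iterated derivative does not vanish
    form two disjoint open sets, which cover [U] because a flat analytic function vanishes
    nearby. *)
Lemma identity_theorem (U : R * R -> Prop) f : region U -> analytic2 U f ->
  (exists t x, U (t, x) /\ near2 t x (fun t x => f t x = 0)) ->
  forall t x, U (t, x) -> f t x = 0.
Proof.
  intros HU Hf [t0 [x0 [U0 N0]]] t x Ut. rewrite an2_analytic2 in Hf.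
  assert (AD : forall g, iterated_derivative (fun t x _ => f t x) g ->
    forall t x, U (t, x) -> an g t x 0).
  { induction 1; intros; [now apply Hf|apply an_D1; auto|apply an_D2; auto]. }
  pose proof HU as [OU [HC _]].
  apply NNPP; intros Nt.
  destruct (HC (fun p => U p /\ near2 (fst p) (snd p) (fun t x => f t x = 0))
    (fun p => U p /\ exists g, iterated_derivative (fun t x _ => f t x) g /\
       g (fst p) (snd p) 0 <> 0)) as [[t1 x1] [_ [[U1 H1] [_ [g [Hg Ng]]]]]]; simpl in *.
  - apply near2_open; intros t1 x1 [U1 H1].
    apply near2_and; [now apply open_near2|now apply near2_near].
  - apply near2_open; intros t1 x1 [U1 [g [Hg Ng]]]; simpl in *.
    apply near2_imp with (2 := near2_and (open_near2 _ _ _ OU U1)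
      (near2_of_near (an_near_neq0 _ _ _ _ (AD g Hg t1 x1 U1) Ng))).
    intros t2 x2 [U2 N2]; simpl; split; [easy|]. now exists g.
  - intros [t1 x1] U1; simpl. destruct (classic (exists g,
      iterated_derivative (fun t x _ => f t x) g /\ g t1 x1 0 <> 0)) as [Y|N]; [tauto|].
    left; split; [easy|]. apply an2_flat_zero; [auto|]. intros g Hg.
    apply NNPP; intros Ng; apply N; eauto.
  - exists (t0, x0); auto.
  - exists (t, x); split; [easy|split]; [easy|]. exists (fun t x _ => f t x).
    split; [constructor|easy].
  - apply Ng. clear Ng U1. enough (W : near2 t1 x1 (fun t x => g t x 0 = 0))
      by apply (near2_self W).
    clear AD. induction Hg as [|g Hg IH|g Hg IH].
    + easy.
    + apply near2_imp with (2 := @Dt_near (fun t x => g t x 0) (fun _ _ => 0) _ _ IH).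
      intros t2 x2 E. unfold D1. unfold Dt in E. now rewrite E, Derive_const.
    + apply near2_imp with (2 := @Dx_near (fun t x => g t x 0) (fun _ _ => 0) _ _ IH).
      intros t2 x2 E. unfold D2. unfold Dx in E. now rewrite E, Derive_const.
Qed.

(** * The overdetermined system *)

Lemma is_derive_Rconst (c x : R) : is_derive (fun _ : R => c) x 0.
Proof. apply @is_derive_const. Qed.
Lemma is_derive_Rid (x : R) : is_derive (fun s : R => s) x 1.
Proof. apply @is_derive_id. Qed.
Lemma is_derive_Rplus (f g : R -> R) (x a b : R) :
  is_derive f x a -> is_derive g x b -> is_derive (fun s => f s + g s) x (a + b).
Proof. intros; now apply @is_derive_plus. Qed.
Lemma is_derive_Rminus (f g : R -> R) (x a b : R) :
  is_derive f x a -> is_derive g x b -> is_derive (fun s => f s - g s) x (a - b).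
Proof. intros; now apply @is_derive_minus. Qed.
Lemma is_derive_Ropp (f : R -> R) (x a : R) :
  is_derive f x a -> is_derive (fun s => - f s) x (- a).
Proof. intros; now apply @is_derive_opp. Qed.
Lemma is_derive_Rmult (f g : R -> R) (x a b : R) :
  is_derive f x a -> is_derive g x b ->
  is_derive (fun s => f s * g s) x (a * g x + f x * b).
Proof. intros; apply @is_derive_mult; auto. intros; apply Rmult_comm. Qed.
Lemma is_derive_Rdiv (f g : R -> R) (x a b : R) :
  is_derive f x a -> is_derive g x b -> g x <> 0 ->
  is_derive (fun s => f s / g s) x ((a * g x - f x * b) / g x ^ 2).
Proof. intros; now apply is_derive_div. Qed.
Lemma is_derive_eq (f : R -> R) (x a b : R) : is_derive f x a -> a = b -> is_derive f x b.
Proof. now intros H <-. Qed.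

(** Run with the derivative left as a metavariable: the syntactic rules build its value, hypotheses
    settle the atoms, and [is_derive_eq] leaves an algebraic identity. *)
Ltac der := lazymatch goal with
  | |- is_derive (fun s => @?f s + @?g s) _ _ => eapply (is_derive_Rplus f g); [der|der]
  | |- is_derive (fun s => @?f s - @?g s) _ _ => eapply (is_derive_Rminus f g); [der|der]
  | |- is_derive (fun s => @?f s * @?g s) _ _ => eapply (is_derive_Rmult f g); [der|der]
  | |- is_derive (fun s => @?f s / @?g s) _ _ =>
      eapply (is_derive_Rdiv f g); [der|der|try assumption]
  | |- is_derive (fun s => - @?f s) _ _ => eapply (is_derive_Ropp f); der
  | |- is_derive (fun s => s) _ _ => apply is_derive_Rid
  | |- is_derive (fun _ => ?c) _ _ => apply (is_derive_Rconst c)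
  | |- _ => match goal with H : is_derive ?f ?x _ |- is_derive ?f ?x _ => exact H end
  end.

Ltac der_ring := eapply is_derive_eq; [der|ring].
Ltac derive_ring := apply is_derive_unique; der_ring.
Ltac derivatives H := pose proof (an2_is_derive_t H); pose proof (an2_is_derive_x H).

Lemma hpoly_an n c p t x u : hpoly n c p -> an p t x u.
Proof.
  induction 1.
  - apply an_const.
  - now apply an_plus.
  - apply (an_mult (fun t _ _ => t)); [apply an_coord1|easy].
  - apply (an_mult (fun _ x _ => x)); [apply an_coord2|easy].
  - apply (an_mult (fun _ _ u => u)); [apply an_coord3|easy].
  - now apply an_ext with p.
Qed.

(** [an_schwarz12] speaks only of the centre. On a neighbourhood both mixed derivatives are summed
    from those of the homogeneous parts, which are polynomials and hence analytic everywhere. *)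
Lemma near2_schwarz f t x : an2 f t x ->
  near2 t x (fun t x => Dt (Dx f) t x = Dx (Dt f) t x).
Proof.
  intros [P [M E]].
  pose proof (expansion_D1 _ _ _ _ _ _ (expansion_D2 _ _ _ _ _ _ E)) as E12.
  pose proof (expansion_D2 _ _ _ _ _ _ (expansion_D1 _ _ _ _ _ _ E)) as E21.
  apply (@near2_of_near t x 0 (fun t x u =>
    D1 (D2 (fun t x _ => f t x)) t x u = D2 (D1 (fun t x _ => f t x)) t x u)).
  apply near_of_expansion with (2 * (2 * M ^ 2) ^ 2); [apply E12|].
  intros h k l Hh Hk Hl.
  rewrite <- (is_series_unique _ _ (proj2 (proj2 E12) h k l Hh Hk Hl)).
  rewrite <- (is_series_unique _ _ (proj2 (proj2 E21) h k l Hh Hk Hl)).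
  apply Series_ext; intros n. apply an_schwarz12.
  apply (hpoly_an _ _ _ _ _ _ (proj1 (proj2 E) (S (S n)))).
Qed.
Arguments near2_schwarz {f t x}.

(* The system [y_xx = al y_x + be y + ga], [y_t = h1 y - g y_x + h0] solved for
   all derivatives of [(y, y_x)]. *)
Definition frobenius (al be ga g h1 h0 y : R -> R -> R) t x :=
  is_derive (fun s => y s x) t (h1 t x * y t x - g t x * Dx y t x + h0 t x) /\
  is_derive (fun s => y t s) x (Dx y t x) /\
  is_derive (fun s => Dx y s x) t
    ((Dx h1 t x - g t x * be t x) * y t x
     + (h1 t x - Dx g t x - g t x * al t x) * Dx y t x
     + (Dx h0 t x - g t x * ga t x)) /\
  is_derive (fun s => Dx y t s) x (al t x * Dx y t x + be t x * y t x + ga t x).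

Lemma near2_frobenius al be ga g h1 h0 y t x :
  an2 g t x -> an2 h1 t x -> an2 h0 t x -> an2 y t x ->
  near2 t x (fun t x => Dt y t x = h1 t x * y t x - g t x * Dx y t x + h0 t x) ->
  near2 t x (fun t x => Dx (Dx y) t x = al t x * Dx y t x + be t x * y t x + ga t x) ->
  near2 t x (frobenius al be ga g h1 h0 y).
Proof.
  intros Hg H1 H0 Hy Et Ex.
  pose proof (Dx_near Et) as Ext.
  pose proof (near2_and (near2_and
    (near2_and (an2_near_derive_t Hy) (an2_near_derive_x Hy))
    (near2_and (an2_near_derive_t (an2_Dx Hy))
      (an2_near_derive_x (an2_Dx Hy))))
    (near2_and (an2_near_derive_x Hg)
      (near2_and (an2_near_derive_x H1) (an2_near_derive_x H0)))) as N1.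
  pose proof (near2_and (near2_and Et Ex)
    (near2_and Ext (near2_schwarz Hy))) as N2.
  apply near2_imp with (2 := near2_and N1 N2). clear.
  intros t x [[[[Yt Yx] [Yxt Yxx]] [Gx [H1x H0x]]] [[Et Ex] [Ext S]]].
  split; [now rewrite <- Et|split]; [easy|split]; [|now rewrite <- Ex].
  rewrite S, Ext in Yxt. apply (is_derive_eq _ _ _ _ Yxt).
  apply is_derive_unique. eapply is_derive_eq; [der|]. rewrite Ex. ring.
Qed.

(* The coefficients of [y_x], [y] and 1 in the compatibility condition. *)
Definition obstruction_yx (al g h1 : R -> R -> R) t x :=
  Dt al t x + g t x * Dx al t x + Dx g t x * al t x + Dx (Dx g) t x - 2 * Dx h1 t x.
Definition obstruction_y (al be g h1 : R -> R -> R) t x :=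
  Dt be t x + g t x * Dx be t x + 2 * Dx g t x * be t x + al t x * Dx h1 t x
  - Dx (Dx h1) t x.
Definition obstruction_1 (al be ga g h1 h0 : R -> R -> R) t x :=
  Dt ga t x + g t x * Dx ga t x + 2 * Dx g t x * ga t x - h1 t x * ga t x
  + be t x * h0 t x + al t x * Dx h0 t x - Dx (Dx h0) t x.

Definition compatible al be ga g h1 h0 t x :=
  obstruction_yx al g h1 t x = 0 /\ obstruction_y al be g h1 t x = 0 /\
  obstruction_1 al be ga g h1 h0 t x = 0.

Lemma near2_defect_x al be ga g h1 h0 y t x :
  an2 g t x -> an2 h1 t x -> an2 h0 t x -> an2 y t x ->
  near2 t x (fun t x => Dx (Dx y) t x = al t x * Dx y t x + be t x * y t x + ga t x) ->
  let z := fun t x => Dt y t x - (h1 t x * y t x - g t x * Dx y t x + h0 t x) in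
  near2 t x (fun t x => Dx z t x = Dt (Dx y) t x -
    ((Dx h1 t x - g t x * be t x) * y t x
     + (h1 t x - Dx g t x - g t x * al t x) * Dx y t x
     + (Dx h0 t x - g t x * ga t x))).
Proof.
  intros Hg H1 H0 Hy Ex z.
  apply near2_imp with (2 := near2_and (near2_and
     (near2_and (an2_near_derive_x (an2_Dt Hy)) (an2_near_derive_x Hy))
     (near2_and (an2_near_derive_x Hg) (near2_and
       (an2_near_derive_x H1) (an2_near_derive_x H0))))
     (near2_and (an2_near_derive_x (an2_Dx Hy))
       (near2_and (near2_schwarz Hy) Ex))). clear.
    intros t x [[[Ytx Yx] [Gx [H1x H0x]]] [Yxx [S Ex]]].
    rewrite S. apply is_derive_unique. unfold z. eapply is_derive_eq; [der|].
    rewrite Ex. ring.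
Qed.

(** Cross-differentiation of the two equations for [y]. Only the x-equation is assumed, so the
    result serves both to prove that [z] vanishes and, when [z] is known to vanish, to extract the
    obstructions. *)
Lemma near2_defect al be ga g h1 h0 y t x :
  an2 al t x -> an2 be t x -> an2 ga t x ->
  an2 g t x -> an2 h1 t x -> an2 h0 t x -> an2 y t x ->
  near2 t x (fun t x => Dx (Dx y) t x = al t x * Dx y t x + be t x * y t x + ga t x) ->
  let z := fun t x => Dt y t x - (h1 t x * y t x - g t x * Dx y t x + h0 t x) in
  near2 t x (fun t x => Dx (Dx z) t x = al t x * Dx z t x + be t x * z t x +
    (obstruction_yx al g h1 t x * Dx y t x +
     obstruction_y al be g h1 t x * y t x +
     obstruction_1 al be ga g h1 h0 t x)).
Proof.
  intros Hal Hbe Hga Hg H1 H0 Hy Ex z.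
  pose proof (near2_defect_x al be ga g h1 h0 y t x Hg H1 H0 Hy Ex) as Ez. fold z in Ez.
  pose proof (Dx_near Ez) as Ezx. pose proof (Dt_near Ex) as Ext.
  pose proof (near2_and (near2_and
     (near2_and (an2_near_derive_x (an2_Dt (an2_Dx Hy)))
       (an2_near_derive_x Hy))
     (near2_and (an2_near_derive_x Hg) (near2_and
       (an2_near_derive_x H1) (an2_near_derive_x H0))))
     (near2_and (an2_near_derive_x (an2_Dx Hy))
       (near2_and (near2_schwarz (an2_Dx Hy)) Ex))) as N1.
  pose proof (near2_and (near2_and (an2_near_derive_x Hal)
     (near2_and (an2_near_derive_x Hbe) (an2_near_derive_x Hga)))
     (near2_and (an2_near_derive_t Hal)
     (near2_and (an2_near_derive_t Hbe) (an2_near_derive_t Hga)))) as N2.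
  pose proof (near2_and (near2_and (an2_near_derive_x (an2_Dx Hg))
     (near2_and (an2_near_derive_x (an2_Dx H1))
       (an2_near_derive_x (an2_Dx H0))))
     (near2_and (an2_near_derive_t Hy)
        (an2_near_derive_t (an2_Dx Hy)))) as N3.
  apply near2_imp with (2 := near2_and (near2_and N1 N2)
    (near2_and N3 (near2_and Ez (near2_and Ezx Ext)))). clear.
  intros t x [[[[[Yxtx Yx] [Gx [H1x H0x]]] [Yxx [S Ex]]]
    [[Ax [Bx Cx]] [At [Bt Ct]]]] [[[Gxx [H1xx H0xx]] [Yt Yxt]] [Ez [Ezx Ext]]]].
  rewrite Ezx.
  assert (E1 : Dx (fun t x => Dt (Dx y) t x -
    ((Dx h1 t x - g t x * be t x) * y t x
     + (h1 t x - Dx g t x - g t x * al t x) * Dx y t x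
     + (Dx h0 t x - g t x * ga t x))) t x = Dx (Dt (Dx y)) t x -
    ((Dx (Dx h1) t x - (Dx g t x * be t x + g t x * Dx be t x)) * y t x
     + (Dx h1 t x - g t x * be t x) * Dx y t x
     + (Dx h1 t x - Dx (Dx g) t x - (Dx g t x * al t x + g t x * Dx al t x)) * Dx y t x
     + (h1 t x - Dx g t x - g t x * al t x) * Dx (Dx y) t x
     + (Dx (Dx h0) t x - (Dx g t x * ga t x + g t x * Dx ga t x)))).
  { apply is_derive_unique. eapply is_derive_eq; [der|]. ring. }
  assert (E2 : Dt (fun t x => al t x * Dx y t x + be t x * y t x + ga t x) t x =
    Dt al t x * Dx y t x + al t x * Dt (Dx y) t x + Dt be t x * y t x
    + be t x * Dt y t x + Dt ga t x).
  { apply is_derive_unique. eapply is_derive_eq; [der|]. ring. }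
  rewrite E1, Ez, <- S, Ext, E2, Ex.
  unfold z, obstruction_yx, obstruction_y, obstruction_1. ring.
Qed.

(** * Variation of constants *)

Definition wronskian (v1 v2 : R -> R -> R) t x := v1 t x * Dx v2 t x - v2 t x * Dx v1 t x.

(* Variation of constants: the coefficients of [d] in the basis [v1, v2]. *)
Definition coord_1 (v1 v2 d : R -> R -> R) t x :=
  (d t x * Dx v2 t x - Dx d t x * v2 t x) / wronskian v1 v2 t x.
Definition coord_2 (v1 v2 d : R -> R -> R) t x :=
  (v1 t x * Dx d t x - Dx v1 t x * d t x) / wronskian v1 v2 t x.

Lemma coord_decomp v1 v2 d t x : wronskian v1 v2 t x <> 0 ->
  d t x = coord_1 v1 v2 d t x * v1 t x + coord_2 v1 v2 d t x * v2 t x.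
Proof. intros H. unfold coord_1, coord_2, wronskian in *. now field. Qed.

(** Three solutions of one linear 2 by 2 system: the coordinates of the third in the basis of the
    first two are constant. The matrix is frozen at [s], so the same lemma serves the t- and the
    x-direction. *)
Lemma cramer_constant (m11 m12 m21 m22 : R) (v1 q1 v2 q2 d e : R -> R) s :
  v1 s * q2 s - v2 s * q1 s <> 0 ->
  is_derive v1 s (m11 * v1 s + m12 * q1 s) -> is_derive q1 s (m21 * v1 s + m22 * q1 s) ->
  is_derive v2 s (m11 * v2 s + m12 * q2 s) -> is_derive q2 s (m21 * v2 s + m22 * q2 s) ->
  is_derive d s (m11 * d s + m12 * e s) -> is_derive e s (m21 * d s + m22 * e s) ->
  is_derive (fun s => (d s * q2 s - e s * v2 s) / (v1 s * q2 s - v2 s * q1 s)) s 0 /\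
  is_derive (fun s => (v1 s * e s - q1 s * d s) / (v1 s * q2 s - v2 s * q1 s)) s 0.
Proof.
  intros W D1 Q1 D2 Q2 D3 Q3. split; (eapply is_derive_eq; [der|]); now field.
Qed.

(** The homogeneous system is [frobenius] with [zero2] in place of [ga] and [h0]. *)
Definition zero2 (_ _ : R) : R := 0.

Lemma Dx_zero2 t x : Dx zero2 t x = 0.
Proof. apply (Derive_const 0). Qed.
Lemma Dt_zero2 t x : Dt zero2 t x = 0.
Proof. apply (Derive_const 0). Qed.

Lemma frobenius_coord al be g h1 v1 v2 d t x :
  frobenius al be zero2 g h1 zero2 v1 t x -> frobenius al be zero2 g h1 zero2 v2 t x ->
  frobenius al be zero2 g h1 zero2 d t x -> wronskian v1 v2 t x <> 0 ->
  (is_derive (fun s => coord_1 v1 v2 d s x) t 0 /\ is_derive (fun s => coord_1 v1 v2 d t s) x 0) /\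
  (is_derive (fun s => coord_2 v1 v2 d s x) t 0 /\ is_derive (fun s => coord_2 v1 v2 d t s) x 0).
Proof.
  unfold frobenius. rewrite Dx_zero2. unfold zero2.
  intros [A1 [A2 [A3 A4]]] [B1 [B2 [B3 B4]]] [C1 [C2 [C3 C4]]] W.
  destruct (cramer_constant (h1 t x) (- g t x) (Dx h1 t x - g t x * be t x)
    (h1 t x - Dx g t x - g t x * al t x) (fun s => v1 s x) (fun s => Dx v1 s x)
    (fun s => v2 s x) (fun s => Dx v2 s x) (fun s => d s x) (fun s => Dx d s x) t W)
    as [R1 R2]; try (eapply is_derive_eq; [eassumption|ring]).
  destruct (cramer_constant 0 1 (be t x) (al t x)
    (fun s => v1 t s) (fun s => Dx v1 t s)
    (fun s => v2 t s) (fun s => Dx v2 t s) (fun s => d t s) (fun s => Dx d t s) x W)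
    as [R3 R4]; try (eapply is_derive_eq; [eassumption|ring]).
  split; split; assumption.
Qed.

Lemma frobenius_span (V : R * R -> Prop) al be g h1 v1 v2 d : region V ->
  (forall t x, V (t, x) -> frobenius al be zero2 g h1 zero2 v1 t x /\
    frobenius al be zero2 g h1 zero2 v2 t x /\
    frobenius al be zero2 g h1 zero2 d t x /\ wronskian v1 v2 t x <> 0) ->
  exists c1 c2, forall t x, V (t, x) -> d t x = c1 * v1 t x + c2 * v2 t x.
Proof.
  intros HV H.
  destruct (zero_gradient_constant V (coord_1 v1 v2 d) HV) as [c1 E1].
  { intros t x Vt; destruct (H t x Vt) as [? [? [? ?]]].
    now apply frobenius_coord with al be g h1. }
  destruct (zero_gradient_constant V (coord_2 v1 v2 d) HV) as [c2 E2].
  { intros t x Vt; destruct (H t x Vt) as [? [? [? ?]]].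
    now apply frobenius_coord with al be g h1. }
  exists c1, c2. intros t x Vt. rewrite (coord_decomp v1 v2 d) by apply (H t x Vt).
  now rewrite E1, E2.
Qed.

Lemma frobenius_minus al be ga g h1 h0 y v t x :
  near2 t x (frobenius al be ga g h1 h0 y) -> near2 t x (frobenius al be ga g h1 h0 v) ->
  near2 t x (frobenius al be zero2 g h1 zero2 (fun t x => y t x - v t x)).
Proof.
  intros Hy Hv.
  assert (E : near2 t x (fun t x => Dx (fun t x => y t x - v t x) t x = Dx y t x - Dx v t x)).
  { apply near2_imp with (2 := near2_and Hy Hv).
    intros t' x' [[_ [Y _]] [_ [V _]]]. apply is_derive_unique. der. }
  apply near2_imp with (2 := near2_and (near2_near E) (near2_and Hy Hv)).
  clear. intros t x [E [[A1 [A2 [A3 A4]]] [B1 [B2 [B3 B4]]]]].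
  unfold frobenius. rewrite (near2_self E), Dx_zero2. unfold zero2. split; [|split; [|split]].
  - der_ring.
  - der.
  - apply is_derive_ext_loc with (fun s => Dx y s x - Dx v s x).
    + apply (filter_imp _ _ (fun s H => eq_sym H) (near2_locally_t E)).
    + der_ring.
  - apply is_derive_ext_loc with (fun s => Dx y t s - Dx v t s).
    + apply (filter_imp _ _ (fun s H => eq_sym H) (near2_locally_x E)).
    + der_ring.
Qed.

(** * Initial value problems *)

Lemma an2_swap f t x : an2 f t x -> an2 (fun x t => f t x) x t.
Proof. intros H. exact (an_swap12 _ t x 0 H). Qed.

Lemma near2_swap t x (P : R -> R -> Prop) :
  near2 t x P -> near2 x t (fun x t => P t x).
Proof. intros [d [d0 H]]; exists d; auto. Qed.

Lemma linear_ode_x a11 a12 a21 a22 b1 b2 phi1 phi2 t x :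
  an2 a11 t x -> an2 a12 t x -> an2 a21 t x -> an2 a22 t x ->
  an2 b1 t x -> an2 b2 t x -> an2 phi1 t x -> an2 phi2 t x ->
  exists w1 w2, an2 w1 t x /\ an2 w2 t x /\
  near2 t x (fun t x => Dx w1 t x = a11 t x * w1 t x + a12 t x * w2 t x + b1 t x) /\
  near2 t x (fun t x => Dx w2 t x = a21 t x * w1 t x + a22 t x * w2 t x + b2 t x) /\
  near2 t x (fun t' _ => w1 t' x = phi1 t' x) /\
  near2 t x (fun t' _ => w2 t' x = phi2 t' x).
Proof.
  intros H11 H12 H21 H22 Hb1 Hb2 Hp1 Hp2.
  destruct (an_linear_ode _ _ _ _ _ _ _ _ t x 0 H11 H12 H21 H22 Hb1 Hb2 Hp1 Hp2)
    as [w1 [w2 [A1 [A2 [E1 [E2 [I1 I2]]]]]]].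
  exists (fun t x => w1 t x 0), (fun t x => w2 t x 0).
  split; [now apply an2_slice|split]; [now apply an2_slice|].
  split; [apply (near2_of_near E1)|split]; [apply (near2_of_near E2)|].
  split; [apply (near2_of_near I1)|apply (near2_of_near I2)].
Qed.

Lemma linear_ode_t a11 a12 a21 a22 b1 b2 t x (p q : R) :
  an2 a11 t x -> an2 a12 t x -> an2 a21 t x -> an2 a22 t x ->
  an2 b1 t x -> an2 b2 t x ->
  exists w1 w2, an2 w1 t x /\ an2 w2 t x /\
  near2 t x (fun t x => Dt w1 t x = a11 t x * w1 t x + a12 t x * w2 t x + b1 t x) /\
  near2 t x (fun t x => Dt w2 t x = a21 t x * w1 t x + a22 t x * w2 t x + b2 t x) /\
  w1 t x = p /\ w2 t x = q.
Proof.
  intros H11 H12 H21 H22 Hb1 Hb2.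
  apply an2_swap in H11, H12, H21, H22, Hb1, Hb2.
  destruct (linear_ode_x _ _ _ _ _ _ _ _ x t H11 H12 H21 H22 Hb1 Hb2
    (an2_const p x t) (an2_const q x t)) as [w1 [w2 [A1 [A2 [E1 [E2 [I1 I2]]]]]]].
  exists (fun t x => w1 x t), (fun t x => w2 x t).
  split; [now apply (an2_swap w1)|split]; [now apply (an2_swap w2)|].
  split; [apply (near2_swap _ _ _ E1)|split]; [apply (near2_swap _ _ _ E2)|].
  split; [apply (near2_self I1)|apply (near2_self I2)].
Qed.

Lemma second_order_ivp al be ga phi psi t x :
  an2 al t x -> an2 be t x -> an2 ga t x -> an2 phi t x -> an2 psi t x ->
  exists y, an2 y t x /\
  near2 t x (fun t x => Dx (Dx y) t x = al t x * Dx y t x + be t x * y t x + ga t x) /\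
  near2 t x (fun t' _ => y t' x = phi t' x) /\
  near2 t x (fun t' _ => Dx y t' x = psi t' x).
Proof.
  intros Hal Hbe Hga Hphi Hpsi.
  destruct (linear_ode_x _ _ _ _ _ _ _ _ t x (an2_const 0 t x) (an2_const 1 t x) Hbe Hal
    (an2_const 0 t x) Hga Hphi Hpsi) as [y [q [Ay [Aq [E1 [E2 [I1 I2]]]]]]].
  exists y; split; [easy|].
  assert (E : near2 t x (fun t x => Dx y t x = q t x)).
  { apply near2_imp with (2 := E1). intros t' x' E; rewrite E; ring. }
  split; [|split]; [|easy|].
  - apply near2_imp with (2 := near2_and (Dx_near E) (near2_and E2 E)).
    intros t' x' [R1 [R2 R3]]. rewrite R1, R2, R3. ring.
  - destruct (near2_and E I2) as [d [d0 Hd]]. exists d; split; [easy|].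
    intros t' x' Ht Hx.
    destruct (Hd t' x Ht) as [R1 R2]; [now apply Rabs_diag_lt|congruence].
Qed.

Lemma an2_wronskian v1 v2 t x : an2 v1 t x -> an2 v2 t x -> an2 (wronskian v1 v2) t x.
Proof.
  intros H1 H2. apply (an2_minus (fun t x => v1 t x * Dx v2 t x) (fun t x => v2 t x * Dx v1 t x));
    apply an2_mult; auto using an2_Dx.
Qed.

(** On each line of constant [t] the coordinates of [z] in a fundamental system are constant, and
    they are zero at the initial abscissa. The fundamental system is built with Wronskian 1 at the
    centre. *)
Lemma second_order_unique al be z t x :
  an2 al t x -> an2 be t x -> an2 z t x ->
  near2 t x (fun t x => Dx (Dx z) t x = al t x * Dx z t x + be t x * z t x) ->
  near2 t x (fun t' _ => z t' x = 0) -> near2 t x (fun t' _ => Dx z t' x = 0) ->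
  near2 t x (fun t x => z t x = 0).
Proof.
  intros Hal Hbe Hz Ez I1 I2.
  destruct (second_order_ivp al be zero2 (fun _ _ => 1) (fun _ _ => 0) t x)
    as [v1 [A1 [E1 [J1 K1]]]]; auto; try apply an2_const.
  destruct (second_order_ivp al be zero2 (fun _ _ => 0) (fun _ _ => 1) t x)
    as [v2 [A2 [E2 [J2 K2]]]]; auto; try apply an2_const.
  assert (W0 : wronskian v1 v2 t x <> 0).
  { unfold wronskian. rewrite (near2_self J1), (near2_self J2),
      (near2_self K1), (near2_self K2). lra. }
  pose proof (near2_and (near2_and Ez (near2_and E1 E2))
    (an2_near_neq0 _ _ _ (an2_wronskian _ _ _ _ A1 A2) W0)) as N1.
  pose proof (near2_and
    (near2_and (an2_near_derive_x Hz) (an2_near_derive_x (an2_Dx Hz)))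
    (near2_and
      (near2_and (an2_near_derive_x A1) (an2_near_derive_x (an2_Dx A1)))
      (near2_and (an2_near_derive_x A2)
        (an2_near_derive_x (an2_Dx A2))))) as N2.
  destruct (near2_and (near2_and N1 N2) (near2_and I1 I2))
    as [d [d0 Hd]].
  assert (Z : Rabs (x - x) < d) by now apply Rabs_diag_lt.
  exists d; split; [easy|]. intros t' x' Ht Hx.
  assert (C : forall s, Rabs (s - x) < d ->
    is_derive (fun s => coord_1 v1 v2 z t' s) s 0 /\
    is_derive (fun s => coord_2 v1 v2 z t' s) s 0).
  { intros s Hs. destruct (Hd t' s Ht Hs)
      as [[[[R0 [R1 R2]] W] [[Z1 Z2] [[P1 P2] [Q1 Q2]]]] _].
    apply (cramer_constant 0 1 (be t' s) (al t' s)
      (fun s => v1 t' s) (fun s => Dx v1 t' s) (fun s => v2 t' s) (fun s => Dx v2 t' s)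
      (fun s => z t' s) (fun s => Dx z t' s) s W);
    (eapply is_derive_eq; [eassumption|rewrite ?R0, ?R1, ?R2; unfold zero2; ring]). }
  destruct (Hd t' x Ht Z) as [_ [Z1 Z2]].
  destruct (Hd t' x' Ht Hx) as [[[_ W] _] _].
  rewrite (coord_decomp v1 v2 z t' x' W).
  rewrite (derive_0_eq (fun s => coord_1 v1 v2 z t' s) x' x),
    (derive_0_eq (fun s => coord_2 v1 v2 z t' s) x' x).
  - unfold coord_1, coord_2. rewrite Z1, Z2. unfold Rdiv; ring.
  - intros s Hs. apply C. now apply between_close with x' x.
  - intros s Hs. apply C. now apply between_close with x' x.
Qed.

Lemma near2_line_Dt f g t x : near2 t x (fun t' _ => f t' x = g t' x) ->
  near2 t x (fun t' _ => Dt f t' x = Dt g t' x).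
Proof.
  intros H. apply near2_imp with (2 := near2_near H). intros t' x' H'.
  apply Derive_ext_loc, (near2_locally_t H').
Qed.
Arguments near2_line_Dt {f g t x}.

Lemma near2_line t x P : near2 t x P -> near2 t x (fun t' _ => P t' x).
Proof.
  intros [d [d0 H]]; exists d; split; [easy|]. intros; apply H; auto.
  now apply Rabs_diag_lt.
Qed.
Arguments near2_line {t x P}.

(* Solve the [t]-equations along the line through [x], then the [x]-equation
   from that line; the defect of the [t]-equation solves a homogeneous
   [x]-equation with zero data, hence vanishes. *)
Lemma frobenius_exists al be ga g h1 h0 t x p q :
  an2 al t x -> an2 be t x -> an2 ga t x -> an2 g t x -> an2 h1 t x -> an2 h0 t x ->
  near2 t x (compatible al be ga g h1 h0) ->
  exists y, an2 y t x /\ near2 t x (frobenius al be ga g h1 h0 y) /\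
    y t x = p /\ Dx y t x = q.
Proof.
  intros Hal Hbe Hga Hg H1 H0 HC.
  destruct (linear_ode_t h1 (fun t x => - g t x)
    (fun t x => Dx h1 t x - g t x * be t x)
    (fun t x => h1 t x - Dx g t x - g t x * al t x)
    h0 (fun t x => Dx h0 t x - g t x * ga t x) t x p q)
    as [phi [psi [Aphi [Apsi [Ephi [Epsi [Ip Iq]]]]]]];
    auto 7 using an2_minus, an2_mult, an2_Dx, an2_opp.
  destruct (second_order_ivp al be ga phi psi t x) as [y [Ay [Ey [Jphi Jpsi]]]]; auto.
  set (z := fun t x => Dt y t x - (h1 t x * y t x - g t x * Dx y t x + h0 t x)).
  pose proof (near2_defect al be ga g h1 h0 y t x Hal Hbe Hga Hg H1 H0 Ay Ey) as Ez.
  pose proof (near2_defect_x al be ga g h1 h0 y t x Hg H1 H0 Ay Ey) as Ezx.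
  fold z in Ez, Ezx. cbv zeta in Ez, Ezx.
  assert (Z : near2 t x (fun t x => z t x = 0)).
  { apply second_order_unique with al be; auto.
    - unfold z. auto 7 using an2_minus, an2_plus, an2_mult, an2_Dx, an2_Dt.
    - apply near2_imp with (2 := near2_and Ez HC).
      intros t' x' [E [C1 [C2 C3]]]. rewrite E, C1, C2, C3. ring.
    - apply near2_imp with (2 := near2_and (near2_and Jphi Jpsi)
        (near2_and (near2_line_Dt Jphi) (near2_line Ephi))).
      intros t' x' [[E1 E2] [E3 E4]]. unfold z. rewrite E3, E4, E1, E2. ring.
    - apply near2_imp with (2 := near2_and (near2_and Jphi Jpsi)
        (near2_and (near2_line Ezx)
        (near2_and (near2_line_Dt Jpsi) (near2_line Epsi)))).
      intros t' x' [[E1 E2] [E3 [E4 E5]]]. rewrite E3, E4, E5, E1, E2. ring. }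
  exists y; split; [easy|split]; [|split].
  - apply near2_frobenius; auto.
    apply near2_imp with (2 := Z). unfold z; intros; lra.
  - now rewrite (near2_self Jphi).
  - now rewrite (near2_self Jpsi).
Qed.

Lemma obstruction_1_zero2 al be g h1 t x : obstruction_1 al be zero2 g h1 zero2 t x = 0.
Proof.
  assert (E : Dx (Dx zero2) t x = 0).
  { unfold Dx at 1. rewrite (Derive_ext _ (fun _ => 0)); [apply Derive_const|].
    intros; apply Dx_zero2. }
  unfold obstruction_1. rewrite E, Dt_zero2, !Dx_zero2. unfold zero2; ring.
Qed.

Lemma compatible_homogeneous al be ga g h1 h0 t x :
  compatible al be ga g h1 h0 t x -> compatible al be zero2 g h1 zero2 t x.
Proof. intros [C1 [C2 _]]; split; [easy|split]; [easy|apply obstruction_1_zero2]. Qed.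

Lemma frobenius_basis al be ga g h1 h0 t x :
  an2 al t x -> an2 be t x -> an2 ga t x -> an2 g t x -> an2 h1 t x -> an2 h0 t x ->
  near2 t x (compatible al be ga g h1 h0) ->
  exists v1 v2 v3, an2 v1 t x /\ an2 v2 t x /\ an2 v3 t x /\
    near2 t x (fun t x => frobenius al be zero2 g h1 zero2 v1 t x /\
      frobenius al be zero2 g h1 zero2 v2 t x /\
      frobenius al be ga g h1 h0 v3 t x /\ wronskian v1 v2 t x <> 0).
Proof.
  intros Hal Hbe Hga Hg H1 H0 HC.
  pose proof (near2_imp _ _ _ _ (compatible_homogeneous al be ga g h1 h0) HC) as HC0.
  destruct (frobenius_exists al be zero2 g h1 zero2 t x 1 0) as [v1 [A1 [F1 [P1 Q1]]]];
    auto; try apply an2_const.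
  destruct (frobenius_exists al be zero2 g h1 zero2 t x 0 1) as [v2 [A2 [F2 [P2 Q2]]]];
    auto; try apply an2_const.
  destruct (frobenius_exists al be ga g h1 h0 t x 0 0) as [v3 [A3 [F3 _]]]; auto.
  exists v1, v2, v3; repeat (split; [easy|]).
  repeat (apply near2_and; [easy|]).
  apply an2_near_neq0; [now apply an2_wronskian|].
  unfold wronskian. rewrite P1, P2, Q1, Q2. lra.
Qed.

(** The substitute for recentring: a basis of solutions is constructed at this very point, and [y]
    is a constant combination of it on a box. *)
Lemma frobenius_an2 al be ga g h1 h0 y t x :
  an2 al t x -> an2 be t x -> an2 ga t x -> an2 g t x -> an2 h1 t x -> an2 h0 t x ->
  near2 t x (compatible al be ga g h1 h0) ->
  near2 t x (frobenius al be ga g h1 h0 y) -> an2 y t x.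
Proof.
  intros Hal Hbe Hga Hg H1 H0 HC Hy.
  destruct (frobenius_basis al be ga g h1 h0 t x) as [v1 [v2 [v3 [A1 [A2 [A3 HF]]]]]]; auto.
  assert (F3 : near2 t x (frobenius al be ga g h1 h0 v3))
    by (apply near2_imp with (2 := HF); tauto).
  destruct (near2_box _ _ _ (near2_and HF (frobenius_minus _ _ _ _ _ _ _ _ _ _ Hy F3)))
    as [d [d0 Hd]].
  destruct (frobenius_span (box t x d) al be g h1 v1 v2 (fun t x => y t x - v3 t x))
    as [c1 [c2 E]]; [now apply region_box| |].
  { intros t' x' B. destruct (Hd t' x' B) as [[? [? [? ?]]] ?]. tauto. }
  apply an2_ext_near with (fun t x => c1 * v1 t x + c2 * v2 t x + v3 t x).
  - apply (an2_plus (fun t x => c1 * v1 t x + c2 * v2 t x)); [|easy].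
    now apply an2_lincomb.
  - exists d; split; [easy|]. intros t' x' Ht Hx.
    generalize (E t' x' (conj Ht Hx)); intros; lra.
Qed.

Lemma frobenius_ext al be ga g h1 h0 y v t x :
  near2 t x (fun t x => y t x = v t x) -> near2 t x (frobenius al be ga g h1 h0 y) ->
  near2 t x (frobenius al be ga g h1 h0 v).
Proof.
  intros E H. pose proof (near2_near E) as NE.
  pose proof (near2_near (Dx_near E)) as NEx.
  apply near2_imp with (2 := near2_and H (near2_and NE NEx)).
  clear. intros t x [[A1 [A2 [A3 A4]]] [E Ex]].
  unfold frobenius. rewrite <- (near2_self E), <- (near2_self Ex).
  split; [|split; [|split]].
  - apply is_derive_ext_loc with (2 := A1). apply (near2_locally_t E).
  - apply is_derive_ext_loc with (2 := A2). apply (near2_locally_x E).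
  - apply is_derive_ext_loc with (2 := A3). apply (near2_locally_t Ex).
  - apply is_derive_ext_loc with (2 := A4). apply (near2_locally_x Ex).
Qed.

Lemma frobenius_plus al be ga g h1 h0 v y c t x :
  near2 t x (frobenius al be zero2 g h1 zero2 v) -> near2 t x (frobenius al be ga g h1 h0 y) ->
  near2 t x (frobenius al be ga g h1 h0 (fun t x => c * v t x + y t x)).
Proof.
  intros Hv Hy.
  assert (E : near2 t x (fun t x => Dx (fun t x => c * v t x + y t x) t x
    = c * Dx v t x + Dx y t x)).
  { apply near2_imp with (2 := near2_and Hy Hv).
    intros t' x' [[_ [Y _]] [_ [V _]]]. derive_ring. }
  apply near2_imp with (2 := near2_and (near2_near E) (near2_and Hy Hv)).
  clear. intros t x [E [[A1 [A2 [A3 A4]]] [B1 [B2 [B3 B4]]]]].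
  unfold frobenius. rewrite Dx_zero2 in B3. unfold zero2 in B1, B3, B4.
  rewrite (near2_self E). split; [|split; [|split]].
  - der_ring.
  - der_ring.
  - apply is_derive_ext_loc with (fun s => c * Dx v s x + Dx y s x).
    + apply (filter_imp _ _ (fun s H => eq_sym H) (near2_locally_t E)).
    + der_ring.
  - apply is_derive_ext_loc with (fun s => c * Dx v t s + Dx y t s).
    + apply (filter_imp _ _ (fun s H => eq_sym H) (near2_locally_x E)).
    + der_ring.
Qed.

(** * Prolongation *)

Lemma Dtot_t_on_jet f j : Dtot_t (on_jet f) j =
  D1 f (jt j) (jx j) (ju j) + jut j * D3 f (jt j) (jx j) (ju j).
Proof.
  unfold Dtot_t.
  replace (d_ut (on_jet f) j) with 0 by (symmetry; apply (Derive_const (on_jet f j))).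
  replace (d_ux (on_jet f) j) with 0 by (symmetry; apply (Derive_const (on_jet f j))).
  unfold d_t, d_u, D1, D3, on_jet; simpl. ring.
Qed.

Lemma Dtot_x_on_jet f j : Dtot_x (on_jet f) j =
  D2 f (jt j) (jx j) (ju j) + jux j * D3 f (jt j) (jx j) (ju j).
Proof.
  unfold Dtot_x.
  replace (d_ut (on_jet f) j) with 0 by (symmetry; apply (Derive_const (on_jet f j))).
  replace (d_ux (on_jet f) j) with 0 by (symmetry; apply (Derive_const (on_jet f j))).
  unfold d_x, d_u, D2, D3, on_jet; simpl. ring.
Qed.

Definition eta_t_formula Q t x u ut ux :=
  (D1 (eta Q) t x u + ut * D3 (eta Q) t x u)
  - ut * (D1 (tau Q) t x u + ut * D3 (tau Q) t x u)
  - ux * (D1 (xi Q) t x u + ut * D3 (xi Q) t x u).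

Definition eta_x_formula Q t x u ut ux :=
  (D2 (eta Q) t x u + ux * D3 (eta Q) t x u)
  - ut * (D2 (tau Q) t x u + ux * D3 (tau Q) t x u)
  - ux * (D2 (xi Q) t x u + ux * D3 (xi Q) t x u).

Definition Dxx_total f t x u ux uxx :=
  D2 (D2 f) t x u + 2 * ux * D2 (D3 f) t x u + ux ^ 2 * D3 (D3 f) t x u + uxx * D3 f t x u.

Definition eta_xx_formula Q t x u ut ux utx uxx :=
  Dxx_total (eta Q) t x u ux uxx - ut * Dxx_total (tau Q) t x u ux uxx
  - ux * Dxx_total (xi Q) t x u ux uxx
  - 2 * utx * (D2 (tau Q) t x u + ux * D3 (tau Q) t x u)
  - 2 * uxx * (D2 (xi Q) t x u + ux * D3 (xi Q) t x u).

Lemma eta_t_eq Q j : eta_t Q j = eta_t_formula Q (jt j) (jx j) (ju j) (jut j) (jux j).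
Proof. unfold eta_t. now rewrite !Dtot_t_on_jet. Qed.

Lemma eta_x_eq Q j : eta_x Q j = eta_x_formula Q (jt j) (jx j) (ju j) (jut j) (jux j).
Proof. unfold eta_x. now rewrite !Dtot_x_on_jet. Qed.

Ltac eta_x_derive := unfold d_x, d_u, d_ut, d_ux; simpl;
  (erewrite Derive_ext; [|intros; apply eta_x_eq]); simpl; unfold eta_x_formula; derive_ring.
Ltac jet_derive := unfold d_t, d_x, d_u, d_ut, d_ux, d_utt, d_utx, d_uxx, Lop,
  characteristic, on_jet; simpl; derive_ring.

Lemma eta_xx_eq Q t x u ut ux utt utx uxx :
  an (tau Q) t x u -> an (xi Q) t x u -> an (eta Q) t x u ->
  eta_xx Q (Jet t x u ut ux utt utx uxx) = eta_xx_formula Q t x u ut ux utx uxx.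
Proof.
  intros Ht Hx He. unfold eta_xx. rewrite !Dtot_x_on_jet; simpl.
  assert (Dd : forall f, an f t x u ->
    is_derive (fun s => D2 f t s u) x (D2 (D2 f) t x u) /\
    is_derive (fun s => D3 f t s u) x (D2 (D3 f) t x u) /\
    is_derive (fun s => D2 f t x s) u (D2 (D3 f) t x u) /\
    is_derive (fun s => D3 f t x s) u (D3 (D3 f) t x u)).
  { intros f Hf. split; [apply an_is_derive2; now apply an_D2|].
    split; [apply an_is_derive2; now apply an_D3|].
    split; [rewrite an_schwarz23 by easy|]; apply an_is_derive3;
      [now apply an_D2|now apply an_D3]. }
  destruct (Dd _ Ht) as [T1 [T2 [T3 T4]]], (Dd _ Hx) as [X1 [X2 [X3 X4]]],
    (Dd _ He) as [E1 [E2 [E3 E4]]]. clear Dd.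
  assert (R1 : d_x (eta_x Q) (Jet t x u ut ux utt utx uxx) =
    (D2 (D2 (eta Q)) t x u + ux * D2 (D3 (eta Q)) t x u)
    - ut * (D2 (D2 (tau Q)) t x u + ux * D2 (D3 (tau Q)) t x u)
    - ux * (D2 (D2 (xi Q)) t x u + ux * D2 (D3 (xi Q)) t x u))
    by eta_x_derive.
  assert (R2 : d_u (eta_x Q) (Jet t x u ut ux utt utx uxx) =
    (D2 (D3 (eta Q)) t x u + ux * D3 (D3 (eta Q)) t x u)
    - ut * (D2 (D3 (tau Q)) t x u + ux * D3 (D3 (tau Q)) t x u)
    - ux * (D2 (D3 (xi Q)) t x u + ux * D3 (D3 (xi Q)) t x u))
    by eta_x_derive.
  assert (R3 : d_ut (eta_x Q) (Jet t x u ut ux utt utx uxx) =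
    - (D2 (tau Q) t x u + ux * D3 (tau Q) t x u))
    by eta_x_derive.
  assert (R4 : d_ux (eta_x Q) (Jet t x u ut ux utt utx uxx) =
    D3 (eta Q) t x u - ut * D3 (tau Q) t x u - (D2 (xi Q) t x u + 2 * ux * D3 (xi Q) t x u))
    by eta_x_derive.
  unfold Dtot_x. rewrite R1, R2, R3, R4; simpl.
  unfold eta_xx_formula, Dxx_total. ring.
Qed.

(** [Lop] does not involve [u_tt] and [u_tx], so [eta_tt] and [eta_tx] drop out and need no
    formula. *)
Lemma prolong2_Lop A B C Q t x u ut ux utt utx uxx :
  an2 A t x -> an2 B t x -> an2 C t x ->
  an (tau Q) t x u -> an (xi Q) t x u -> an (eta Q) t x u ->
  prolong2 Q (Lop A B C) (Jet t x u ut ux utt utx uxx) =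
  - tau Q t x u * (Dt A t x * uxx + Dt B t x * ux + Dt C t x * u)
  - xi Q t x u * (Dx A t x * uxx + Dx B t x * ux + Dx C t x * u)
  - eta Q t x u * C t x
  + eta_t_formula Q t x u ut ux - B t x * eta_x_formula Q t x u ut ux
  - A t x * eta_xx_formula Q t x u ut ux utx uxx.
Proof.
  intros HA HB HC Ht Hx He. unfold prolong2.
  rewrite eta_t_eq, eta_x_eq, eta_xx_eq by easy. simpl.
  derivatives HA.
  derivatives HB.
  derivatives HC.
  set (j := Jet t x u ut ux utt utx uxx).
  assert (R1 : d_t (Lop A B C) j = - (Dt A t x * uxx + Dt B t x * ux + Dt C t x * u))
    by jet_derive.
  assert (R2 : d_x (Lop A B C) j = - (Dx A t x * uxx + Dx B t x * ux + Dx C t x * u))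
    by jet_derive.
  assert (R3 : d_u (Lop A B C) j = - C t x)
    by jet_derive.
  assert (R4 : d_ut (Lop A B C) j = 1)
    by jet_derive.
  assert (R5 : d_ux (Lop A B C) j = - B t x)
    by jet_derive.
  assert (R6 : d_uxx (Lop A B C) j = - A t x)
    by jet_derive.
  assert (R7 : d_utt (Lop A B C) j = 0)
    by jet_derive.
  assert (R8 : d_utx (Lop A B C) j = 0)
    by jet_derive.
  rewrite R1, R2, R3, R4, R5, R6, R7, R8. unfold on_jet; simpl. ring.
Qed.

Lemma Dtot_characteristic Q t x u ut ux utt utx uxx :
  an (tau Q) t x u -> an (xi Q) t x u -> an (eta Q) t x u ->
  let j := Jet t x u ut ux utt utx uxx in
  Dtot_t (characteristic Q) j = eta_t_formula Q t x u ut ux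
    - tau Q t x u * utt - xi Q t x u * utx /\
  Dtot_x (characteristic Q) j = eta_x_formula Q t x u ut ux
    - tau Q t x u * utx - xi Q t x u * uxx.
Proof.
  intros Ht Hx He j.
  pose proof (an_is_derive1 Ht). pose proof (an_is_derive2 Ht).
  pose proof (an_is_derive3 Ht). pose proof (an_is_derive1 Hx).
  pose proof (an_is_derive2 Hx). pose proof (an_is_derive3 Hx).
  pose proof (an_is_derive1 He). pose proof (an_is_derive2 He).
  pose proof (an_is_derive3 He).
  assert (R1 : d_t (characteristic Q) j =
    D1 (eta Q) t x u - D1 (tau Q) t x u * ut - D1 (xi Q) t x u * ux)
    by jet_derive.
  assert (R2 : d_x (characteristic Q) j =
    D2 (eta Q) t x u - D2 (tau Q) t x u * ut - D2 (xi Q) t x u * ux)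
    by jet_derive.
  assert (R3 : d_u (characteristic Q) j =
    D3 (eta Q) t x u - D3 (tau Q) t x u * ut - D3 (xi Q) t x u * ux)
    by jet_derive.
  assert (R4 : d_ut (characteristic Q) j = - tau Q t x u)
    by jet_derive.
  assert (R5 : d_ux (characteristic Q) j = - xi Q t x u)
    by jet_derive.
  unfold Dtot_t, Dtot_x. rewrite R1, R2, R3, R4, R5. simpl.
  unfold eta_t_formula, eta_x_formula. split; ring.
Qed.

(** * Determining equations *)

Lemma near_near t x u P : near t x u P -> near t x u (fun t x u => near t x u P).
Proof.
  intros [d [d0 H]]; exists (d / 2); split; [lra|]. intros t' x' u' Ht Hx Hu.
  exists (d / 2); split; [lra|].
  assert (T : forall a b c, Rabs (c - b) < d / 2 -> Rabs (b - a) < d / 2 -> Rabs (c - a) < d).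
  { intros a b c H1 H2. replace (c - a) with ((c - b) + (b - a)) by ring.
    eapply Rle_lt_trans; [apply Rabs_triang|lra]. }
  intros t'' x'' u'' Ht' Hx' Hu'. apply H; eapply T; eassumption.
Qed.
Arguments near_near {t x u P}.

Lemma near_locally1 t x u P : near t x u P -> locally t (fun s => P s x u).
Proof.
  intros [d [d0 H]]. exists (mkposreal d d0). intros s Hs.
  apply H; [apply Hs| |]; now apply Rabs_diag_lt.
Qed.
Lemma near_locally2 t x u P : near t x u P -> locally x (fun s => P t s u).
Proof.
  intros [d [d0 H]]. exists (mkposreal d d0). intros s Hs.
  apply H; [|apply Hs|]; now apply Rabs_diag_lt.
Qed.
Lemma near_locally3 t x u P : near t x u P -> locally u (fun s => P t x s).
Proof.
  intros [d [d0 H]]. exists (mkposreal d d0). intros s Hs.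
  apply H; [| |apply Hs]; now apply Rabs_diag_lt.
Qed.

Lemma D1_near f g t x u : near t x u (fun t x u => f t x u = g t x u) ->
  near t x u (fun t x u => D1 f t x u = D1 g t x u).
Proof.
  intros H; apply near_imp with (2 := near_near H). intros t' x' u' H'.
  apply Derive_ext_loc, (near_locally1 _ _ _ _ H').
Qed.
Arguments D1_near {f g t x u}.
Lemma D2_near f g t x u : near t x u (fun t x u => f t x u = g t x u) ->
  near t x u (fun t x u => D2 f t x u = D2 g t x u).
Proof.
  intros H; apply near_imp with (2 := near_near H). intros t' x' u' H'.
  apply Derive_ext_loc, (near_locally2 _ _ _ _ H').
Qed.
Arguments D2_near {f g t x u}.
Lemma D3_near f g t x u : near t x u (fun t x u => f t x u = g t x u) ->
  near t x u (fun t x u => D3 f t x u = D3 g t x u).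
Proof.
  intros H; apply near_imp with (2 := near_near H). intros t' x' u' H'.
  apply Derive_ext_loc, (near_locally3 _ _ _ _ H').
Qed.
Arguments D3_near {f g t x u}.

Lemma near_D2_mult f a b t x u : an a t x u -> an b t x u ->
  near t x u (fun t x u => f t x u = a t x u * b t x u) ->
  near t x u (fun t x u => D2 f t x u = D2 a t x u * b t x u + a t x u * D2 b t x u).
Proof.
  intros Ha Hb E. apply near_imp with (2 := near_and (D2_near E)
    (near_and (near_ex_derive2 Ha) (near_ex_derive2 Hb))).
  clear. intros t x u [E [Ha Hb]]. rewrite E. apply is_derive_unique.
  apply (is_derive_Rmult (fun s => a t s u) (fun s => b t s u)); now apply Derive_correct.
Qed.

Lemma near_D3_mult f a b t x u : an a t x u -> an b t x u ->
  near t x u (fun t x u => f t x u = a t x u * b t x u) ->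
  near t x u (fun t x u => D3 f t x u = D3 a t x u * b t x u + a t x u * D3 b t x u).
Proof.
  intros Ha Hb E. apply near_imp with (2 := near_and (D3_near E)
    (near_and (near_ex_derive3 Ha) (near_ex_derive3 Hb))).
  clear. intros t x u [E [Ha Hb]]. rewrite E. apply is_derive_unique.
  apply (is_derive_Rmult (fun s => a t x s) (fun s => b t x s)); now apply Derive_correct.
Qed.

Lemma product_derivatives f a b t x u : an a t x u -> an b t x u ->
  near t x u (fun t x u => f t x u = a t x u * b t x u) ->
  D1 f t x u = D1 a t x u * b t x u + a t x u * D1 b t x u /\
  D2 f t x u = D2 a t x u * b t x u + a t x u * D2 b t x u /\
  D3 f t x u = D3 a t x u * b t x u + a t x u * D3 b t x u /\
  D2 (D2 f) t x u = D2 (D2 a) t x u * b t x u + 2 * D2 a t x u * D2 b t x u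
    + a t x u * D2 (D2 b) t x u /\
  D2 (D3 f) t x u = D2 (D3 a) t x u * b t x u + D3 a t x u * D2 b t x u
    + D2 a t x u * D3 b t x u + a t x u * D2 (D3 b) t x u /\
  D3 (D3 f) t x u = D3 (D3 a) t x u * b t x u + 2 * D3 a t x u * D3 b t x u
    + a t x u * D3 (D3 b) t x u.
Proof.
  intros Ha Hb E.
  pose proof (near_D2_mult _ _ _ _ _ _ Ha Hb E) as E2.
  pose proof (near_D3_mult _ _ _ _ _ _ Ha Hb E) as E3.
  pose proof (an_D2 Ha) as Ha2. pose proof (an_D3 Ha) as Ha3.
  pose proof (an_D2 Hb) as Hb2. pose proof (an_D3 Hb) as Hb3.
  pose proof (an_is_derive1 Ha). pose proof (an_is_derive1 Hb).
  pose proof (an_is_derive2 Ha). pose proof (an_is_derive2 Hb).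
  pose proof (an_is_derive3 Ha). pose proof (an_is_derive3 Hb).
  pose proof (an_is_derive2 Ha2). pose proof (an_is_derive2 Hb2).
  pose proof (an_is_derive2 Ha3). pose proof (an_is_derive2 Hb3).
  pose proof (an_is_derive3 Ha3). pose proof (an_is_derive3 Hb3).
  split; [|split; [exact (near_self E2)|split; [exact (near_self E3)|
    split; [|split]]]].
  - rewrite (near_self (D1_near E)).
    derive_ring.
  - rewrite (near_self (D2_near E2)).
    derive_ring.
  - rewrite (near_self (D2_near E3)).
    derive_ring.
  - rewrite (near_self (D3_near E3)).
    derive_ring.
Qed.

(* The invariance condition for the operator [d/dt + g d/dx + h d/du] at the
   jet with [u_x = p] satisfying the equation and [u_t + g u_x = h]. *)
Definition invariance_defect (A B C : R -> R -> R) (g h : R -> R -> R -> R) t x u p :=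
  let ut := h t x u - g t x u * p in
  let uxx := (h t x u - (g t x u + B t x) * p - C t x * u) / A t x in
  D1 h t x u + ut * D3 h t x u - p * (D1 g t x u + ut * D3 g t x u)
  - A t x * (Dxx_total h t x u p uxx - p * Dxx_total g t x u p uxx
             - 2 * uxx * (D2 g t x u + p * D3 g t x u))
  - B t x * (D2 h t x u + p * D3 h t x u - p * (D2 g t x u + p * D3 g t x u))
  - C t x * h t x u - (Dt A t x + g t x u * Dx A t x) * uxx
  - (Dt B t x + g t x u * Dx B t x) * p - (Dt C t x + g t x u * Dx C t x) * u.

(** The last clause of [reduction_operator] over one base point, so that it can be used and proved
    pointwise. *)
Definition invariance_condition A B C Q t x u := forall ut ux utt utx uxx,
  let j := Jet t x u ut ux utt utx uxx in
  Lop A B C j = 0 -> characteristic Q j = 0 ->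
  Dtot_t (characteristic Q) j = 0 -> Dtot_x (characteristic Q) j = 0 ->
  prolong2 Q (Lop A B C) j = 0.

(** On the constraint set [u_t], [u_xx], [u_tx] are functions of [u_x]. Derivatives of [tau] enter
    the prolongation only as multipliers of the characteristic of the normalized operator and of its
    x-derivative, both zero there, so the prolongation is [tau] times the defect. *)
Lemma invariance_condition_iff A B C Q g h t x u :
  an2 A t x -> an2 B t x -> an2 C t x -> A t x <> 0 ->
  an (tau Q) t x u -> an g t x u -> an h t x u -> tau Q t x u <> 0 ->
  near t x u (fun t x u => xi Q t x u = tau Q t x u * g t x u) ->
  near t x u (fun t x u => eta Q t x u = tau Q t x u * h t x u) ->
  (invariance_condition A B C Q t x u <-> forall p, invariance_defect A B C g h t x u p = 0).
Proof.
  intros HA HB HC A0 Ht Hg Hh T0 Exi Eeta.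
  assert (Hxi : an (xi Q) t x u).
  { apply an_ext_near with (fun t x u => tau Q t x u * g t x u); [now apply an_mult|].
    apply near_imp with (2 := Exi); auto. }
  assert (Heta : an (eta Q) t x u).
  { apply an_ext_near with (fun t x u => tau Q t x u * h t x u); [now apply an_mult|].
    apply near_imp with (2 := Eeta); auto. }
  destruct (product_derivatives _ _ _ _ _ _ Ht Hg Exi) as [X1 [X2 [X3 [X22 [X23 X33]]]]].
  destruct (product_derivatives _ _ _ _ _ _ Ht Hh Eeta) as [E1 [E2 [E3 [E22 [E23 E33]]]]].
  pose proof (near_self Exi) as X0. pose proof (near_self Eeta) as E0.
  simpl in X0, E0.
  assert (M : forall ux utt,
    let ut := h t x u - g t x u * ux in
    let uxx := (h t x u - (g t x u + B t x) * ux - C t x * u) / A t x in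
    let utx := D2 h t x u + ux * D3 h t x u - ux * (D2 g t x u + ux * D3 g t x u)
      - g t x u * uxx in
    prolong2 Q (Lop A B C) (Jet t x u ut ux utt utx uxx)
    = tau Q t x u * invariance_defect A B C g h t x u ux).
  { intros ux utt ut uxx utx. rewrite prolong2_Lop by easy.
    unfold eta_t_formula, eta_x_formula, eta_xx_formula, invariance_defect, Dxx_total.
    rewrite X0, E0, X1, X2, X3, X22, X23, X33, E1, E2, E3, E22, E23, E33.
    fold uxx. fold ut. unfold utx, ut. ring. }
  assert (DC := fun ut ux utt utx uxx =>
    Dtot_characteristic Q t x u ut ux utt utx uxx Ht Hxi Heta).
  split.
  - intros Inv p.
    set (ut := h t x u - g t x u * p).
    set (uxx := (h t x u - (g t x u + B t x) * p - C t x * u) / A t x).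
    set (utx := D2 h t x u + p * D3 h t x u - p * (D2 g t x u + p * D3 g t x u)
      - g t x u * uxx).
    (* Chosen to make the t-derivative of the characteristic vanish, which [tau <> 0] permits. *)
    set (utt := (eta_t_formula Q t x u ut p - xi Q t x u * utx) / tau Q t x u).
    apply Rmult_eq_reg_l with (tau Q t x u); [|easy].
    rewrite Rmult_0_r, <- (M p utt). apply Inv; fold ut uxx utx.
    + unfold Lop; simpl. unfold uxx, ut. now field.
    + unfold characteristic, on_jet; simpl. rewrite X0, E0. unfold ut. ring.
    + rewrite (proj1 (DC ut p utt utx uxx)). unfold utt. now field.
    + rewrite (proj2 (DC ut p utt utx uxx)). unfold eta_x_formula.
      rewrite X0, X2, X3, E2, E3. unfold utx, ut. ring.
  - intros Def ut ux utt utx uxx j HL Hc HDt HDx.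
    assert (Eut : ut = h t x u - g t x u * ux).
    { unfold j, characteristic, on_jet in Hc; simpl in Hc. rewrite X0, E0 in Hc.
      apply Rmult_eq_reg_l with (tau Q t x u); [lra|easy]. }
    assert (Euxx : uxx = (h t x u - (g t x u + B t x) * ux - C t x * u) / A t x).
    { unfold j, Lop in HL; simpl in HL. rewrite Eut in HL.
      apply Rmult_eq_reg_l with (A t x); [|easy].
      replace (A t x * ((h t x u - (g t x u + B t x) * ux - C t x * u) / A t x))
        with (h t x u - (g t x u + B t x) * ux - C t x * u) by now field.
      lra. }
    assert (Eutx : utx = D2 h t x u + ux * D3 h t x u - ux * (D2 g t x u + ux * D3 g t x u)
      - g t x u * uxx).
    { unfold j in HDx. rewrite (proj2 (DC ut ux utt utx uxx)) in HDx.
      unfold eta_x_formula in HDx. rewrite X0, X2, X3, E2, E3, Eut in HDx.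
      apply Rmult_eq_reg_l with (tau Q t x u); [lra|easy]. }
    unfold j. rewrite Eutx, Euxx, Eut, M, Def. ring.
Qed.

Lemma cubic_coefficients (f : R -> R) c0 c1 c2 c3 :
  (forall p, f p = c0 + c1 * p + c2 * p ^ 2 + c3 * p ^ 3) -> (forall p, f p = 0) ->
  c0 = 0 /\ c1 = 0 /\ c2 = 0 /\ c3 = 0.
Proof.
  intros E H. assert (P : forall p, c0 + c1 * p + c2 * p ^ 2 + c3 * p ^ 3 = 0)
    by (intros; now rewrite <- E).
  pose proof (P 0). pose proof (P 1). pose proof (P (-1)). pose proof (P 2).
  repeat split; lra.
Qed.

(** The coefficients of [p ^ 3], [p ^ 2] and [p]. The constant coefficient enters later, through
    [invariance_defect_linear]. *)
Lemma determining_equations A B C g h t x u : A t x <> 0 ->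
  (forall p, invariance_defect A B C g h t x u p = 0) ->
  D3 (D3 g) t x u = 0 /\
  A t x * D3 (D3 h) t x u
    = 2 * A t x * D2 (D3 g) t x u - 2 * (g t x u + B t x) * D3 g t x u /\
  2 * h t x u * D3 g t x u - D1 g t x u - 3 * C t x * u * D3 g t x u
    - 2 * A t x * D2 (D3 h) t x u + A t x * D2 (D2 g) t x u
    - 2 * (g t x u + B t x) * D2 g t x u + B t x * D2 g t x u
    + (Dt A t x + g t x u * Dx A t x) * (g t x u + B t x) / A t x
    - Dt B t x - g t x u * Dx B t x = 0.
Proof.
  intros A0 H.
  destruct (cubic_coefficients (fun p => invariance_defect A B C g h t x u p)
    (D1 h t x u + h t x u * D3 h t x u - A t x * D2 (D2 h) t x u
     - (h t x u - C t x * u) * D3 h t x u + 2 * (h t x u - C t x * u) * D2 g t x u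
     - B t x * D2 h t x u - C t x * h t x u
     - (Dt A t x + g t x u * Dx A t x) * (h t x u - C t x * u) / A t x
     - (Dt C t x + g t x u * Dx C t x) * u)
    (2 * h t x u * D3 g t x u - D1 g t x u - 3 * C t x * u * D3 g t x u
    - 2 * A t x * D2 (D3 h) t x u + A t x * D2 (D2 g) t x u
    - 2 * (g t x u + B t x) * D2 g t x u + B t x * D2 g t x u
    + (Dt A t x + g t x u * Dx A t x) * (g t x u + B t x) / A t x
    - Dt B t x - g t x u * Dx B t x)
    (2 * A t x * D2 (D3 g) t x u - 2 * (g t x u + B t x) * D3 g t x u
      - A t x * D3 (D3 h) t x u)
    (A t x * D3 (D3 g) t x u)) as [_ [C1 [C2 C3]]]; [|easy|].
  - intros p. unfold invariance_defect, Dxx_total. now field.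
  - split; [|split]; [|lra|easy].
    apply Rmult_eq_reg_l with (A t x); [lra|easy].
Qed.

(** Inserting [u_t = h1 u - g u_x + h0] into the equation and dividing by [A] gives
    [u_xx = alpha u_x + beta u + gamma]. *)
Definition alpha (A B g : R -> R -> R) t x := - (g t x + B t x) / A t x.
Definition beta (A C h1 : R -> R -> R) t x := (h1 t x - C t x) / A t x.
Definition gamma (A h0 : R -> R -> R) t x := h0 t x / A t x.

Lemma an2_coefficients A B C g h1 h0 t x : A t x <> 0 ->
  an2 A t x -> an2 B t x -> an2 C t x -> an2 g t x -> an2 h1 t x -> an2 h0 t x ->
  an2 (alpha A B g) t x /\ an2 (beta A C h1) t x /\ an2 (gamma A h0) t x.
Proof.
  intros A0 AA AB AC Hg H1 H0. split; [|split].
  - apply (an2_div (fun t x => - (g t x + B t x))); auto.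
    apply (an2_opp (fun t x => g t x + B t x)). now apply an2_plus.
  - apply (an2_div (fun t x => h1 t x - C t x)); auto. now apply an2_minus.
  - now apply an2_div.
Qed.

Lemma an_linear h1 h0 t x u : an2 h1 t x -> an2 h0 t x ->
  an (fun t x u => h1 t x * u + h0 t x) t x u.
Proof.
  intros H1 H0. apply an_plus; [|now apply an2_lift].
  apply (an_mult (fun t x _ => h1 t x)); [now apply an2_lift|apply an_coord3].
Qed.

(** For linear coefficients the invariance condition is affine in [p] and [u], with the obstructions
    to compatibility as coefficients; this identifies invariance of the operator with
    [compatible]. *)
Lemma invariance_defect_linear A B C g h1 h0 t x u p :
  an2 A t x -> an2 B t x -> an2 C t x -> an2 g t x -> an2 h1 t x -> an2 h0 t x ->
  A t x <> 0 ->
  let al := alpha A B g in let be := beta A C h1 in let ga := gamma A h0 in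
  invariance_defect A B C (fun t x _ => g t x) (fun t x u => h1 t x * u + h0 t x) t x u p
  = A t x * (obstruction_yx al g h1 t x * p +
     obstruction_y al be g h1 t x * u +
     obstruction_1 al be ga g h1 h0 t x).
Proof.
  intros HA HB HC Hg H1 H0 A0 al be ga.
  derivatives HA.
  derivatives HB.
  derivatives HC.
  derivatives Hg.
  derivatives H1.
  derivatives H0.
  pose proof (an2_is_derive_x (an2_Dx H1)).
  pose proof (an2_is_derive_x (an2_Dx H0)).
  set (G := fun t x (_ : R) => g t x). set (L := fun t x u => h1 t x * u + h0 t x).
  assert (G1 : D1 G t x u = Dt g t x) by easy.
  assert (G2 : D2 G t x u = Dx g t x) by easy.
  assert (G22 : D2 (D2 G) t x u = Dx (Dx g) t x) by easy.
  assert (G3 : forall t x u, D3 G t x u = 0) by (intros; apply (Derive_const (g _ _))).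
  assert (G23 : D2 (D3 G) t x u = 0).
  { unfold D2 at 1. rewrite (Derive_ext _ (fun _ => 0)); [apply Derive_const|auto]. }
  assert (G33 : D3 (D3 G) t x u = 0).
  { unfold D3 at 1. rewrite (Derive_ext _ (fun _ => 0)); [apply Derive_const|auto]. }
  assert (T1 : D1 L t x u = Dt h1 t x * u + Dt h0 t x).
  { unfold L; derive_ring. }
  assert (T2 : D2 L t x u = Dx h1 t x * u + Dx h0 t x).
  { unfold L; derive_ring. }
  assert (T3 : forall t x u, D3 L t x u = h1 t x).
  { intros. unfold L; derive_ring. }
  assert (T23 : D2 (D3 L) t x u = Dx h1 t x).
  { unfold D2 at 1. now rewrite (Derive_ext _ (fun s => h1 t s)). }
  assert (T33 : D3 (D3 L) t x u = 0).
  { unfold D3 at 1. rewrite (Derive_ext _ (fun _ => h1 t x)); [apply Derive_const|auto]. }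
  assert (T22 : D2 (D2 L) t x u = Dx (Dx h1) t x * u + Dx (Dx h0) t x).
  { assert (N : near2 t x (fun t x => D2 L t x u = Dx h1 t x * u + Dx h0 t x)).
    { apply near2_imp with (2 := near2_and (an2_near_derive_x H1)
        (an2_near_derive_x H0)).
      intros t' x' [R1 R2]. unfold L; derive_ring. }
    transitivity (Derive (fun s => Dx h1 t s * u + Dx h0 t s) x);
      [apply Derive_ext_loc, (near2_locally_x N)|].
    derive_ring. }
  assert (At : Dt al t x = - (Dt g t x + Dt B t x) / A t x
    + (g t x + B t x) * Dt A t x / A t x ^ 2).
  { apply is_derive_unique. unfold al, alpha. eapply is_derive_eq; [der|]. now field. }
  assert (Ax : Dx al t x = - (Dx g t x + Dx B t x) / A t x
    + (g t x + B t x) * Dx A t x / A t x ^ 2).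
  { apply is_derive_unique. unfold al, alpha. eapply is_derive_eq; [der|]. now field. }
  assert (Bt : Dt be t x = (Dt h1 t x - Dt C t x) / A t x
    - (h1 t x - C t x) * Dt A t x / A t x ^ 2).
  { apply is_derive_unique. unfold be, beta. eapply is_derive_eq; [der|]. now field. }
  assert (Bx : Dx be t x = (Dx h1 t x - Dx C t x) / A t x
    - (h1 t x - C t x) * Dx A t x / A t x ^ 2).
  { apply is_derive_unique. unfold be, beta. eapply is_derive_eq; [der|]. now field. }
  assert (Ct : Dt ga t x = Dt h0 t x / A t x - h0 t x * Dt A t x / A t x ^ 2).
  { apply is_derive_unique. unfold ga, gamma. eapply is_derive_eq; [der|]. now field. }
  assert (Cx : Dx ga t x = Dx h0 t x / A t x - h0 t x * Dx A t x / A t x ^ 2).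
  { apply is_derive_unique. unfold ga, gamma. eapply is_derive_eq; [der|]. now field. }
  unfold invariance_defect, Dxx_total, obstruction_yx, obstruction_y, obstruction_1.
  rewrite G1, G2, G22, G3, G23, G33, T1, T2, T3, T23, T33, T22, At, Ax, Bt, Bx, Ct, Cx.
  unfold al, be, ga, alpha, beta, gamma, G, L. now field.
Qed.

Lemma derive_eq_on_interval (f : R -> R) (F : R -> R) u0 d :
  (forall u, Rabs (u - u0) < d -> is_derive f u (F u)) ->
  forall P, (forall u, is_derive P u (F u)) ->
  forall u, Rabs (u - u0) < d -> f u = f u0 + (P u - P u0).
Proof.
  intros Hf P HP u Hu.
  assert (E : f u - P u = f u0 - P u0); [|lra].
  apply (derive_0_eq (fun u => f u - P u)). intros s Hs.
  assert (Z : Rabs (u0 - u0) < d).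
  { rewrite Rminus_diag, Rabs_R0. apply Rle_lt_trans with (2 := Hu), Rabs_pos. }
  pose proof (Hf s (between_close u u0 u0 d s Hu Z Hs)). pose proof (HP s).
  eapply is_derive_eq; [apply is_derive_Rminus; eassumption|ring].
Qed.

Lemma interval_locally u0 d u : Rabs (u - u0) < d -> locally u (fun v : R => Rabs (v - u0) < d).
Proof.
  intros Hu. assert (P : 0 < d - Rabs (u - u0)) by lra. exists (mkposreal _ P).
  intros v Hv. change (Rabs (v - u) < d - Rabs (u - u0)) in Hv.
  replace (v - u0) with ((v - u) + (u - u0)) by ring.
  eapply Rle_lt_trans; [apply Rabs_triang|lra].
Qed.

(* [g] is affine and [h] cubic in [u]; the cubic term of the remaining equation
   is a multiple of the cube of the slope of [g], which therefore vanishes. *)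
Lemma coefficients_linear A B C g h t0 x0 u0 :
  near t0 x0 u0 (fun t x u => an g t x u /\ an h t x u /\
    (an2 A t x /\ an2 B t x /\ an2 C t x) /\ A t x <> 0 /\
    forall p, invariance_defect A B C g h t x u p = 0) ->
  exists G H1 H0,
    near2 t0 x0 (fun t x => an2 G t x /\ an2 H1 t x /\ an2 H0 t x) /\
    near t0 x0 u0 (fun t x u => g t x u = G t x) /\
    near t0 x0 u0 (fun t x u => h t x u = H1 t x * u + H0 t x).
Proof.
  intros [d [d0 Hd]].
  assert (Hu0 : Rabs (u0 - u0) < d) by now apply Rabs_diag_lt.
  set (G := fun t x => g t x u0). set (a := fun t x => D3 g t x u0).
  set (H0 := fun t x => h t x u0). set (H1 := fun t x => D3 h t x u0).
  (* With [g = G + a (u - u0)] the second determining equation makes [D3 (D3 h)] equal to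
     [2 K2 + 6 K3 (u - u0)]; two integrations turn [K2] and [K3] into the quadratic and cubic
     coefficients of [h]. *)
  pose (K2 := fun t x => Dx a t x - (G t x + B t x) * a t x / A t x).
  pose (K3 := fun t x => - (a t x * a t x) / (3 * A t x)).
  assert (Han : forall t x, Rabs (t - t0) < d -> Rabs (x - x0) < d ->
    (an2 A t x /\ an2 B t x /\ an2 C t x /\ A t x <> 0) /\
    an2 G t x /\ an2 a t x /\ an2 H0 t x /\ an2 H1 t x /\ an2 K2 t x /\ an2 K3 t x).
  { intros t x Ht Hx. destruct (Hd t x u0 Ht Hx Hu0) as [Hg [Hh [[HA [HB HC]] [A0 _]]]].
    assert (AG : an2 G t x) by now apply an2_slice.
    assert (Aa : an2 a t x) by now apply an2_slice, an_D3.
    repeat (split; auto).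
    - now apply an2_slice.
    - now apply (an2_slice (D3 h)), an_D3.
    - apply (an2_minus (Dx a)); [now apply an2_Dx|].
      apply (an2_div (fun t x => (G t x + B t x) * a t x)); auto.
      apply (an2_mult (fun t x => G t x + B t x)); auto. now apply an2_plus.
    - apply (an2_div (fun t x => - (a t x * a t x)) (fun t x => 3 * A t x)); [| |lra].
      + apply (an2_opp (fun t x => a t x * a t x)). now apply an2_mult.
      + apply (an2_mult (fun _ _ => 3)); [apply an2_const|easy]. }
  assert (E1 : forall t x u, Rabs (t - t0) < d -> Rabs (x - x0) < d -> Rabs (u - u0) < d ->
    D3 g t x u = a t x).
  { intros t x u Ht Hx Hu.
    rewrite (derive_eq_on_interval (fun u => D3 g t x u) (fun _ => 0) u0 d) with
      (P := fun _ => 0); auto.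
    - unfold a. ring.
    - intros v Hv. destruct (Hd t x v Ht Hx Hv) as [Hg [_ [_ [A0 Def]]]].
      rewrite <- (proj1 (determining_equations _ _ _ _ _ _ _ _ A0 Def)).
      apply an_is_derive3. now apply an_D3.
    - intros; apply is_derive_Rconst. }
  assert (E2 : forall t x u, Rabs (t - t0) < d -> Rabs (x - x0) < d -> Rabs (u - u0) < d ->
    g t x u = G t x + a t x * (u - u0)).
  { intros t x u Ht Hx Hu.
    rewrite (derive_eq_on_interval (fun u => g t x u) (fun _ => a t x) u0 d) with
      (P := fun u => a t x * (u - u0)); auto.
    - unfold G. ring.
    - intros v Hv. destruct (Hd t x v Ht Hx Hv) as [Hg _].
      rewrite <- (E1 t x v) by easy. now apply an_is_derive3.
    - intros v. der_ring. }
  assert (E3 : forall t x u, Rabs (t - t0) < d -> Rabs (x - x0) < d -> Rabs (u - u0) < d ->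
    D2 (D3 g) t x u = Dx a t x).
  { intros t x u Ht Hx Hu. apply Derive_ext_loc.
    apply filter_imp with (2 := interval_locally x0 d x Hx). intros; now apply E1. }
  assert (E4 : forall t x u, Rabs (t - t0) < d -> Rabs (x - x0) < d -> Rabs (u - u0) < d ->
    D3 h t x u = H1 t x + 2 * K2 t x * (u - u0) + 3 * K3 t x * (u - u0) ^ 2).
  { intros t x u Ht Hx Hu.
    rewrite (derive_eq_on_interval (fun u => D3 h t x u)
      (fun u => 2 * K2 t x + 6 * K3 t x * (u - u0)) u0 d) with
      (P := fun u => 2 * K2 t x * (u - u0) + 3 * K3 t x * ((u - u0) * (u - u0))); auto.
    - unfold H1. ring.
    - intros v Hv. destruct (Hd t x v Ht Hx Hv) as [_ [Hh [_ [A0 Def]]]].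
      destruct (determining_equations _ _ _ _ _ _ _ _ A0 Def) as [_ [Q _]].
      rewrite E1, E2, E3 in Q by easy.
      replace (2 * K2 t x + 6 * K3 t x * (v - u0)) with (D3 (D3 h) t x v).
      + apply an_is_derive3. now apply an_D3.
      + apply Rmult_eq_reg_l with (A t x); [|easy]. rewrite Q. unfold K2, K3. now field.
    - intros v. der_ring. }
  assert (E5 : forall t x u, Rabs (t - t0) < d -> Rabs (x - x0) < d -> Rabs (u - u0) < d ->
    h t x u = H0 t x + H1 t x * (u - u0) + K2 t x * (u - u0) ^ 2 + K3 t x * (u - u0) ^ 3).
  { intros t x u Ht Hx Hu.
    rewrite (derive_eq_on_interval (fun u => h t x u)
      (fun u => H1 t x + 2 * K2 t x * (u - u0) + 3 * K3 t x * (u - u0) ^ 2) u0 d) with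
      (P := fun u => H1 t x * (u - u0) + K2 t x * ((u - u0) * (u - u0))
        + K3 t x * ((u - u0) * ((u - u0) * (u - u0)))); auto.
    - unfold H0. ring.
    - intros v Hv. destruct (Hd t x v Ht Hx Hv) as [_ [Hh _]].
      rewrite <- E4 by easy. now apply an_is_derive3.
    - intros v. der_ring. }
  assert (E6 : forall t x u, Rabs (t - t0) < d -> Rabs (x - x0) < d -> Rabs (u - u0) < d ->
    D1 g t x u = Dt G t x + Dt a t x * (u - u0) /\
    D2 g t x u = Dx G t x + Dx a t x * (u - u0)).
  { intros t x u Ht Hx Hu. destruct (Han t x Ht Hx) as [_ [AG [Aa _]]].
    derivatives AG.
    derivatives Aa.
    split.
    - transitivity (Derive (fun s => G s x + a s x * (u - u0)) t).
      + apply Derive_ext_loc. apply filter_imp with (2 := interval_locally t0 d t Ht).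
        intros; now apply E2.
      + derive_ring.
    - transitivity (Derive (fun s => G t s + a t s * (u - u0)) x).
      + apply Derive_ext_loc. apply filter_imp with (2 := interval_locally x0 d x Hx).
        intros; now apply E2.
      + derive_ring. }
  assert (E7 : forall t x u, Rabs (t - t0) < d -> Rabs (x - x0) < d -> Rabs (u - u0) < d ->
    D2 (D2 g) t x u = Dx (Dx G) t x + Dx (Dx a) t x * (u - u0) /\
    D2 (D3 h) t x u = Dx H1 t x + 2 * Dx K2 t x * (u - u0) + 3 * Dx K3 t x * (u - u0) ^ 2).
  { intros t x u Ht Hx Hu. destruct (Han t x Ht Hx) as [_ [AG [Aa [_ [A1 [AK2 AK3]]]]]].
    pose proof (an2_is_derive_x (an2_Dx AG)).
    pose proof (an2_is_derive_x (an2_Dx Aa)).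
    pose proof (an2_is_derive_x A1). pose proof (an2_is_derive_x AK2).
    pose proof (an2_is_derive_x AK3).
    split.
    - transitivity (Derive (fun s => Dx G t s + Dx a t s * (u - u0)) x).
      + apply Derive_ext_loc. apply filter_imp with (2 := interval_locally x0 d x Hx).
        intros; now apply E6.
      + derive_ring.
    - transitivity (Derive (fun s => H1 t s + 2 * K2 t s * (u - u0)
        + 3 * K3 t s * ((u - u0) * (u - u0))) x).
      + apply Derive_ext_loc. apply filter_imp with (2 := interval_locally x0 d x Hx).
        intros; rewrite E4 by easy; ring.
      + derive_ring. }
  assert (a0 : forall t x, Rabs (t - t0) < d -> Rabs (x - x0) < d -> a t x = 0).
  { intros t x Ht Hx. destruct (Han t x Ht Hx) as [[_ [_ [_ A0]]] _].
    set (e := d / 3).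
    assert (R : forall w, Rabs w < d -> 2 *
      (H0 t x + H1 t x * w + K2 t x * w ^ 2 + K3 t x * w ^ 3) * a t x
      - (Dt G t x + Dt a t x * w) - 3 * C t x * (u0 + w) * a t x
      - 2 * A t x * (Dx H1 t x + 2 * Dx K2 t x * w + 3 * Dx K3 t x * w ^ 2)
      + A t x * (Dx (Dx G) t x + Dx (Dx a) t x * w)
      - 2 * (G t x + a t x * w + B t x) * (Dx G t x + Dx a t x * w)
      + B t x * (Dx G t x + Dx a t x * w)
      + (Dt A t x + (G t x + a t x * w) * Dx A t x) * (G t x + a t x * w + B t x) / A t x
      - Dt B t x - (G t x + a t x * w) * Dx B t x = 0).
    { intros w Hw. assert (Hu : Rabs (u0 + w - u0) < d)
        by now replace (u0 + w - u0) with w by ring.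
      destruct (Hd t x (u0 + w) Ht Hx Hu) as [_ [_ [_ [_ Def]]]].
      destruct (determining_equations _ _ _ _ _ _ _ _ A0 Def) as [_ [_ Q]].
      rewrite E1, E2, (proj1 (E6 _ _ _ Ht Hx Hu)), (proj2 (E6 _ _ _ Ht Hx Hu)),
        (proj1 (E7 _ _ _ Ht Hx Hu)), (proj2 (E7 _ _ _ Ht Hx Hu)), E5 in Q by easy.
      replace (u0 + w - u0) with w in Q by ring. exact Q. }
    assert (L : forall k, -2 <= k <= 2 -> Rabs (k * e) < d).
    { intros k Hk. unfold e. apply Rabs_def1; nra. }
    pose proof (R _ (L 1 ltac:(lra))) as R1. pose proof (R _ (L 2 ltac:(lra))) as R2.
    pose proof (R _ (L (-1) ltac:(lra))) as R3. pose proof (R _ (L (-2) ltac:(lra))) as R4.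
    (* The combination of the values at [2 e], [e], [-e], [-2 e] with weights 1, -2, 2, -1 kills the
       even powers and the linear term and takes [w ^ 3] to [12 e ^ 3]. The cubic coefficient is
       [2 a K3], coming from the product of [h] and [a]. *)
    assert (Hz : 24 * e ^ 3 * (a t x * K3 t x) = 0).
    { match type of R1 with ?l1 = 0 => match type of R2 with ?l2 = 0 =>
      match type of R3 with ?l3 = 0 => match type of R4 with ?l4 = 0 =>
        transitivity (l2 - 2 * l1 + 2 * l3 - l4); [field; exact A0|lra]
      end end end end. }
    assert (He : 0 < e) by (unfold e; lra). pose proof (pow_lt e 3 He).
    apply Rmult_integral in Hz. destruct Hz as [Hz|Hz]; [exfalso; nra|].
    assert (Hc : a t x ^ 3 = 0).
    { replace (a t x ^ 3) with (- 3 * A t x * (a t x * K3 t x)).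
      - rewrite Hz; ring.
      - unfold K3. now field. }
    destruct (Req_dec (a t x) 0) as [|N]; [easy|].
    exfalso; now apply (pow_nonzero _ 3 N). }
  assert (k0 : forall t x, Rabs (t - t0) < d -> Rabs (x - x0) < d -> K2 t x = 0 /\ K3 t x = 0).
  { intros t x Ht Hx. unfold K2, K3. rewrite (a0 t x Ht Hx).
    replace (Dx a t x) with 0.
    - split; unfold Rdiv; ring.
    - symmetry. transitivity (Derive (fun _ => 0) x); [|apply Derive_const].
      apply Derive_ext_loc. apply filter_imp with (2 := interval_locally x0 d x Hx).
      intros; now apply a0. }
  exists G, H1, (fun t x => H0 t x - u0 * H1 t x). split; [|split].
  - exists d; split; [easy|]. intros t x Ht Hx.
    destruct (Han t x Ht Hx) as [_ [AG [_ [AH0 [AH1 _]]]]].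
    split; [easy|split]; [easy|].
    apply (an2_minus H0 (fun t x => u0 * H1 t x)); [easy|].
    apply (an2_mult (fun _ _ => u0)); [apply an2_const|easy].
  - exists d; split; [easy|]. intros t x u Ht Hx Hu. rewrite E2, a0 by easy. ring.
  - exists d; split; [easy|]. intros t x u Ht Hx Hu.
    rewrite E5, (proj1 (k0 t x Ht Hx)), (proj2 (k0 t x Ht Hx)) by easy. ring.
Qed.

(** * From operators to families *)

Lemma open_near (D : R * R * R -> Prop) t x u : open D -> D (t, x, u) ->
  near t x u (fun t x u => D (t, x, u)).
Proof.
  intros HD Hp; destruct (HD _ Hp) as [[d d0] Hd].
  exists d; split; [easy|]. intros t' x' u' Ht Hx Hu. apply Hd.
  split; [split; [apply Ht|apply Hx]|apply Hu].
Qed.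

Lemma near_lift t x u (P : R -> R -> Prop) :
  near2 t x P -> near t x u (fun t x _ => P t x).
Proof. intros [d [d0 H]]; exists d; auto. Qed.

Lemma near2_all (U : R * R -> Prop) (P : R -> R -> Prop) t x : open U -> U (t, x) ->
  (forall t x, U (t, x) -> P t x) -> near2 t x P.
Proof. intros HU Ut H. apply near2_imp with (2 := open_near2 U t x HU Ut). auto. Qed.

Lemma Lop_jet_of A B C f t x : Lop A B C (jet_of f t x) =
  Dt f t x - A t x * Dx (Dx f) t x - B t x * Dx f t x - C t x * f t x.
Proof. reflexivity. Qed.

Lemma characteristic_jet_of Q f t x : characteristic Q (jet_of f t x) =
  eta Q t x (f t x) - tau Q t x (f t x) * Dt f t x - xi Q t x (f t x) * Dx f t x.
Proof. reflexivity. Qed.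

Lemma frobenius_solution A B C g h1 h0 y t x : A t x <> 0 ->
  frobenius (alpha A B g) (beta A C h1) (gamma A h0) g h1 h0 y t x ->
  Lop A B C (jet_of y t x) = 0 /\ Dt y t x = h1 t x * y t x - g t x * Dx y t x + h0 t x.
Proof.
  intros A0 [Y1 [Y2 [Y3 Y4]]]. apply is_derive_unique in Y1, Y4.
  change (Dt y t x = h1 t x * y t x - g t x * Dx y t x + h0 t x) in Y1.
  change (Dx (Dx y) t x = alpha A B g t x * Dx y t x + beta A C h1 t x * y t x
    + gamma A h0 t x) in Y4.
  split; [|easy]. rewrite Lop_jet_of, Y1, Y4. unfold alpha, beta, gamma. now field.
Qed.

Lemma solution_frobenius (U : R * R -> Prop) A B C g h1 h0 y t x : open U ->
  (forall t x, U (t, x) -> A t x <> 0) ->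
  (forall t x, U (t, x) -> Lop A B C (jet_of y t x) = 0 /\
     Dt y t x = h1 t x * y t x - g t x * Dx y t x + h0 t x) ->
  U (t, x) -> an2 g t x -> an2 h1 t x -> an2 h0 t x -> an2 y t x ->
  near2 t x (frobenius (alpha A B g) (beta A C h1) (gamma A h0) g h1 h0 y).
Proof.
  intros HU A0 HS Ut Hg H1 H0 Hy. apply near2_frobenius; auto.
  - apply (near2_all U); auto. intros; now apply HS.
  - apply (near2_all U); auto. intros t' x' Ut'. destruct (HS t' x' Ut') as [E1 E2].
    rewrite Lop_jet_of, E2 in E1. pose proof (A0 t' x' Ut').
    apply Rmult_eq_reg_l with (A t' x'); [|easy].
    unfold alpha, beta, gamma.
    replace (A t' x' * (- (g t' x' + B t' x') / A t' x' * Dx y t' x' +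
      (h1 t' x' - C t' x') / A t' x' * y t' x' + h0 t' x' / A t' x'))
      with (- (g t' x' + B t' x') * Dx y t' x' + (h1 t' x' - C t' x') * y t' x' + h0 t' x')
      by now field.
    lra.
Qed.

Lemma gamma_zero2 A : gamma A zero2 = zero2.
Proof.
  extensionality t; extensionality x. unfold gamma, zero2, Rdiv. ring.
Qed.

(** The common interface of both directions: it implies that [F] is two-parametric and, for an
    operator with coefficient ratios [g] and [h1 u + h0], that [F] corresponds to it. *)
Definition frobenius_family (U : R * R -> Prop) A B C g h1 h0 F :=
  forall t x, U (t, x) -> A t x <> 0 /\ (an2 g t x /\ an2 h1 t x /\ an2 h0 t x) /\
    (an2 (v1 F) t x /\ an2 (v2 F) t x /\ an2 (v3 F) t x) /\
    near2 t x (frobenius (alpha A B g) (beta A C h1) zero2 g h1 zero2 (v1 F)) /\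
    near2 t x (frobenius (alpha A B g) (beta A C h1) zero2 g h1 zero2 (v2 F)) /\
    near2 t x (frobenius (alpha A B g) (beta A C h1) (gamma A h0) g h1 h0 (v3 F)) /\
    wronskian (v1 F) (v2 F) t x <> 0.

Lemma frobenius_family_at U A B C g h1 h0 F c1 c2 t x :
  frobenius_family U A B C g h1 h0 F -> U (t, x) ->
  near2 t x (frobenius (alpha A B g) (beta A C h1) (gamma A h0) g h1 h0 (family_at F c1 c2)).
Proof.
  intros HF Ut. destruct (HF t x Ut) as [_ [_ [_ [F1 [F2 [F3 _]]]]]].
  apply frobenius_ext with (fun t x => c1 * v1 F t x + (c2 * v2 F t x + v3 F t x)).
  - exists 1; split; [lra|]. intros; unfold family_at; ring.
  - apply (frobenius_plus _ _ _ _ _ _ (v1 F) (fun t x => c2 * v2 F t x + v3 F t x)); [easy|].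
    now apply frobenius_plus.
Qed.

Lemma an2_family_at F c1 c2 t x : an2 (v1 F) t x -> an2 (v2 F) t x -> an2 (v3 F) t x ->
  an2 (family_at F c1 c2) t x.
Proof.
  intros H1 H2 H3. apply (an2_plus (fun t x => c1 * v1 F t x + c2 * v2 F t x)); [|easy].
  now apply an2_lincomb.
Qed.

Lemma Dx_lincomb c1 c2 f g t x : an2 f t x -> an2 g t x ->
  Dx (fun t x => c1 * f t x + c2 * g t x) t x = c1 * Dx f t x + c2 * Dx g t x.
Proof.
  intros Hf Hg. pose proof (an2_is_derive_x Hf). pose proof (an2_is_derive_x Hg).
  derive_ring.
Qed.

Lemma frobenius_family_two_parametric U A B C g h1 h0 F : region U ->
  frobenius_family U A B C g h1 h0 F -> two_parametric_solution_family A B C U F.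
Proof.
  intros [OU [_ [[t0 x0] U0]]] HF; split.
  - intros c1 c2; split.
    + apply an2_analytic2. intros t x Ut. destruct (HF t x Ut) as [_ [_ [[? [? ?]] _]]].
      now apply an2_family_at.
    + intros t x Ut. apply (frobenius_solution A B C g h1 h0); [apply (HF t x Ut)|].
      apply (near2_self (frobenius_family_at U A B C g h1 h0 F c1 c2 t x HF Ut)).
  - intros c1 c2 E. destruct (HF t0 x0 U0) as [_ [_ [[A1 [A2 _]] [_ [_ [_ W]]]]]].
    assert (Ex : c1 * Dx (v1 F) t0 x0 + c2 * Dx (v2 F) t0 x0 = 0).
    { rewrite <- Dx_lincomb by easy. transitivity (Dx (fun _ _ => 0) t0 x0);
        [|apply (Derive_const 0)].
      apply (near2_self (@Dx_near _ (fun _ _ => 0) _ _ (near2_all U _ t0 x0 OU U0 E))). }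
    pose proof (E t0 x0 U0) as E0. unfold wronskian in W.
    split; apply Rmult_eq_reg_r with (v1 F t0 x0 * Dx (v2 F) t0 x0 - v2 F t0 x0 * Dx (v1 F) t0 x0);
      try easy.
    + transitivity ((c1 * v1 F t0 x0 + c2 * v2 F t0 x0) * Dx (v2 F) t0 x0
        - (c1 * Dx (v1 F) t0 x0 + c2 * Dx (v2 F) t0 x0) * v2 F t0 x0); [ring|].
      rewrite E0, Ex; ring.
    + transitivity (v1 F t0 x0 * (c1 * Dx (v1 F) t0 x0 + c2 * Dx (v2 F) t0 x0)
        - Dx (v1 F) t0 x0 * (c1 * v1 F t0 x0 + c2 * v2 F t0 x0)); [ring|].
      rewrite E0, Ex; ring.
Qed.

(** An invariant solution minus [v3] solves the homogeneous system, and connectedness of [V] makes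
    its coordinates constant. Conversely [f] agrees with a member only on [V], whose openness
    transfers derivatives. *)
Lemma frobenius_family_corresponds U I A B C g h1 h0 F Q :
  frobenius_family U A B C g h1 h0 F ->
  (forall t x u, U (t, x) -> I u -> tau Q t x u <> 0 /\
     xi Q t x u = tau Q t x u * g t x /\
     eta Q t x u = tau Q t x u * (h1 t x * u + h0 t x)) ->
  corresponds A B C U I Q F.
Proof.
  intros HF HQ V HV VU f If. pose proof HV as [OV _]. split.
  - intros [[Af Sf] Inv]. rewrite an2_analytic2 in Af.
    assert (HS : forall t x, V (t, x) -> Lop A B C (jet_of f t x) = 0 /\
      Dt f t x = h1 t x * f t x - g t x * Dx f t x + h0 t x).
    { intros t x Vt; split; [now apply Sf|].
      destruct (HQ t x (f t x) (VU _ Vt) (If t x Vt)) as [T0 [X E]].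
      pose proof (Inv t x Vt) as Ch. rewrite characteristic_jet_of, X, E in Ch.
      apply Rmult_eq_reg_l with (tau Q t x (f t x)); [lra|easy]. }
    destruct (frobenius_span V (alpha A B g) (beta A C h1) g h1 (v1 F) (v2 F)
      (fun t x => f t x - v3 F t x)) as [c1 [c2 E]]; [easy| |].
    + intros t x Vt. destruct (HF t x (VU _ Vt))
        as [_ [[Hg [H1 H0]] [_ [F1 [F2 [F3 W]]]]]].
      split; [apply (near2_self F1)|split; [apply (near2_self F2)|split; [|easy]]].
      apply (@near2_self t x (frobenius (alpha A B g) (beta A C h1) zero2 g h1 zero2
        (fun t x => f t x - v3 F t x))).
      apply frobenius_minus with (2 := F3).
      apply (solution_frobenius V); auto. intros; now apply HF, VU.
    + exists c1, c2. intros t x Vt. generalize (E t x Vt). unfold family_at. lra.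
  - intros [c1 [c2 E]].
    assert (HE : forall t x, V (t, x) ->
      near2 t x (fun t x => family_at F c1 c2 t x = f t x)).
    { intros t x Vt. apply (near2_all V); auto. intros; symmetry; auto. }
    assert (HS : forall t x, V (t, x) -> Lop A B C (jet_of f t x) = 0 /\
      Dt f t x = h1 t x * f t x - g t x * Dx f t x + h0 t x).
    { intros t x Vt. apply frobenius_solution; [apply (HF t x (VU _ Vt))|].
      apply (near2_self (frobenius_ext _ _ _ _ _ _ _ _ _ _ (HE t x Vt)
        (frobenius_family_at U A B C g h1 h0 F c1 c2 t x HF (VU _ Vt)))). }
    split; [split|].
    + apply an2_analytic2. intros t x Vt.
      destruct (HF t x (VU _ Vt)) as [_ [_ [[? [? ?]] _]]].
      apply an2_ext_near with (2 := HE t x Vt). now apply an2_family_at.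
    + intros t x Vt; now apply HS.
    + intros t x Vt. rewrite characteristic_jet_of, (proj2 (HS t x Vt)).
      destruct (HQ t x (f t x) (VU _ Vt) (If t x Vt)) as [_ [X1 X2]].
      rewrite X1, X2. ring.
Qed.

Lemma reduction_operator_family (A B C : R -> R -> R) (Omega : R * R -> Prop)
  (D : R * R * R -> Prop) (Q : operator) (t0 x0 u0 : R) :
  analytic2 Omega A -> analytic2 Omega B -> analytic2 Omega C ->
  (forall t x, Omega (t, x) -> A t x <> 0) ->
  region D -> subset D (cylinder Omega (fun _ => True)) ->
  reduction_operator A B C D Q -> D (t0, x0, u0) -> tau Q t0 x0 u0 <> 0 ->
  exists (U : R * R -> Prop) (I : R -> Prop) (F : lin_family),
    region U /\ region I /\ U (t0, x0) /\ I u0 /\ subset (cylinder U I) D /\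
    nonvanishing (cylinder U I) (tau Q) /\
    two_parametric_solution_family A B C U F /\ corresponds A B C U I Q F.
Proof.
  intros HA HB HC A0 [OD _] DO [Ht [Hx [He [_ HR]]]] Dp T0.
  rewrite an2_analytic2 in HA, HB, HC.
  assert (N : near t0 x0 u0 (fun t x u => D (t, x, u) /\ tau Q t x u <> 0)).
  { apply near_and; [now apply open_near|].
    apply an_near_neq0; [now apply an_of_analytic3 with D|easy]. }
  set (g := fun t x u => xi Q t x u / tau Q t x u).
  set (h := fun t x u => eta Q t x u / tau Q t x u).
  assert (Pt : forall t x u, D (t, x, u) -> tau Q t x u <> 0 ->
    an (tau Q) t x u /\ an g t x u /\ an h t x u /\
    (an2 A t x /\ an2 B t x /\ an2 C t x) /\ A t x <> 0 /\
    invariance_condition A B C Q t x u).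
  { intros t x u Dt T. pose proof (proj1 (DO _ Dt)) as Om; simpl in Om.
    pose proof (an_of_analytic3 _ _ _ _ _ Ht Dt) as At.
    split; [easy|]. split; [apply an_div; auto; now apply an_of_analytic3 with D|].
    split; [apply an_div; auto; now apply an_of_analytic3 with D|].
    split; [auto|]. split; [now apply A0|].
    intros ut ux utt utx uxx j. apply (HR j Dt). }
  destruct (coefficients_linear A B C g h t0 x0 u0) as [G [h1 [h0 [AG [Eg Eh]]]]].
  { apply near_imp with (2 := near_near N). clear N. intros t x u N.
    destruct (near_self N) as [Dt T].
    destruct (Pt t x u Dt T) as [At [Ag [Ah [AA [A0' Inv]]]]].
    repeat (split; [easy|]).
    apply (invariance_condition_iff A B C Q g h t x u); auto; try tauto.
    - apply near_imp with (2 := N). intros t' x' u' [_ T']. unfold g. now field.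
    - apply near_imp with (2 := N). intros t' x' u' [_ T']. unfold h. now field. }
  (* The normal form must hold near every point of the box: the invariance condition there involves
     derivatives of the coefficients. *)
  destruct (near_near (near_and (near_lift _ _ u0 _ AG)
    (near_and N (near_and Eg Eh)))) as [d [d0 Hd]].
  assert (Hu0 : Rabs (u0 - u0) < d) by now apply Rabs_diag_lt.
  assert (Hbox : forall t x, box t0 x0 d (t, x) ->
    (an2 A t x /\ an2 B t x /\ an2 C t x /\ A t x <> 0) /\
    (an2 G t x /\ an2 h1 t x /\ an2 h0 t x) /\
    compatible (alpha A B G) (beta A C h1) (gamma A h0) G h1 h0 t x).
  { intros t x [Bt Bx]; simpl in Bt, Bx.
    destruct (near_self (Hd t x u0 Bt Bx Hu0)) as [HG [[Dt' T'] _]].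
    destruct (Pt t x u0 Dt' T') as [_ [_ [_ [[AA [AB AC]] [A0' _]]]]].
    split; [tauto|split]; [tauto|].
    set (al := alpha A B G). set (be := beta A C h1). set (ga := gamma A h0).
    assert (Z : forall u p, Rabs (u - u0) < d ->
      obstruction_yx al G h1 t x * p +
      obstruction_y al be G h1 t x * u +
      obstruction_1 al be ga G h1 h0 t x = 0).
    { intros u p Hu. pose proof (Hd t x u Bt Bx Hu) as Nu.
      destruct (near_self Nu) as [_ [[Du Tu] _]].
      destruct (Pt t x u Du Tu) as [At [_ [_ [_ [_ Inv]]]]].
      apply Rmult_eq_reg_l with (A t x); [|easy]. rewrite Rmult_0_r.
      unfold al, be, ga. rewrite <- invariance_defect_linear by tauto.
      revert p. apply (invariance_condition_iff A B C Q); auto.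
      - now apply an2_lift.
      - now apply an_linear.
      - apply near_imp with (2 := Nu). intros t1 x1 u1 [_ [[_ T1] [E _]]].
        rewrite <- E. unfold g. now field.
      - apply near_imp with (2 := Nu). intros t1 x1 u1 [_ [[_ T1] [_ E]]].
        rewrite <- E. unfold h. now field. }
    (* An affine function of [u] and [p] vanishing at three points that are not collinear is
       zero. *)
    pose proof (Z u0 0 Hu0) as Z1. pose proof (Z u0 1 Hu0) as Z2.
    assert (Hu1 : Rabs (u0 + d / 2 - u0) < d).
    { replace (u0 + d / 2 - u0) with (d / 2) by ring. rewrite Rabs_pos_eq; lra. }
    pose proof (Z _ 0 Hu1) as Z3. clear Z. unfold compatible.
    match type of Z1 with ?kq * 0 + ?ky * u0 + ?k0 = 0 =>
      set (Kq := kq) in *; set (Ky := ky) in *; set (K0 := k0) in * end.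
    assert (Ky0 : Ky = 0) by (apply Rmult_eq_reg_r with (d / 2); lra).
    rewrite Ky0 in *. repeat split; lra. }
  assert (Hc : box t0 x0 d (t0, x0)) by now apply box_center.
  pose proof (proj1 (region_box t0 x0 d d0)) as Ob.
  assert (Han : forall t x, box t0 x0 d (t, x) ->
    an2 (alpha A B G) t x /\ an2 (beta A C h1) t x /\ an2 (gamma A h0) t x).
  { intros t x Bp. destruct (Hbox t x Bp) as [[AA [AB [AC A0']]] [[HG [H1 H0]] _]].
    now apply an2_coefficients. }
  destruct (frobenius_basis (alpha A B G) (beta A C h1) (gamma A h0) G h1 h0 t0 x0)
    as [w1 [w2 [w3 [_ [_ [_ HF]]]]]]; try apply (Han _ _ Hc); try apply (Hbox _ _ Hc).
  { apply (near2_all (box t0 x0 d)); auto. intros; now apply Hbox. }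
  destruct (near2_box _ _ _ (near2_near HF)) as [e [e0 He0]].
  (* On the box of radius [d] the system is linear and compatible; on that of radius [e] the basis
     solves it. *)
  set (m := Rmin d e). pose proof (Rmin_l d e) as md. pose proof (Rmin_r d e) as me.
  assert (m0 : 0 < m) by now apply Rmin_pos.
  assert (Bd : forall t x, box t0 x0 m (t, x) -> box t0 x0 d (t, x) /\ box t0 x0 e (t, x)).
  { intros t x [B1 B2]; simpl in *. split; split; simpl; unfold m in *; lra. }
  assert (FF : frobenius_family (box t0 x0 m) A B C G h1 h0 (Family w1 w2 w3)).
  { intros t x Bm. destruct (Bd t x Bm) as [Bp Be].
    destruct (Hbox t x Bp) as [[AA [AB [AC A0']]] [HG Cp]].
    destruct (Han t x Bp) as [Hal [Hbe Hga]].
    pose proof (He0 t x Be) as NF. simpl.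
    assert (F1 := near2_imp _ _ _ _ (fun t x H => proj1 H) NF).
    assert (F2 := near2_imp _ _ _ _ (fun t x H => proj1 (proj2 H)) NF).
    assert (F3 := near2_imp _ _ _ _ (fun t x H => proj1 (proj2 (proj2 H))) NF).
    assert (NC : near2 t x (compatible (alpha A B G) (beta A C h1) (gamma A h0) G h1 h0))
      by (apply (near2_all (box t0 x0 d)); auto; intros; now apply Hbox).
    pose proof (near2_imp _ _ _ _ (compatible_homogeneous _ _ _ _ _ _) NC) as NC0.
    split; [easy|split]; [easy|split]; [split; [|split]|].
    - apply (frobenius_an2 _ _ _ _ _ _ _ _ _ Hal Hbe (an2_const 0 t x)
        (proj1 HG) (proj1 (proj2 HG)) (an2_const 0 t x) NC0 F1).
    - apply (frobenius_an2 _ _ _ _ _ _ _ _ _ Hal Hbe (an2_const 0 t x)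
        (proj1 HG) (proj1 (proj2 HG)) (an2_const 0 t x) NC0 F2).
    - apply (frobenius_an2 _ _ _ _ _ _ _ _ _ Hal Hbe Hga
        (proj1 HG) (proj1 (proj2 HG)) (proj2 (proj2 HG)) NC F3).
    - repeat (split; [easy|]). apply (near2_self NF). }
  assert (HI : forall t x u, box t0 x0 m (t, x) -> Rabs (u - u0) < d ->
    D (t, x, u) /\ tau Q t x u <> 0 /\ g t x u = G t x /\ h t x u = h1 t x * u + h0 t x).
  { intros t x u Bm Hu. destruct (Bd t x Bm) as [[B1 B2] _]; simpl in *.
    destruct (near_self (Hd t x u B1 B2 Hu)) as [_ [[? ?] [? ?]]]. tauto. }
  exists (box t0 x0 m), (fun u => Rabs (u - u0) < d), (Family w1 w2 w3).
  split; [now apply region_box|split]; [now apply region_interval|].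
  split; [now apply box_center|split]; [easy|].
  split; [intros [[t x] u] [B1 B2]; now apply HI|].
  split; [intros t x u [B1 B2]; now apply HI|].
  split; [apply frobenius_family_two_parametric with G h1 h0; [now apply region_box|easy]|].
  apply frobenius_family_corresponds with (1 := FF).
  intros t x u B1 B2. destruct (HI t x u B1 B2) as [_ [T [E1 E2]]].
  split; [easy|]. rewrite <- E1, <- E2. unfold g, h. split; now field.
Qed.

(** * From families to operators *)

Lemma Lop_minus A B C f g t x : an2 f t x -> an2 g t x ->
  Lop A B C (jet_of (fun t x => f t x - g t x) t x)
  = Lop A B C (jet_of f t x) - Lop A B C (jet_of g t x).
Proof.
  intros Hf Hg. rewrite !Lop_jet_of.
  pose proof (an2_is_derive_t Hf). pose proof (an2_is_derive_t Hg).
  pose proof (an2_is_derive_x Hf). pose proof (an2_is_derive_x Hg).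
  pose proof (an2_is_derive_x (an2_Dx Hf)).
  pose proof (an2_is_derive_x (an2_Dx Hg)).
  assert (E1 : Dt (fun t x => f t x - g t x) t x = Dt f t x - Dt g t x)
    by (apply is_derive_unique; der).
  assert (N : near2 t x (fun t x => Dx (fun t x => f t x - g t x) t x = Dx f t x - Dx g t x)).
  { apply near2_imp with (2 := near2_and (an2_near_derive_x Hf)
      (an2_near_derive_x Hg)). intros t' x' [? ?]. apply is_derive_unique; der. }
  assert (E2 : Dx (Dx (fun t x => f t x - g t x)) t x = Dx (Dx f) t x - Dx (Dx g) t x).
  { rewrite (near2_self (Dx_near N)). apply is_derive_unique; der. }
  rewrite E1, E2, (near2_self N). ring.
Qed.

(** The hypothesis speaks of members only: [v3] is the member with parameters 0, 0, while [v1] and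
    [v2] are differences of members. *)
Lemma family_components A B C U F t x :
  two_parametric_solution_family A B C U F -> U (t, x) ->
  (an2 (v1 F) t x /\ an2 (v2 F) t x /\ an2 (v3 F) t x) /\
  Lop A B C (jet_of (v1 F) t x) = 0 /\ Lop A B C (jet_of (v2 F) t x) = 0 /\
  Lop A B C (jet_of (v3 F) t x) = 0.
Proof.
  intros [HS _] Ut.
  assert (S : forall c1 c2, an2 (family_at F c1 c2) t x /\
    Lop A B C (jet_of (family_at F c1 c2) t x) = 0).
  { intros c1 c2; destruct (HS c1 c2) as [HA HL]. rewrite an2_analytic2 in HA. auto. }
  assert (E3 : v3 F = family_at F 0 0)
    by (extensionality a; extensionality b; unfold family_at; ring).
  assert (E1 : v1 F = fun t x => family_at F 1 0 t x - family_at F 0 0 t x)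
    by (extensionality a; extensionality b; unfold family_at; ring).
  assert (E2 : v2 F = fun t x => family_at F 0 1 t x - family_at F 0 0 t x)
    by (extensionality a; extensionality b; unfold family_at; ring).
  destruct (S 0 0) as [A0 L0], (S 1 0) as [A1 L1], (S 0 1) as [A2 L2].
  rewrite E1, E2, E3. rewrite !Lop_minus by easy. rewrite L0, L1, L2.
  split; [split; [|split]|]; [now apply an2_minus|now apply an2_minus|easy|].
  split; [|split]; ring.
Qed.

(* If the Wronskian vanished on [V], then [v2 / v1] would have zero
   x-derivative, hence by the equation also zero t-derivative. *)
Lemma wronskian_nonzero A B C U V F : region U -> region V -> subset V U ->
  two_parametric_solution_family A B C U F ->
  exists t x, V (t, x) /\ wronskian (v1 F) (v2 F) t x <> 0.
Proof.
  intros HU HV VU HF. pose proof HV as [OV [_ [[tv xv] Vv]]].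
  pose proof (fun t x Ut => family_components A B C U F t x HF Ut) as HC.
  (* Linear independence is assumed on all of [U]; the identity theorem brings it down to every open
     subset. *)
  assert (Id : forall c1 c2,
    (exists t x, U (t, x) /\ near2 t x (fun t x => c1 * v1 F t x + c2 * v2 F t x = 0)) ->
    c1 = 0 /\ c2 = 0).
  { intros c1 c2 Hex. apply (proj2 HF).
    apply (identity_theorem U (fun t x => c1 * v1 F t x + c2 * v2 F t x) HU); [|easy].
    apply an2_analytic2. intros t x Ut. destruct (HC t x Ut) as [[? [? _]] _].
    now apply an2_lincomb. }
  apply NNPP; intros NW.
  assert (W0 : forall t x, V (t, x) -> wronskian (v1 F) (v2 F) t x = 0).
  { intros t x Vt. apply NNPP; intros N. apply NW; eauto. }
  assert (Ex : exists t x, V (t, x) /\ v1 F t x <> 0).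
  { apply NNPP; intros N. destruct (Id 1 0) as [C1 _]; [|lra].
    exists tv, xv; split; [now apply VU|]. apply (near2_all V); auto.
    intros t x Vt. replace (v1 F t x) with 0; [ring|].
    apply NNPP; intros N'. apply N; exists t, x; split; [easy|]. intros E; now apply N'. }
  destruct Ex as [t1 [x1 [V1 P1]]].
  destruct (HC t1 x1 (VU _ V1)) as [[A1 _] _].
  destruct (near2_box _ _ _ (near2_and (open_near2 V t1 x1 OV V1)
    (an2_near_neq0 _ _ _ A1 P1))) as [d [d0 Hd]].
  destruct (zero_gradient_constant (box t1 x1 d) (fun t x => v2 F t x / v1 F t x))
    as [k Hk]; [now apply region_box| |].
  { intros t x Bp. destruct (Hd t x Bp) as [Vt P].
    destruct (HC t x (VU _ Vt)) as [[Av1 [Av2 _]] [L1 [L2 _]]].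
    pose proof (W0 t x Vt) as W. unfold wronskian in W.
    pose proof (an2_is_derive_t Av1). pose proof (an2_is_derive_t Av2).
    pose proof (an2_is_derive_x Av1). pose proof (an2_is_derive_x Av2).
    pose proof (an2_is_derive_x (an2_Dx Av1)).
    pose proof (an2_is_derive_x (an2_Dx Av2)).
    assert (Wx : v1 F t x * Dx (Dx (v2 F)) t x - v2 F t x * Dx (Dx (v1 F)) t x = 0).
    { transitivity (Dx (wronskian (v1 F) (v2 F)) t x).
      - symmetry. unfold wronskian; derive_ring.
      - rewrite (near2_self (@Dx_near _ (fun _ _ => 0) _ _ (near2_all V _ t x OV Vt W0))).
        apply (Derive_const 0). }
    rewrite Lop_jet_of in L1, L2.
    assert (Wt : v1 F t x * Dt (v2 F) t x - v2 F t x * Dt (v1 F) t x = 0).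
    { replace (Dt (v2 F) t x) with (A t x * Dx (Dx (v2 F)) t x + B t x * Dx (v2 F) t x
        + C t x * v2 F t x) by lra.
      replace (Dt (v1 F) t x) with (A t x * Dx (Dx (v1 F)) t x + B t x * Dx (v1 F) t x
        + C t x * v1 F t x) by lra.
      transitivity (A t x * (v1 F t x * Dx (Dx (v2 F)) t x - v2 F t x * Dx (Dx (v1 F)) t x)
        + B t x * (v1 F t x * Dx (v2 F) t x - v2 F t x * Dx (v1 F) t x)); [ring|].
      rewrite Wx, W; ring. }
    split; (eapply is_derive_eq; [der|]).
    - transitivity ((v1 F t x * Dt (v2 F) t x - v2 F t x * Dt (v1 F) t x) / v1 F t x ^ 2);
        [now field|rewrite Wt; now field].
    - transitivity ((v1 F t x * Dx (v2 F) t x - v2 F t x * Dx (v1 F) t x) / v1 F t x ^ 2);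
        [now field|rewrite W; now field]. }
  destruct (Id k (-1)) as [_ K]; [|lra].
  exists t1, x1; split; [now apply VU|]. exists d; split; [easy|]. intros t x Ht Hx.
  destruct (Hd t x (conj Ht Hx)) as [_ P]. rewrite <- (Hk t x (conj Ht Hx)). now field.
Qed.

Lemma family_reduction_operator (A B C : R -> R -> R) (Omega U V : R * R -> Prop)
  (F : lin_family) :
  analytic2 Omega A -> analytic2 Omega B -> analytic2 Omega C ->
  (forall t x, Omega (t, x) -> A t x <> 0) ->
  region U -> subset U Omega -> two_parametric_solution_family A B C U F ->
  region V -> subset V U ->
  exists (W : R * R -> Prop) (Q : operator),
    region W /\ subset W V /\
    reduction_operator A B C (cylinder W (fun _ => True)) Q /\
    nonvanishing (cylinder W (fun _ => True)) (tau Q) /\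
    two_parametric_solution_family A B C W F /\
    corresponds A B C W (fun _ => True) Q F.
Proof.
  intros HA HB HC A0 HU UO HF HV VU.
  rewrite an2_analytic2 in HA, HB, HC.
  destruct (wronskian_nonzero A B C U V F HU HV VU HF) as [t0 [x0 [V0 W0]]].
  pose proof (fun t x Vt => family_components A B C U F t x HF (VU (t, x) Vt)) as HFc.
  destruct (HFc t0 x0 V0) as [[B1 [B2 _]] _].
  destruct (near2_box _ _ _ (near2_and (open_near2 V t0 x0 (proj1 HV) V0)
    (an2_near_neq0 _ _ _ (an2_wronskian _ _ _ _ B1 B2) W0))) as [d [d0 Hd]].
  set (W := box t0 x0 d) in *. clear W0 B1 B2.
  assert (RW : region W) by now apply region_box.
  pose proof (proj1 RW) as OW.
  set (w := wronskian (v1 F) (v2 F)) in *.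
  (* Cramer's rule for [v_t + g v_x = h1 v] with [v = v1] and [v = v2]; [h0] is then the value
     forced by [v3]. *)
  set (g := fun t x => - (v1 F t x * Dt (v2 F) t x - v2 F t x * Dt (v1 F) t x) / w t x).
  set (h1 := fun t x =>
    (Dt (v1 F) t x * Dx (v2 F) t x - Dt (v2 F) t x * Dx (v1 F) t x) / w t x).
  set (h0 := fun t x => Dt (v3 F) t x + g t x * Dx (v3 F) t x - h1 t x * v3 F t x).
  assert (Pt : forall t x, W (t, x) -> w t x <> 0 /\ A t x <> 0 /\
    (an2 A t x /\ an2 B t x /\ an2 C t x) /\
    (an2 g t x /\ an2 h1 t x /\ an2 h0 t x) /\
    (an2 (v1 F) t x /\ an2 (v2 F) t x /\ an2 (v3 F) t x)).
  { intros t x Wt. destruct (Hd t x Wt) as [Vt Nw].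
    pose proof (UO _ (VU _ Vt)) as Ot.
    destruct (HFc t x Vt) as [[A1 [A2 A3]] _].
    assert (Aw : an2 w t x) by now apply an2_wronskian.
    assert (Ag : an2 g t x).
    { apply (an2_div (fun t x => - (v1 F t x * Dt (v2 F) t x - v2 F t x * Dt (v1 F) t x))); auto.
      apply (an2_opp (fun t x => v1 F t x * Dt (v2 F) t x - v2 F t x * Dt (v1 F) t x)).
      apply an2_minus; apply an2_mult; auto using an2_Dt. }
    assert (Ah : an2 h1 t x).
    { apply (an2_div (fun t x =>
        Dt (v1 F) t x * Dx (v2 F) t x - Dt (v2 F) t x * Dx (v1 F) t x)); auto.
      apply an2_minus; apply an2_mult; auto using an2_Dt, an2_Dx. }
    repeat (split; [solve [auto]|]). split; [split; [easy|split]; [easy|]|easy].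
    apply (an2_minus (fun t x => Dt (v3 F) t x + g t x * Dx (v3 F) t x));
      [|now apply an2_mult].
    apply an2_plus; [now apply an2_Dt|]. apply an2_mult; auto using an2_Dx. }
  assert (E1 : forall t x, W (t, x) ->
    Dt (v1 F) t x = h1 t x * v1 F t x - g t x * Dx (v1 F) t x + zero2 t x).
  { intros t x Wt. destruct (Pt t x Wt) as [Nw _]. unfold h1, g, zero2.
    unfold w, wronskian in *. now field. }
  assert (E2 : forall t x, W (t, x) ->
    Dt (v2 F) t x = h1 t x * v2 F t x - g t x * Dx (v2 F) t x + zero2 t x).
  { intros t x Wt. destruct (Pt t x Wt) as [Nw _]. unfold h1, g, zero2.
    unfold w, wronskian in *. now field. }
  assert (E3 : forall t x, W (t, x) ->
    Dt (v3 F) t x = h1 t x * v3 F t x - g t x * Dx (v3 F) t x + h0 t x).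
  { intros. unfold h0. ring. }
  set (al := alpha A B g) in *. set (be := beta A C h1) in *. set (ga := gamma A h0) in *.
  assert (WV : forall t x, W (t, x) -> V (t, x)) by (intros t x Wt; now apply Hd).
  assert (FF : frobenius_family W A B C g h1 h0 F).
  { intros t x Wt. destruct (Pt t x Wt) as [Nw [A0' [_ [Hg Hv]]]].
    assert (AW : forall t x, W (t, x) -> A t x <> 0) by (intros; now apply Pt).
    split; [easy|split]; [easy|split]; [easy|].
    assert (S0 := fun y => solution_frobenius W A B C g h1 zero2 y t x).
    rewrite gamma_zero2 in S0.
    split; [|split; [|split]]; [| | |easy].
    - apply S0; auto; try tauto; [|apply an2_const].
      intros t' x' Wt'; split; [now apply HFc, WV|now apply E1].
    - apply S0; auto; try tauto; [|apply an2_const].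
      intros t' x' Wt'; split; [now apply HFc, WV|now apply E2].
    - apply (solution_frobenius W); auto; try tauto.
      intros t' x' Wt'; split; [now apply HFc, WV|now apply E3]. }
  (* A genuine solution has zero defect nearby, so in [near2_defect] only the source term remains,
     and it must vanish. *)
  assert (Def : forall t x c y, W (t, x) -> an2 al t x -> an2 be t x -> an2 c t x ->
    forall k, an2 k t x -> an2 y t x ->
    near2 t x (frobenius al be c g h1 k y) ->
    obstruction_yx al g h1 t x * Dx y t x +
    obstruction_y al be g h1 t x * y t x +
    obstruction_1 al be c g h1 k t x = 0).
  { intros t x c y Wt Hal Hbe Hcc k Hk Hy Fy.
    destruct (Pt t x Wt) as [_ [_ [_ [[Hg [H1 _]] _]]]].
    assert (Ey : near2 t x (fun t x =>
      Dx (Dx y) t x = al t x * Dx y t x + be t x * y t x + c t x)).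
    { apply near2_imp with (2 := Fy). intros t' x' [_ [_ [_ Y]]].
      now apply is_derive_unique in Y. }
    pose proof (near2_self (near2_defect al be c g h1 k y t x Hal Hbe Hcc Hg H1 Hk Hy Ey))
      as N. cbv beta zeta in N.
    set (z := fun t x => Dt y t x - (h1 t x * y t x - g t x * Dx y t x + k t x)) in *.
    assert (Z : near2 t x (fun t x => z t x = zero2 t x)).
    { apply near2_imp with (2 := Fy). intros t' x' [Y _].
      assert (E : Dt y t' x' = h1 t' x' * y t' x' - g t' x' * Dx y t' x' + k t' x')
        by (apply is_derive_unique, Y).
      unfold z, zero2. rewrite E. ring. }
    change (Dt y t x - (h1 t x * y t x - g t x * Dx y t x + k t x)) with (z t x) in N.
    rewrite (near2_self Z), (near2_self (Dx_near Z)),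
      (near2_self (Dx_near (Dx_near Z))) in N.
    assert (E : Dx (Dx zero2) t x = 0).
    { unfold Dx at 1. rewrite (Derive_ext _ (fun _ => 0)); [apply Derive_const|].
      intros; apply Dx_zero2. }
    rewrite E, Dx_zero2 in N. unfold zero2 in N. lra. }
  assert (Cp : forall t x, W (t, x) -> compatible al be ga g h1 h0 t x).
  { intros t x Wt. destruct (Pt t x Wt)
      as [Nw [A0' [[AA [AB AC]] [[Hg [H1 H0]] [A1 [A2 A3]]]]]].
    destruct (FF t x Wt) as [_ [_ [_ [F1 [F2 [F3 _]]]]]].
    destruct (an2_coefficients A B C g h1 h0 t x) as [Hal [Hbe Hga]]; auto.
    pose proof (Def t x zero2 _ Wt Hal Hbe (an2_const 0 t x) zero2 (an2_const 0 t x) A1 F1) as R1.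
    pose proof (Def t x zero2 _ Wt Hal Hbe (an2_const 0 t x) zero2 (an2_const 0 t x) A2 F2) as R2.
    pose proof (Def t x ga _ Wt Hal Hbe Hga h0 H0 A3 F3) as R3.
    rewrite obstruction_1_zero2 in R1, R2. unfold compatible.
    match type of R3 with ?kq * _ + ?ky * _ + ?k0 = 0 =>
      set (Kq := kq) in *; set (Ky := ky) in *; set (K0 := k0) in * end.
    (* [v1] and [v2] give two homogeneous linear equations for [Kq] and [Ky] whose determinant is
       the Wronskian up to sign; [v3] then gives [K0]. *)
    assert (Kq0 : Kq = 0).
    { apply Rmult_eq_reg_r with (w t x); [|easy]. unfold w, wronskian.
      transitivity (v1 F t x * (Kq * Dx (v2 F) t x + Ky * v2 F t x)
        - v2 F t x * (Kq * Dx (v1 F) t x + Ky * v1 F t x)); [ring|].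
      replace (Kq * Dx (v2 F) t x + Ky * v2 F t x) with 0 by lra.
      replace (Kq * Dx (v1 F) t x + Ky * v1 F t x) with 0 by lra. ring. }
    assert (Ky0 : Ky = 0).
    { apply Rmult_eq_reg_r with (w t x); [|easy]. unfold w, wronskian.
      transitivity (Dx (v2 F) t x * (Kq * Dx (v1 F) t x + Ky * v1 F t x)
        - Dx (v1 F) t x * (Kq * Dx (v2 F) t x + Ky * v2 F t x)); [ring|].
      replace (Kq * Dx (v2 F) t x + Ky * v2 F t x) with 0 by lra.
      replace (Kq * Dx (v1 F) t x + Ky * v1 F t x) with 0 by lra. ring. }
    rewrite Kq0, Ky0 in R3. repeat split; try easy. lra. }
  set (Q := Operator (fun _ _ _ => 1) (fun t x _ => g t x) (fun t x u => h1 t x * u + h0 t x)).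
  assert (AQ : forall t x u, W (t, x) -> an (fun t x _ => g t x) t x u /\
    an (fun t x u => h1 t x * u + h0 t x) t x u).
  { intros t x u Wt. destruct (Pt t x Wt) as [_ [_ [_ [[Hg [H1 H0]] _]]]].
    split; [now apply an2_lift|now apply an_linear]. }
  exists W, Q. split; [easy|split]; [intros [t x]; apply WV|split; [|split]].
  - split; [|split; [|split; [|split]]].
    + apply analytic3_of_an. intros t x u _. exact (an_const 1 t x u).
    + apply analytic3_of_an. intros t x u [Wt _]. exact (proj1 (AQ t x u Wt)).
    + apply analytic3_of_an. intros t x u [Wt _]. exact (proj2 (AQ t x u Wt)).
    + exists t0, x0, 0. split; [split; [now apply box_center|easy]|]. left; simpl; lra.
    + intros [t x u ut ux utt utx uxx] [Wt _]. simpl in Wt.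
      destruct (Pt t x Wt) as [_ [A0' [[AA [AB AC]] [[Hg [H1 H0]] _]]]].
      destruct (AQ t x u Wt) as [AQg AQh].
      revert ut ux utt utx uxx. change (invariance_condition A B C Q t x u).
      apply (invariance_condition_iff A B C Q _ _ t x u AA AB AC A0' (an_const 1 t x u) AQg AQh).
      * simpl; lra.
      * exists 1; split; [lra|]. intros; simpl; ring.
      * exists 1; split; [lra|]. intros; simpl; ring.
      * intros p. rewrite invariance_defect_linear by easy.
        destruct (Cp t x Wt) as [C1 [C2 C3]]. unfold al, be, ga in *.
        rewrite C1, C2, C3. ring.
  - intros t x u _; simpl; lra.
  - split; [now apply frobenius_family_two_parametric with g h1 h0|].
    apply frobenius_family_corresponds with (1 := FF).
    intros t x u _ _; simpl. split; [lra|split; ring].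
Qed.

(** * Equivalence *)

Lemma region_subset_interval (I : R -> Prop) u : region I -> I u ->
  exists e, 0 < e /\ forall v, Rabs (v - u) < e -> I v.
Proof.
  intros [OI _] Iu. destruct (OI u Iu) as [[e e0] He].
  exists e; split; [easy|]. intros v Hv; now apply He.
Qed.

(* Members of [F] with values in [I] near a point have parameters filling an
   open set, and their differences span the homogeneous part of [F]. *)
Lemma corresponding_family_member A B C U I Q Q' F F' : region U -> region I ->
  two_parametric_solution_family A B C U F ->
  two_parametric_solution_family A B C U F' ->
  corresponds A B C U I Q F -> corresponds A B C U I Q' F' ->
  (forall V f, subset V U -> values_in V I f -> invariant V Q f -> invariant V Q' f) ->
  forall f, member U F f -> member U F' f.
Proof.
  intros HU HI HF HF' HQ HQ' Inv f [c1 [c2 Ef]].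
  pose proof (fun t x Ut => family_components A B C U F t x HF Ut) as HC.
  pose proof HI as [_ [_ [u Iu]]].
  destruct (region_subset_interval I u HI Iu) as [e [e0 He]].
  destruct (wronskian_nonzero A B C U U F HU HU (fun p H => H) HF) as [t0 [x0 [U0 W0]]].
  (* A nonzero Wronskian excludes [v1 = v2 = 0] at the base point, so some member takes the value
     [u] there. *)
  assert (Ex : exists a1 a2, family_at F a1 a2 t0 x0 = u).
  { unfold family_at. destruct (Req_dec (v1 F t0 x0) 0) as [Z1|N1].
    - destruct (Req_dec (v2 F t0 x0) 0) as [Z2|N2].
      + exfalso; apply W0. unfold wronskian. rewrite Z1, Z2. ring.
      + exists 0, ((u - v3 F t0 x0) / v2 F t0 x0). now field.
    - exists ((u - v3 F t0 x0) / v1 F t0 x0), 0. now field. }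
  destruct Ex as [a1 [a2 Ea]].
  destruct (HC t0 x0 U0) as [[A1 [A2 A3]] _].
  set (M := Rabs (v1 F t0 x0) + Rabs (v2 F t0 x0) + 1).
  pose proof (Rabs_pos (v1 F t0 x0)). pose proof (Rabs_pos (v2 F t0 x0)).
  assert (M0 : 0 < M) by (unfold M; lra).
  (* On [V] both [v1] and [v2] stay below [M] in absolute value, so shifting one parameter by [s]
     changes a member by less than [e / 2]; the other half pays for the variation of the base member
     over [V]. *)
  set (s := e / (2 * M)). assert (s0 : 0 < s) by (apply Rdiv_lt_0_compat; lra).
  assert (sM : s * M = e / 2) by (unfold s; field; lra).
  destruct (near2_box _ _ _ (near2_and (open_near2 U t0 x0 (proj1 HU) U0)
    (near2_and (an2_continuous _ _ _ (e / 2) (an2_family_at F a1 a2 t0 x0 A1 A2 A3)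
      ltac:(lra))
    (near2_and (an2_continuous _ _ _ 1 A1 ltac:(lra))
      (an2_continuous _ _ _ 1 A2 ltac:(lra)))))) as [d [d0 Hd]].
  set (V := box t0 x0 d) in *.
  assert (RV : region V) by now apply region_box.
  assert (VU : subset V U) by (intros [t x] Vp; now apply Hd).
  assert (Mem : forall b1 b2, (forall t x, V (t, x) ->
      Rabs (family_at F (a1 + b1) (a2 + b2) t x - family_at F a1 a2 t x) < e / 2) ->
    member V F' (family_at F (a1 + b1) (a2 + b2))).
  { intros b1 b2 Hb.
    assert (Hv : values_in V I (family_at F (a1 + b1) (a2 + b2))).
    { intros t x Vt. apply He. destruct (Hd t x Vt) as [_ [C0 _]]. rewrite Ea in C0.
      replace (family_at F (a1 + b1) (a2 + b2) t x - u)
        with ((family_at F (a1 + b1) (a2 + b2) t x - family_at F a1 a2 t x)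
          + (family_at F a1 a2 t x - u)) by ring.
      eapply Rle_lt_trans; [apply Rabs_triang|]. specialize (Hb t x Vt). lra. }
    apply HQ'; auto.
    assert (Hm : member V F (family_at F (a1 + b1) (a2 + b2))) by (eexists; eexists; reflexivity).
    apply (HQ V RV VU _ Hv) in Hm. destruct Hm as [Sm Im]. split; [easy|]. now apply Inv. }
  assert (Small : forall w t x, Rabs (w t x - w t0 x0) < 1 -> Rabs (w t0 x0) + 1 <= M ->
    Rabs (s * w t x) < e / 2).
  { intros w t x H1 H2. rewrite Rabs_mult, (Rabs_pos_eq s), <- sM by lra.
    apply Rmult_lt_compat_l; [easy|]. apply Rlt_le_trans with (2 := H2).
    replace (w t x) with ((w t x - w t0 x0) + w t0 x0) at 1 by ring.
    eapply Rle_lt_trans; [apply Rabs_triang|lra]. }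
  destruct (Mem 0 0) as [p1 [p2 P]].
  { intros t x _. rewrite !Rplus_0_r, Rminus_diag, Rabs_R0. lra. }
  destruct (Mem s 0) as [q1 [q2 P1]].
  { intros t x Vt. destruct (Hd t x Vt) as [_ [_ [C1 _]]].
    replace (family_at F (a1 + s) (a2 + 0) t x - family_at F a1 a2 t x)
      with (s * v1 F t x) by (unfold family_at; ring).
    apply (Small (v1 F)); [easy|unfold M; lra]. }
  destruct (Mem 0 s) as [r1 [r2 P2]].
  { intros t x Vt. destruct (Hd t x Vt) as [_ [_ [_ C2]]].
    replace (family_at F (a1 + 0) (a2 + s) t x - family_at F a1 a2 t x)
      with (s * v2 F t x) by (unfold family_at; ring).
    apply (Small (v2 F)); [easy|unfold M; lra]. }
  (* The member with parameters [c1], [c2] is an affine combination, with these weights, of the base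
     member and its two shifts. The same combination of their parameters in [F'] describes it on
     [V], and the identity theorem extends the equality to [U]. *)
  set (m1 := (c1 - a1) / s). set (m2 := (c2 - a2) / s).
  set (k1 := p1 + m1 * (q1 - p1) + m2 * (r1 - p1)).
  set (k2 := p2 + m1 * (q2 - p2) + m2 * (r2 - p2)).
  exists k1, k2. intros t x Ut. rewrite (Ef t x Ut).
  apply Rminus_diag_uniq.
  apply (identity_theorem U (fun t x => family_at F c1 c2 t x - family_at F' k1 k2 t x) HU);
    [| |easy].
  - apply an2_analytic2. intros t' x' Ut'.
    destruct (HC t' x' Ut') as [[B1 [B2 B3]] _].
    destruct (family_components A B C U F' t' x' HF' Ut') as [[B1' [B2' B3']] _].
    apply an2_minus; now apply an2_family_at.
  - exists t0, x0; split; [easy|]. exists d; split; [easy|]. intros t' x' Ht Hx.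
    assert (Vp : V (t', x')) by now split.
    pose proof (P t' x' Vp) as R0. pose proof (P1 t' x' Vp) as R1. pose proof (P2 t' x' Vp) as R2.
    replace (family_at F c1 c2 t' x') with
      (family_at F (a1 + 0) (a2 + 0) t' x'
       + m1 * (family_at F (a1 + s) (a2 + 0) t' x' - family_at F (a1 + 0) (a2 + 0) t' x')
       + m2 * (family_at F (a1 + 0) (a2 + s) t' x' - family_at F (a1 + 0) (a2 + 0) t' x')).
    + rewrite R0, R1, R2. unfold family_at, k1, k2. ring.
    + unfold family_at, m1, m2. field. lra.
Qed.

Lemma operator_equiv_sym D Q Q' : operator_equiv D Q Q' -> operator_equiv D Q' Q.
Proof.
  intros [l [Al [Nl El]]]. exists (fun t x u => / l t x u). split; [|split].
  - apply analytic3_of_an. intros t x u Dp. apply an_inv; [|now apply Nl].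
    now apply an_of_analytic3 with D.
  - intros t x u Dp. apply Rinv_neq_0_compat. now apply Nl.
  - intros t x u Dp. pose proof (Nl t x u Dp). destruct (El t x u Dp) as [-> [-> ->]].
    repeat split; now field.
Qed.

Lemma operator_equiv_invariant U I Q Q' V f : operator_equiv (cylinder U I) Q Q' ->
  subset V U -> values_in V I f -> invariant V Q f -> invariant V Q' f.
Proof.
  intros [l [_ [_ El]]] VU Vf Inv t x Vt.
  destruct (El t x (f t x)) as [E1 [E2 E3]]; [split; simpl; [now apply VU|now apply Vf]|].
  pose proof (Inv t x Vt) as H. rewrite characteristic_jet_of in *. rewrite E1, E2, E3.
  transitivity (l t x (f t x) * (eta Q t x (f t x) - tau Q t x (f t x) * Dt f t x
    - xi Q t x (f t x) * Dx f t x)); [ring|rewrite H; ring].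
Qed.

(* Two members through the same value with different slopes determine the
   ratios of the coefficients wherever the Wronskian does not vanish. *)
Lemma equivalent_families_proportional A B C U I Q Q' F F' t x u :
  region U -> region I ->
  two_parametric_solution_family A B C U F ->
  corresponds A B C U I Q F -> corresponds A B C U I Q' F' ->
  family_equiv U F F' -> U (t, x) -> I u -> wronskian (v1 F) (v2 F) t x <> 0 ->
  xi Q' t x u * tau Q t x u = tau Q' t x u * xi Q t x u /\
  eta Q' t x u * tau Q t x u = tau Q' t x u * eta Q t x u.
Proof.
  intros HU HI HF HQ HQ' HE Ut Iu W.
  destruct (family_components A B C U F t x HF Ut) as [[A1 [A2 A3]] _].
  destruct (region_subset_interval I u HI Iu) as [e [e0 He]].
  (* Cramer's rule yields the member with value [u] and slope [k] at the point. Its values stay in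
     [I] nearby, so it is invariant under both operators, and [a] is its t-derivative. *)
  assert (K : forall k, exists a,
    eta Q t x u - tau Q t x u * a - xi Q t x u * k = 0 /\
    eta Q' t x u - tau Q' t x u * a - xi Q' t x u * k = 0).
  { intros k.
    set (w := wronskian (v1 F) (v2 F) t x) in *.
    set (c1 := ((u - v3 F t x) * Dx (v2 F) t x - (k - Dx (v3 F) t x) * v2 F t x) / w).
    set (c2 := (v1 F t x * (k - Dx (v3 F) t x) - Dx (v1 F) t x * (u - v3 F t x)) / w).
    set (f := family_at F c1 c2).
    assert (Ef : f t x = u).
    { unfold f, family_at, c1, c2. unfold w, wronskian in *. now field. }
    assert (Ex : Dx f t x = k).
    { pose proof (an2_is_derive_x A1). pose proof (an2_is_derive_x A2).
      pose proof (an2_is_derive_x A3).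
      apply is_derive_unique. unfold f, family_at. eapply is_derive_eq; [der|].
      unfold c1, c2. unfold w, wronskian in *. now field. }
    assert (Af : an2 f t x) by now apply an2_family_at.
    destruct (near2_box _ _ _ (near2_and (open_near2 U t x (proj1 HU) Ut)
      (an2_continuous _ _ _ e Af e0))) as [d [d0 Hd]].
    set (V := box t x d) in *.
    assert (RV : region V) by now apply region_box.
    assert (VU : subset V U) by (intros [t' x'] Vp; now apply Hd).
    assert (Vf : values_in V I f).
    { intros t' x' Vp. apply He. rewrite <- Ef. now apply Hd. }
    assert (Vtx : V (t, x)) by now apply box_center.
    assert (Hm : member V F f) by (exists c1, c2; reflexivity).
    assert (Hm' : member V F' f).
    { destruct (proj1 (HE f)) as [b1 [b2 E]]; [now exists c1, c2|].
      exists b1, b2. intros t' x' Vp. apply E, (VU _ Vp). }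
    apply (HQ V RV VU f Vf) in Hm. apply (HQ' V RV VU f Vf) in Hm'.
    exists (Dt f t x).
    pose proof (proj2 Hm t x Vtx) as R1. pose proof (proj2 Hm' t x Vtx) as R2.
    rewrite characteristic_jet_of, Ef, Ex in R1, R2. easy. }
  destruct (K 0) as [a [P P']], (K 1) as [b [R R']].
  assert (E1 : eta Q t x u = tau Q t x u * a) by lra.
  assert (E2 : eta Q' t x u = tau Q' t x u * a) by lra.
  assert (E3 : xi Q t x u = tau Q t x u * a - tau Q t x u * b) by lra.
  assert (E4 : xi Q' t x u = tau Q' t x u * a - tau Q' t x u * b) by lra.
  rewrite E1, E2, E3, E4. split; ring.
Qed.

Lemma family_equiv_operator_equiv A B C U I Q Q' F F' :
  region U -> region I ->
  reduction_operator A B C (cylinder U I) Q ->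
  nonvanishing (cylinder U I) (tau Q) ->
  reduction_operator A B C (cylinder U I) Q' ->
  nonvanishing (cylinder U I) (tau Q') ->
  two_parametric_solution_family A B C U F ->
  corresponds A B C U I Q F -> corresponds A B C U I Q' F' ->
  family_equiv U F F' -> operator_equiv (cylinder U I) Q Q'.
Proof.
  intros HU HI [Ht [Hx [He _]]] NQ [Ht' [Hx' [He' _]]] NQ' HF HQ HQ' HE.
  (* The Wronskian may vanish at some points of [U], but not on a whole box; an identity valid where
     it is nonzero therefore extends to [U] by continuity. *)
  assert (Dense : forall (P : R -> R -> R) t x, U (t, x) ->
    (forall t x, U (t, x) -> an2 P t x) ->
    (forall t x, U (t, x) -> wronskian (v1 F) (v2 F) t x <> 0 -> P t x = 0) -> P t x = 0).
  { intros P t x Ut AP HP. apply NNPP; intros NP.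
    destruct (near2_box _ _ _ (near2_and (open_near2 U t x (proj1 HU) Ut)
      (an2_near_neq0 _ _ _ (AP t x Ut) NP))) as [d [d0 Hd]].
    destruct (wronskian_nonzero A B C U (box t x d) F HU) as [t' [x' [B' W']]]; auto.
    - now apply region_box.
    - intros [t' x'] Bp; now apply Hd.
    - destruct (Hd t' x' B') as [U' N']. apply N'. now apply HP. }
  assert (Slice : forall f t x u, analytic3 (cylinder U I) f -> U (t, x) -> I u ->
    an2 (fun t x => f t x u) t x).
  { intros f t x u Hf Ut Iu. apply an2_slice. now apply an_of_analytic3 with (cylinder U I). }
  assert (Prp : forall t x u, U (t, x) -> I u ->
    xi Q' t x u * tau Q t x u = tau Q' t x u * xi Q t x u /\
    eta Q' t x u * tau Q t x u = tau Q' t x u * eta Q t x u).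
  { intros t x u Ut Iu. split; apply Rminus_diag_uniq.
    - apply (Dense (fun t x => xi Q' t x u * tau Q t x u - tau Q' t x u * xi Q t x u)); auto.
      + intros; apply an2_minus; apply an2_mult; now apply Slice.
      + intros t' x' Ut' W. apply Rminus_diag_eq.
        now apply (equivalent_families_proportional A B C U I Q Q' F F').
    - apply (Dense (fun t x => eta Q' t x u * tau Q t x u - tau Q' t x u * eta Q t x u)); auto.
      + intros; apply an2_minus; apply an2_mult; now apply Slice.
      + intros t' x' Ut' W. apply Rminus_diag_eq.
        now apply (equivalent_families_proportional A B C U I Q Q' F F'). }
  exists (fun t x u => tau Q' t x u / tau Q t x u). split; [|split].
  - apply analytic3_of_an. intros t x u Dp.
    apply an_div; [| |now apply NQ]; now apply an_of_analytic3 with (cylinder U I).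
  - intros t x u Dp. apply Rmult_integral_contrapositive; split; [now apply NQ'|].
    now apply Rinv_neq_0_compat, NQ.
  - intros t x u Dp. destruct (Prp t x u (proj1 Dp) (proj2 Dp)) as [E1 E2].
    pose proof (NQ t x u Dp) as T. split; [now field|split].
    + apply Rmult_eq_reg_r with (tau Q t x u); [|easy]. rewrite E1. now field.
    + apply Rmult_eq_reg_r with (tau Q t x u); [|easy]. rewrite E2. now field.
Qed.

Theorem theorem2 (Omega : R * R -> Prop) (A B C : R -> R -> R)
  (hOmega : region Omega)
  (hA : analytic2 Omega A) (hB : analytic2 Omega B) (hC : analytic2 Omega C)
  (hA0 : forall t x, Omega (t, x) -> A t x <> 0) :
  (* every operator has its family, after shrinking around any point where the
     coefficient of d/dt does not vanish *)
  (forall (D : R * R * R -> Prop) (Q : operator) (t x u : R),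
     region D -> subset D (cylinder Omega (fun _ => True)) ->
     reduction_operator A B C D Q ->
     D (t, x, u) -> tau Q t x u <> 0 ->
     exists (U : R * R -> Prop) (I : R -> Prop) (F : lin_family),
       region U /\ region I /\ U (t, x) /\ I u /\
       subset (cylinder U I) D /\
       nonvanishing (cylinder U I) (tau Q) /\
       two_parametric_solution_family A B C U F /\
       corresponds A B C U I Q F) /\
  (* every family comes from an operator, after shrinking inside any given
     subregion *)
  (forall (U V : R * R -> Prop) (F : lin_family),
     region U -> subset U Omega ->
     two_parametric_solution_family A B C U F ->
     region V -> subset V U ->
     exists (W : R * R -> Prop) (Q : operator),
       region W /\ subset W V /\
       reduction_operator A B C (cylinder W (fun _ => True)) Q /\
       nonvanishing (cylinder W (fun _ => True)) (tau Q) /\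
       two_parametric_solution_family A B C W F /\
       corresponds A B C W (fun _ => True) Q F) /\
  (* operators are equivalent exactly when their families are *)
  (forall (U : R * R -> Prop) (I : R -> Prop) (Q Q' : operator)
          (F F' : lin_family),
     region U -> subset U Omega -> region I ->
     reduction_operator A B C (cylinder U I) Q ->
     nonvanishing (cylinder U I) (tau Q) ->
     reduction_operator A B C (cylinder U I) Q' ->
     nonvanishing (cylinder U I) (tau Q') ->
     two_parametric_solution_family A B C U F ->
     two_parametric_solution_family A B C U F' ->
     corresponds A B C U I Q F -> corresponds A B C U I Q' F' ->
     (operator_equiv (cylinder U I) Q Q' <-> family_equiv U F F')).
Proof.
  split; [|split].
  - intros D Q t x u HD DO HQ Dp T.
    now apply reduction_operator_family with Omega.
  - intros U V F HU UO HF HV VU.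
    now apply family_reduction_operator with Omega U.
  - intros U I Q Q' F F' HU _ HI HQ NQ HQ' NQ' HF HF' CQ CQ'. split.
    + intros HE f. pose proof (operator_equiv_sym _ _ _ HE) as HE'. split.
      * apply (corresponding_family_member A B C U I Q Q' F F'); auto.
        intros V k; now apply (operator_equiv_invariant U I).
      * apply (corresponding_family_member A B C U I Q' Q F' F); auto.
        intros V k; now apply (operator_equiv_invariant U I).
    + now apply (family_equiv_operator_equiv A B C U I Q Q' F F').
Qed.
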